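(* Let $X$ be the blow-up of $\mathbb CP^2$ at four points in general position with the monotone symplectic structure $[\omega]=c_1$. Let $S_1,S_2,S_3,S_4$ be the Lagrangian spheres and $L$ the monotone Lagrangian torus with critical points $b_1,b_2$ of $W_L$ described in the context, and let $\mathcal L$ be a finite family of Lagrangians as in the context that contains $S_1,S_2,S_3,S_4,L$. Then the six objects $S_1,S_2,S_3,S_4,(L,b_1),(L,b_2)$ (four Lagrangian spheres, and two monotone Lagrangian tori with Maurer–Cartan elements) split generate $\mathrm{Fuk}(X)^{\mathcal L}$. Moreover, the quantum cohomology $QH^\bullet(X)$ is semi-simple.
   Context: **Setting.** $(X,\omega)$ is a compact symplectic manifold of real dimension $2n$ (here $n=2$) with a compatible almost complex structure. $\Lambda=\{\sum_{i\ge0}a_iT^{\lambda_i}\mid a_i\in\mathbb C,\lambda_i\in\mathbb R,\lambda_i\to\infty\}$ is the universal Novikov field (algebraically closed), $\Lambda_0$ its valuation ring, $\Lambda_+$ the maximal ideal. Everything is $\mathbb Z/2$-graded; $|x|'=|x|-1$. $QH^\bullet(X)=H^\bullet(X;\Lambda)$ with quantum product $*$: $\langle x_1*x_2,x_3\rangle_X=\sum_{\alpha\in H_2(X;\mathbb Z)}T^{\omega(\alpha)/2\pi}\mathrm{GW}_3(\alpha;x_1,x_2,x_3)$ (genus $0$ Gromov–Witten invariants), $\langle x,y\rangle_X=\int_Xx\cup y$, unit $1_X$. A subcategory $\mathscr B\subset\mathscr A$ split generates $\mathscr A$ if the inclusion $D^\pi(\mathscr B)\subset D^\pi(\mathscr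 A)$ is an equivalence, where $D^\pi$ is $H^0$ of the split closure of twisted complexes. **Disk operators.** For a compact oriented spin Lagrangian $L$ with Maslov class $\mu_L\in H^2(X,L;\mathbb Z)$ one is given the Fukaya–Oh–Ohta–Ono maps $m_{s,\beta}:H^\bullet(L;\mathbb C)^{\otimes s}\to H^\bullet(L;\mathbb C)$, $\beta\in H_2(X,L;\mathbb Z)$, built from moduli spaces $\mathscr M_{s+1}(L;\beta)$ of stable disks of class $\beta$ with $s+1$ boundary marked points, with: (i) degree $2-s-\mu_L(\beta)$; (ii) $m_{s,\beta}\neq0$ implies $\beta=\beta_1+\cdots+\beta_m$ with $\mathscr M_{s+1}(L;\beta_i)\ne\emptyset$; (iii) $m_{0,0}=m_{1,0}=0$, $m_{2,0}(x_1,x_2)=(-1)^{|x_1||x_2|+|x_1|}x_1\cup x_2$; (iv) $\sum_{s_1+s_2=s+1,\,\beta_1+\beta_2=\beta}(-1)^{|x_1|'+\cdots+|x_i|'}m_{s_1,\beta_1}(x_1,\dots,x_i,m_{s_2,\beta_2}(x_{i+1},\dots),\dots,x_s)=0$; (v) $m_{s,\beta}(\dots,1_L,\dots)=0$ if $\beta\ne0$ or $s\ge3$; (vi) $\langle m_{s,\beta}(x_1,\dots,x_s),x_0\rangle_{\rm cyc}=(-1)^{|x_0|'(|x_1|'+\cdots+|x_s|')}\langle m_{s,\beta}(x_0,\dots,x_{s-1}),x_s\rangle_{\rm cyc}$ for $\langle x_1,x_2\rangle_{\rm cyc}=(-1)^{|x_1||x_2|+|x_1|}\int_Lx_1\cup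 x_2$. A Maurer–Cartan element is a pair $b=(\rho,b_+)$, $\rho:\pi_1(L)\to\mathbb C^\times$, $b_+\in H^{\rm odd}(L;\Lambda_+)$, with $\sum_{s,\beta}\rho(\partial\beta)T^{\omega(\beta)/2\pi}m_{s,\beta}(b_+,\dots,b_+)=W_{L,b}\cdot1_L$ for some $W_{L,b}\in\Lambda$; $L$ is weakly unobstructed if one exists. **Fukaya category (standing assumption).** $\mathcal L$ is a finite set of weakly unobstructed, pairwise transverse, compact oriented spin Lagrangians. There is an $n$-cyclic strictly unital $A_\infty$ category $\mathrm{Fuk}(X)^{\mathcal L}$ over $\Lambda$ (finite-dimensional hom spaces, non-degenerate degree-$n$ pairings $\langle\,,\rangle_{\rm cyc}:\hom(A,B)\otimes\hom(B,A)\to\Lambda$ with $\langle m_{s-1}(x_1,\dots,x_{s-1}),x_s\rangle_{\rm cyc}=(-1)^{|x_s|'(|x_1|'+\cdots+|x_{s-1}|')}\langle m_{s-1}(x_s,x_1,\dots,x_{s-2}),x_{s-1}\rangle_{\rm cyc}$). Objects: pairs $(L,b)$ with $L\in\mathcal L$, $b$ a Maurer–Cartan element of $L$. $\hom((L_1,b_1),(L_2,b_2))$ is $0$ if $W_{L_1,b_1}\ne W_{L_2,b_2}$; otherwise $H^\bullet(L_1;\mathscr Hom(\rho_1,\rho_2))\otimes\Lambda$ if $L_1=L_2$ (local system $\rho_2\rho_1^{-1}$), and $\bigoplus_{p\in L_1\cap L_2}\Lambda\langle p\rangle$ if $L_1\neq L_2$. For objects $(L,b_i)$, $b_i=(\rho,b_{i,+})$,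 with the same $L,\rho,W$: $m_s(x_1,\dots,x_s)=\sum_{l_i\ge0,\beta}\rho(\partial\beta)T^{\omega(\beta)/2\pi}m_{s+l_0+\cdots+l_s,\beta}(b_{0,+}^{\otimes l_0},x_1,b_{1,+}^{\otimes l_1},\dots,x_s,b_{s,+}^{\otimes l_s})$, unit $1_L$, pairing as in (vi). $HF^\bullet(L,b)=H^\bullet\hom((L,b),(L,b))$ is a ring with $x\cdot y=(-1)^{|x||y|+|x|}[m_2](x,y)$. **Open-closed maps (standing assumption).** $HH^\bullet$, $HH_\bullet$ are Hochschild cohomology (a unital ring) and homology (a module over it by cap product), $\langle\,,\rangle_{\rm Muk}$ the Mukai pairing on $HH_\bullet$; on length-$0$ classes $x_0\in H^\bullet\hom(A,A)$, $x_0'\in H^\bullet\hom(A',A')$ it is $\mathrm{str}(x''\mapsto(-1)^{|x_0||x''|+|x_0||x_0'|}x_0\cdot x''\cdot x_0')$ on $H^\bullet\hom(A,A')$. The cyclic structure gives $\langle\varphi,x_0[x_1|\cdots|x_s]\rangle_{\rm cyc}=(-1)^{|x_0|'(|x_1|'+\cdots+|x_s|')}\langle\varphi_s(x_1,\dots,x_s),x_0\rangle_{\rm cyc}$ on $HH^\bullet\otimes HH_\bullet$. There is $\mathfrak q:QH^\bullet(X)\to HH^\bullet(\mathrm{Fuk}(X)^{\mathcal L})$; $\mathfrak p:HH_\bullet(\mathrm{Fuk}(X)^{\mathcal L})\to QH^{\bullet+n}(X)$ is defined by $\langle x,\mathfrak p(\mathbb X)\rangle_X=(-1)^{n|\mathbb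 X|}\langle\mathfrak q(x),\mathbb X\rangle_{\rm cyc}$. They satisfy: (1) $\mathfrak q$ is a unital ring homomorphism; (2) for $\eta\in H^2_c(X\setminus L;\mathbb C)$ the length-$0$ component of $\mathfrak q(\eta)$ at $(L,b)$ is $\sum_{\beta,s}\langle\eta,\beta\rangle\rho(\partial\beta)T^{\omega(\beta)/2\pi}m_{s,\beta}(b_+,\dots,b_+)$; (3) $\langle\mathfrak p(\mathbb X),\mathfrak p(\mathbb X')\rangle_X=(-1)^{n(n+1)/2+\sigma}\langle\mathbb X,\mathbb X'\rangle_{\rm Muk}$ with $\sigma$ depending only on the parities of $n$ and $|\mathbb X|$; (4) $\mathfrak p(1_L)=[L]$, where $\int_Lx|_L=\int_X[L]\cup x$. **Potential function.** If every $\beta\ne0$ with $\mathscr M_1(L;\beta)\ne\emptyset$ has $\mu_L(\beta)\ge2$ (e.g. $L$ monotone), and $H_1(L;\mathbb Z)$ is torsion free, then $m_{0,\beta}(1)=n_\beta1_L$ with $n_\beta\in\mathbb Q$, $m_{s,\beta}(b_+,\dots,b_+)=\frac{\langle\partial\beta,b_+\rangle^s}{s!}m_{0,\beta}(1)$ for $b_+\in H^1$, and all $(\rho,b_+)$ with $b_+\in H^1(L;\Lambda_+)$ are Maurer–Cartan elements, identified via $\rho e^{b_+}$ with points of $H^1(L;\Lambda_{=0}):=\mathrm{Hom}(H_1(L;\mathbb Z),\Lambda_0^* )$. The potential is $W_L=\sum_{\mu_L(\beta)=2}n_\beta T^{\omega(\beta)/2\pi}y^{\partial\beta}$, with $W_L(b)=W_{L,b}$.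 **The Lagrangians (known results).** Let $H\in H^2(X;\mathbb Z)$ be the pullback of the hyperplane class and $E_1,\dots,E_4$ the Poincaré duals of the exceptional divisors, so $c_1=3H-E_1-E_2-E_3-E_4$; $X$ has a unique symplectic structure with $[\omega]=c_1$. By Li–Wu there are oriented Lagrangian spheres $S_1,\dots,S_4$ with $[S_i]=E_i-E_{i+1}$ ($i=1,2,3$) and $[S_4]=H-E_1-E_2-E_3$; each has a unique spin structure, is weakly unobstructed, and $S_i$ also denotes the object $(S_i,0)$. By Pascaleff–Tonkonog there is a monotone Lagrangian torus $L$ with a spin structure whose potential, in a suitable basis of $H_1(L;\mathbb Z)$, is $W_L=\big((1+y_1+y_2)(1+\tfrac1{y_1})(1+\tfrac1{y_2})-3\big)T$. It has three critical points $b_1,b_2,b_3$, all non-degenerate, with critical values $\tfrac{5+5\sqrt5}2T$, $\tfrac{5-5\sqrt5}2T$, $-3T$ respectively. After Hamiltonian perturbation $S_1,\dots,S_4,L$ are pairwise transverse. *)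

(* Defs.v *)
From HB Require Import structures.
From mathcomp Require Import all_boot all_order all_algebra.
From mathcomp Require Import finmap.
From mathcomp Require Import mathcomp_extra boolp classical_sets functions.
From mathcomp Require Import cardinality fsbigop reals.
From mathcomp Require Import complex.
From mathcomp Require Import ring.

Set Implicit Arguments.
Unset Strict Implicit.
Unset Printing Implicit Defensive.

Import Order.TTheory GRing.Theory Num.Theory.

Local Open Scope classical_set_scope.
Local Open Scope ring_scope.
Local Open Scope complex_scope.

(**md**************************************************************************)
(* # Split generation of a Fukaya category in dimension four                  *)
(*                                                                            *)
(* X is the blow-up of CP^2 at four general points, n = 2.  Gromov-Witten     *)
(* invariants, the disk operators of Lagrangians, the Fukaya category and the *)
(* open-closed maps enter as data; the properties they are known or assumed   *)
(* to have are Prop-valued records about these data.                          *)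
(*                                                                            *)
(* Conventions.                                                               *)
(* - The exponent of T is area = omega / 2 pi, and the symplectic form is     *)
(*   normalised by omega / 2 pi = c_1.                                        *)
(* - Finite dimensional graded vector spaces over C are given by a            *)
(*   homogeneous basis; multilinear maps by their structure constants.        *)
(* - Over Lambda, a Z/2-grading is an involution tau = (-1)^{|x|}.  Then      *)
(*   kos = - tau is (-1)^{|x|'} with |x|' = |x| - 1, so that Koszul signs in  *)
(*   prefixes are obtained by applying kos to each entry of the prefix.       *)
(******************************************************************************)

(** ** The universal Novikov field *)

(* K is the field of the series sum_i a_i T^{l_i}, a_i complex, l_i real,
   l_i -> oo: nov_coef x l is the coefficient of T^l in x.  The axioms
   determine K up to a unique isomorphism compatible with nov_coef. *)
Record novikov (R : realType) (K : fieldType) := Novikov {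
  nov_coef : K -> R -> R[i];
  nov_mono : R[i] -> R -> K;  (* a T^l *)
  nov_coef_inj : forall x y, nov_coef x =1 nov_coef y -> x = y;
  nov_coef_fin : forall x c, finite_set [set l | l <= c /\ nov_coef x l != 0];
  nov_coef_surj : forall f : R -> R[i],
    (forall c, finite_set [set l | l <= c /\ f l != 0]) ->
    exists x, nov_coef x =1 f;
  nov_coefD : forall x y l, nov_coef (x + y) l = nov_coef x l + nov_coef y l;
  nov_coefM : forall x y l,
    nov_coef (x * y) l = \sum_(a \in [set: R]) (nov_coef x a * nov_coef y (l - a));
  nov_coef1 : forall l, nov_coef 1 l = (l == 0)%:R;
  nov_coef_mono : forall a e l, nov_coef (nov_mono a e) l = if l == e then a else 0
}.

Section NovikovSums.
Variables (R : realType) (K : fieldType) (N : novikov R K).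

Definition novC (a : R[i]) : K := nov_mono N a 0.
Definition novT (e : R) : K := nov_mono N 1 e.

(* The valuation ring and its maximal ideal. *)
Definition nov_val_ring (x : K) : Prop := forall l, l < 0 -> nov_coef N x l = 0.
Definition nov_plus (x : K) : Prop := forall l, l <= 0 -> nov_coef N x l = 0.

(* The family F converges T-adically, with sum s. *)
Definition nov_sum (I : choiceType) (F : I -> K) (s : K) : Prop :=
  (forall c, finite_set [set i | exists2 l, l <= c & nov_coef N (F i) l != 0]) /\
  (forall l, nov_coef N s l = \sum_(i \in [set: I]) nov_coef N (F i) l).

(* Lambda-multilinear extension of the structure constants f. *)
Definition mlext d (f : seq 'I_d -> 'rV[R[i]]_d) (xs : seq 'rV[K]_d) : 'rV[K]_d :=
  \sum_(t : (size xs).-tuple 'I_d)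
    (\prod_(k < size xs) (nth 0 xs k) 0 (tnth t k)) *: map_mx novC (f t).

End NovikovSums.

Definition bilin (K : pzRingType) d (c : 'I_d -> 'I_d -> 'rV[K]_d)
    (x y : 'rV[K]_d) : 'rV[K]_d :=
  \sum_i \sum_j (x 0 i * y 0 j) *: c i j.

(** ** The cohomology of X *)

(* H^*(X; K) = 'rV[K]_7 in the basis 1, H, E_1, ..., E_4, [pt]. *)
Definition degX (k : 'I_7) : nat := nth 0%N [:: 0; 2; 2; 2; 2; 2; 4] k.

Section CohomologyX.
Variable K : pzRingType.
Implicit Types x y : 'rV[K]_7.

Definition oneX : 'rV[K]_7 := delta_mx 0 (inord 0).
Definition ptX : 'rV[K]_7 := delta_mx 0 (inord 6).
Definition intX x : K := x 0 (inord 6).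

(* H.H = 1, E_i.E_i = -1. *)
Definition qformX x y : K :=
  x 0 (inord 1) * y 0 (inord 1)
  - \sum_(2 <= k < 6) x 0 (inord k) * y 0 (inord k).

Definition cupX x y : 'rV[K]_7 :=
  x 0 (inord 0) *: y + y 0 (inord 0) *: x
  - (x 0 (inord 0) * y 0 (inord 0)) *: oneX + qformX x y *: ptX.

Definition pairX x y : K := intX (cupX x y).

(* H_2(X; Z) = H^2(X; Z) = 'rV[int]_5 by Poincare duality, in the basis
   H, E_1, ..., E_4. *)
Definition h2X (al : 'rV[int]_5) : 'rV[K]_7 :=
  \row_(k < 7) if (0 < k < 6)%N then (al 0 (inord k.-1))%:~R else 0.

End CohomologyX.

Definition row5 (s : seq int) : 'rV[int]_5 := \row_k nth 0 s k.

Definition c1X : 'rV[int]_5 := row5 [:: 3; -1; -1; -1; -1].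

Definition c1num (al : 'rV[int]_5) : int := pairX (h2X int c1X) (h2X int al).

Definition sphere_class (i : 'I_4) : 'rV[int]_5 :=
  row5 (nth [::] [:: [:: 0; 1; -1; 0; 0];
                     [:: 0; 0; 1; -1; 0];
                     [:: 0; 0; 0; 1; -1];
                     [:: 1; -1; -1; -1; 0]] i).

(** ** Quantum cohomology *)

Section QuantumCohomology.
Variables (R : realType) (K : fieldType) (N : novikov R K).

(* gw al i j k is GW_3(al; e_i, e_j, e_k), and qcoef i j is e_i * e_j. *)
Record quantum_data := QuantumData {
  gw : 'rV[int]_5 -> 'I_7 -> 'I_7 -> 'I_7 -> rat;
  qcoef : 'I_7 -> 'I_7 -> 'rV[K]_7
}.

Definition qmul (Q : quantum_data) (x y : 'rV[K]_7) : 'rV[K]_7 :=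
  bilin (qcoef Q) x y.

Record quantum_axioms (Q : quantum_data) : Prop := QuantumAxioms {
  gw_degree : forall al i j k, gw Q al i j k != 0 ->
    (degX i + degX j + degX k)%:Z = 4 + 2 * c1num al;
  gw_swap12 : forall al i j k, gw Q al i j k = gw Q al j i k;
  gw_swap23 : forall al i j k, gw Q al i j k = gw Q al i k j;
  gw_zero : forall i j k,
    gw Q 0 i j k = intX (cupX (cupX (delta_mx 0 i) (delta_mx 0 j)) (delta_mx 0 k));
  gw_fundamental : forall al j k, al != 0 -> gw Q al (inord 0) j k = 0;
  gw_effective : forall al i j k,
    al != 0 -> gw Q al i j k != 0 -> 0 < c1num al;
  gw_compact : forall c : int,
    finite_set [set al | c1num al <= c /\ exists i j k, gw Q al i j k != 0];
  qcoef_gw : forall i j k,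
    nov_sum N (fun al => nov_mono N (ratr (gw Q al i j k)) (c1num al)%:~R)
      (pairX (qcoef Q i j) (delta_mx 0 k));
  qmulA : associative (qmul Q)
}.

Definition qideal (Q : quantum_data) (I : {vspace 'rV[K]_7}) : Prop :=
  forall a x, x \in I -> qmul Q a x \in I.

(* Every ideal has a complementary ideal.  QH(X) is commutative and contains
   K, so its ideals are the subspaces stable under multiplication. *)
Definition semisimple_QH (Q : quantum_data) : Prop :=
  forall I, qideal Q I ->
  exists J, [/\ qideal Q J, (I + J)%VS = fullv & (I :&: J)%VS = 0%VS].

End QuantumCohomology.

(** ** Lagrangians and disk operators *)

(* Data of a compact oriented spin Lagrangian L in X.  Since C^* is abelian, a
   homomorphism pi_1(L) -> C^* is a homomorphism H_1(L; Z) -> C^*.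
   H^*(L; C) = 'rV[R[i]]_lg_dim in a homogeneous basis e_k. *)
Record lagrangian (R : realType) := Lagrangian {
  lg_H1 : zmodType;                            (* H_1(L; Z) *)
  lg_H2 : zmodType;                            (* H_2(X, L; Z) *)
  lg_j : {additive 'rV[int]_5 -> lg_H2};       (* H_2(X) -> H_2(X, L) *)
  lg_bd : {additive lg_H2 -> lg_H1};
  lg_mu : {additive lg_H2 -> int};             (* Maslov class *)
  lg_area : {additive lg_H2 -> R};
  lg_class : 'rV[int]_5;                       (* [L] in H^2(X; Z) *)
  lg_dim : nat;
  lg_deg : 'I_lg_dim -> nat;
  lg_cup : 'I_lg_dim -> 'I_lg_dim -> 'rV[R[i]]_lg_dim;
  lg_one : 'rV[R[i]]_lg_dim;
  lg_int : 'I_lg_dim -> R[i];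
  lg_res : 'I_7 -> 'rV[R[i]]_lg_dim;           (* H^*(X) -> H^*(L) *)
  lg_kron : lg_H1 -> 'I_lg_dim -> R[i];        (* <gamma, e_k> *)
  lg_loc : (lg_H1 -> R[i]) -> nat -> vectType R[i];
    (* cohomology of L in the rank one local system of a given holonomy *)
  lg_moduli : nat -> lg_H2 -> Prop;
    (* the moduli space of disks of a given class with a given number of
       boundary marked points is non-empty *)
  lg_m : lg_H2 -> seq 'I_lg_dim -> 'rV[R[i]]_lg_dim;
    (* lg_m beta [:: k_1; ...; k_s] = m_{s,beta}(e_{k_1}, ..., e_{k_s}) *)
  lg_n : lg_H2 -> rat                          (* disk counts n_beta *)
}.

Section LagrangianAxioms.
Variables (R : realType) (L : lagrangian R).
Implicit Types x y z : 'rV[R[i]]_(lg_dim L).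

Definition cupL x y := bilin (@lg_cup _ L) x y.
Definition intL x : R[i] := \sum_k x 0 k * lg_int k.
Definition resL (x : 'rV[R[i]]_7) := \sum_k x 0 k *: lg_res L k.
Definition cohdeg (K : fieldType) (p : nat) (x : 'rV[K]_(lg_dim L)) : Prop :=
  forall k, x 0 k != 0 -> lg_deg k = p.
Definition betti (p : nat) : nat := #|[pred k : 'I_(lg_dim L) | lg_deg k == p]|.

(* <e_k, e_l>_cyc *)
Definition cycL (k l : 'I_(lg_dim L)) : R[i] :=
  (-1) ^+ (lg_deg k * lg_deg l + lg_deg k) * intL (lg_cup k l).
(* <x, e_l>_cyc *)
Definition cycLv x (l : 'I_(lg_dim L)) : R[i] := \sum_k x 0 k * cycL k l.

(* m_{s,beta}(u, x, v) with u and v lists of basis elements. *)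
Definition lg_ins beta (u : seq 'I_(lg_dim L)) x (v : seq 'I_(lg_dim L)) :=
  \sum_k x 0 k *: lg_m beta (u ++ k :: v).

(* |e_{k_1}|' + ... + |e_{k_s}|' modulo 2 *)
Definition sdeg (u : seq 'I_(lg_dim L)) : nat := \sum_(k <- u) (lg_deg k).+1.

Definition is_hol (rho : lg_H1 L -> R[i]) : Prop :=
  rho 0 = 1 /\ forall g h, rho (g + h) = rho g * rho h.

Record lagrangian_axioms : Prop := LagrangianAxioms {
  (* topology of the pair (X, L) *)
  lg_j_class : lg_j L (lg_class L) = 0;
  lg_bdj : forall al, lg_bd L (lg_j L al) = 0;
  lg_bd_exact : forall b, lg_bd L b = 0 -> exists al, b = lg_j L al;
  lg_muj : forall al, lg_mu L (lg_j L al) = 2 * c1num al;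
  lg_mu_even : forall b, exists c, lg_mu L b = 2 * c;
  lg_areaj : forall al, lg_area L (lg_j L al) = (c1num al)%:~R;
  (* the cohomology ring of L, a closed oriented surface *)
  lg_deg_le : forall k : 'I_(lg_dim L), (lg_deg k <= 2)%N;
  lg_cup_deg : forall k l : 'I_(lg_dim L), cohdeg (lg_deg k + lg_deg l) (lg_cup k l);
  lg_cupA : associative cupL;
  lg_cupC : forall k l : 'I_(lg_dim L),
    lg_cup k l = (-1) ^+ (lg_deg k * lg_deg l) *: lg_cup l k;
  lg_one_deg : cohdeg 0 (lg_one L);
  lg_cup1 : left_id (lg_one L) cupL;
  lg_one_neq0 : lg_one L != 0;
  lg_int_deg : forall k : 'I_(lg_dim L), lg_int k != 0 -> lg_deg k = 2%N;
  lg_poincare : forall x, (forall y, intL (cupL x y) = 0) -> x = 0;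
  lg_kronD : forall g h (k : 'I_(lg_dim L)),
    lg_kron (g + h) k = lg_kron g k + lg_kron h k;
  lg_kron_deg : forall g (k : 'I_(lg_dim L)), lg_kron g k != 0 -> lg_deg k = 1%N;
  lg_kron_iso : forall f : {additive lg_H1 L -> R[i]},
    exists! x, cohdeg 1 x /\ forall g, f g = \sum_k x 0 k * lg_kron g k;
  lg_loc1 : forall p, \dim {: lg_loc (fun _ : lg_H1 L => 1) p} = betti p;
  lg_res_deg : forall k, cohdeg (degX k) (lg_res L k);
  lg_res1 : resL (oneX R[i]) = lg_one L;
  lg_resM : forall x y : 'rV[R[i]]_7, resL (cupX x y) = cupL (resL x) (resL y);
  lg_res_class : forall x : 'rV[R[i]]_7, intL (resL x) = pairX (h2X R[i] (lg_class L)) x;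
  (* Gromov compactness, without which the sums below are meaningless *)
  lg_moduli_area : forall s b, lg_moduli s b -> b != 0 -> 0 < lg_area L b;
  lg_moduli_fin : forall c : R,
    finite_set [set b | lg_area L b <= c /\ exists s, lg_moduli s b];
  (* properties (i)-(vi) of the maps m_{s,beta} *)
  lg_m_deg : forall b t (k : 'I_(lg_dim L)), (lg_m b t) 0 k != 0 ->
    (lg_deg k)%:Z = \sum_(i <- t) (lg_deg i)%:Z + 2 - (size t)%:Z - lg_mu L b;
  lg_m_moduli : forall b (t : seq 'I_(lg_dim L)), lg_m b t != 0 ->
    exists bs : seq (lg_H2 L),
      b = \sum_(c <- bs) c /\ forall c, c \in bs -> lg_moduli (size t).+1 c;
  lg_m00 : lg_m (0 : lg_H2 L) [::] = 0;
  lg_m10 : forall k : 'I_(lg_dim L), lg_m (0 : lg_H2 L) [:: k] = 0;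
  lg_m20 : forall k l : 'I_(lg_dim L), lg_m (0 : lg_H2 L) [:: k; l] =
    (-1) ^+ (lg_deg k * lg_deg l + lg_deg k) *: lg_cup k l;
  lg_m_rel : forall b (t : seq 'I_(lg_dim L)),
    \sum_(b2 \in [set: lg_H2 L])
      \sum_(i < (size t).+1) \sum_(s2 < (size t - i).+1)
        (-1) ^+ sdeg (take i t) *:
          lg_ins (b - b2) (take i t) (lg_m b2 (take s2 (drop i t)))
            (drop (i + s2) t) = 0;
  lg_m_unit : forall b u v, (b != 0) || (2 <= size u + size v)%N ->
    lg_ins b u (lg_one L) v = 0;
  lg_m_cyc : forall b t (i j : 'I_(lg_dim L)),
    cycLv (lg_m b (rcons t j)) i =
    (-1) ^+ ((lg_deg i).+1 * sdeg (rcons t j)) * cycLv (lg_m b (i :: t)) j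
}.

(* For closed oriented surfaces, the genus is determined by H_1. *)
Definition is_sphere : Prop :=
  [/\ forall g : lg_H1 L, g = 0, betti 0 = 1%N, betti 1 = 0%N & betti 2 = 1%N].

Definition is_H1_basis (g1 g2 : lg_H1 L) : Prop :=
  forall g, exists! ab : int * int, g = g1 *~ ab.1 + g2 *~ ab.2.

Definition is_torus : Prop :=
  [/\ exists g1 g2, is_H1_basis g1 g2,
      betti 0 = 1%N, betti 1 = 2%N & betti 2 = 1%N].

Definition is_monotone : Prop :=
  exists2 c : R, 0 < c & forall b, lg_area L b = c * (lg_mu L b)%:~R.

End LagrangianAxioms.

(** ** Maurer-Cartan elements and potential functions *)

Section MaurerCartan.
Variables (R : realType) (K : fieldType) (N : novikov R K).
Variable L : lagrangian R.

(* rho(d beta) T^{omega(beta)/2 pi} m_{s,beta}(x_1, ..., x_s) *)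
Definition disk_term (rho : lg_H1 L -> R[i]) (b : lg_H2 L)
    (xs : seq 'rV[K]_(lg_dim L)) : 'rV[K]_(lg_dim L) :=
  nov_mono N (rho (lg_bd L b)) (lg_area L b) *: mlext N (lg_m b) xs.

Definition oneL : 'rV[K]_(lg_dim L) := map_mx (novC N) (lg_one L).

Definition is_mc (rho : lg_H1 L -> R[i]) (bp : 'rV[K]_(lg_dim L)) (W : K) : Prop :=
  [/\ is_hol rho,
      forall k, bp 0 k != 0 -> odd (lg_deg k),
      forall k, nov_plus N (bp 0 k)
    & forall k, nov_sum N
        (fun sb : nat * lg_H2 L => (disk_term rho sb.2 (nseq sb.1 bp)) 0 k)
        (W * oneL 0 k)].

Record mc := MC {
  mc_rho : lg_H1 L -> R[i];
  mc_b : 'rV[K]_(lg_dim L);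
  mc_W : K;
  mcP : is_mc mc_rho mc_b mc_W
}.

(* Both objects have the same local system and the same value of W. *)
Definition mc_same (b b' : mc) : Prop :=
  mc_rho b =1 mc_rho b' /\ mc_W b = mc_W b'.

Definition kronK (g : lg_H1 L) (x : 'rV[K]_(lg_dim L)) : K :=
  \sum_k x 0 k * novC N (lg_kron g k).

(* The known facts on Lagrangians without disks of Maslov index < 2. *)
Definition potential_axioms : Prop :=
  (forall b, b != 0 -> lg_moduli 1 b -> 2 <= lg_mu L b) ->
  (forall (g : lg_H1 L) k, (0 < k)%N -> g *+ k = 0 -> g = 0) ->
  [/\ forall b, lg_m b [::] = ratr (lg_n b) *: lg_one L,
      forall s b (x : 'rV[K]_(lg_dim L)), cohdeg 1 x ->
        (forall k, nov_plus N (x 0 k)) ->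
        mlext N (lg_m b) (nseq s x) =
        (kronK (lg_bd L b) x ^+ s / s`!%:R) *: map_mx (novC N) (lg_m b [::])
    & forall rho x, is_hol rho -> cohdeg 1 x -> (forall k, nov_plus N (x 0 k)) ->
        exists W, is_mc rho x W].

(* y = rho(g) exp(<g, b_+>), the value at g of the point rho e^{b_+} of
   H^1(L; Lambda_{=0}). *)
Definition mc_coord (b : mc) (g : lg_H1 L) (y : K) : Prop :=
  exists2 E, nov_sum N (fun s : nat => kronK g (mc_b b) ^+ s / s`!%:R) E
           & y = novC N (mc_rho b g) * E.

End MaurerCartan.

(** Laurent polynomials in y_1, y_2 as lists of ((i, j), c), for c y_1^i y_2^j *)

Definition lpoly := seq ((int * int) * int).

Section LaurentPolynomials.
Variable K : fieldType.

Definition lp_coef (w : lpoly) (u : int * int) : int :=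
  \sum_(m <- w | m.1 == u) m.2.
Definition lp_eval (w : lpoly) (y1 y2 : K) : K :=
  \sum_(m <- w) m.2%:~R * y1 ^ m.1.1 * y2 ^ m.1.2.

End LaurentPolynomials.

Definition lp_d1 (w : lpoly) : lpoly :=
  [seq ((m.1.1 - 1, m.1.2), m.1.1 * m.2) | m <- w].
Definition lp_d2 (w : lpoly) : lpoly :=
  [seq ((m.1.1, m.1.2 - 1), m.1.2 * m.2) | m <- w].

(* W_L / T for the monotone torus, expanded: see potX_eval. *)
Definition potX : lpoly :=
  [:: ((1, 0), 1); ((0, 1), 1); ((-1, 0), 2); ((0, -1), 2);
      ((-1, -1), 1); ((1, -1), 1); ((-1, 1), 1)].

Lemma potX_eval (K : fieldType) (y1 y2 : K) : y1 != 0 -> y2 != 0 ->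
  lp_eval potX y1 y2 = (1 + y1 + y2) * (1 + y1^-1) * (1 + y2^-1) - 3.
Proof.
move=> y1N0 y2N0; rewrite /lp_eval /potX !big_cons big_nil /=.
rewrite !expr0z !expr1z !exprN1 !mulr1.
by field; rewrite y1N0 y2N0.
Qed.

Section Potential.
Variables (R : realType) (K : fieldType) (N : novikov R K).
Variable L : lagrangian R.

(* W_L = w T: for all (i, j), the sum of n_beta T^{omega(beta)/2 pi} over the
   classes beta with mu(beta) = 2 and d beta = i g1 + j g2 is the coefficient
   of y_1^i y_2^j. *)
Definition has_potential (g1 g2 : lg_H1 L) (w : lpoly) : Prop :=
  forall u : int * int,
    nov_sum N
      (fun b : lg_H2 L =>
         if (lg_mu L b == 2) && (lg_bd L b == g1 *~ u.1 + g2 *~ u.2)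
         then nov_mono N (ratr (lg_n b)) (lg_area L b) else 0)
      ((lp_coef w u)%:~R * novT N 1).

(* b is a critical point of w T with critical value v T. *)
Definition is_crit (g1 g2 : lg_H1 L) (w : lpoly) (b : mc N L) (v : R[i]) : Prop :=
  cohdeg 1 (mc_b b) /\
  exists y1 y2, [/\ mc_coord b g1 y1, mc_coord b g2 y2,
    lp_eval (lp_d1 w) y1 y2 = 0, lp_eval (lp_d2 w) y1 y2 = 0
    & lp_eval w y1 y2 = novC N v].

End Potential.

(** ** A-infinity categories *)

(* Composable sequences x_1 in hom A_0 A_1, ..., x_s in hom A_(s-1) A_s. *)
Inductive chain (K : fieldType) (Ob : Type) (hom : Ob -> Ob -> vectType K) :
    Ob -> Ob -> Type :=
  | hnil A : chain hom A A
  | hcons A B C of hom A B & chain hom B C : chain hom A C.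
Arguments hnil {K Ob hom} A.
Arguments hcons {K Ob hom A B C} _ _.

Section Chains.
Variables (K : fieldType) (Ob : Type) (hom : Ob -> Ob -> vectType K).

Fixpoint capp A B C (p : chain hom A B) : chain hom B C -> chain hom A C :=
  match p with
  | hnil _ => id
  | hcons _ _ _ x p' => fun q => hcons x (capp p' q)
  end.

Definition crcons A B C (p : chain hom A B) (x : hom B C) : chain hom A C :=
  capp p (hcons x (hnil C)).

Fixpoint csize A B (p : chain hom A B) : nat :=
  if p is hcons _ _ _ _ p' then (csize p').+1 else 0%N.

Fixpoint cmap (f : forall A B, hom A B -> hom A B) A B (p : chain hom A B) :
    chain hom A B :=
  match p with
  | hnil A => hnil A
  | hcons _ _ _ x p' => hcons (f _ _ x) (cmap f p')
  end.

(* The decompositions p = p1 ++ p2. *)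
Definition csplit A B := {C : Ob & (chain hom A C * chain hom C B)%type}.
Definition cfst A B (u : csplit A B) := (projT2 u).1.
Definition csnd A B (u : csplit A B) := (projT2 u).2.

Fixpoint csplits A B (p : chain hom A B) : seq (csplit A B) :=
  match p with
  | hnil A => [:: existT _ A (hnil A, hnil A)]
  | hcons A B C x p' =>
      existT _ A (hnil A, hcons x p') ::
      [seq existT _ (projT1 u) (hcons x (cfst u), csnd u) | u <- csplits p']
  end.

Definition multilinear (f : forall A B, chain hom A B -> hom A B) : Prop :=
  forall A B C D (p : chain hom A B) (q : chain hom C D) a (x y : hom B C),
    f _ _ (capp p (hcons (a *: x + y) q)) =
    a *: f _ _ (capp p (hcons x q)) + f _ _ (capp p (hcons y q)).

End Chains.

Record ainf (K : fieldType) (Ob : Type) := Ainf {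
  hom : Ob -> Ob -> vectType K;
  tau : forall A B, 'End(hom A B);
  mm : forall A B, chain hom A B -> hom A B;
  unit : forall A, hom A A;
  cyc : forall A B, hom A B -> hom B A -> K
}.
Arguments tau {K Ob _ A B}.
Arguments mm {K Ob _ A B}.
Arguments cyc {K Ob _ A B}.

Section AinfCategories.
Variables (K : fieldType) (Ob : Type) (C : ainf K Ob).
Notation H := (hom C).

(* (-1)^{|x|'} x *)
Definition kos A B (x : H A B) : H A B := - tau x.
Definition kosp (d : bool) A B (x : H A B) : H A B := if d then kos x else x.

Definition m1 A B (x : H A B) : H A B := mm (hcons x (hnil B)).
Definition m2 A B D (x : H A B) (y : H B D) : H A D :=
  mm (hcons x (hcons y (hnil D))).

(* |x| = d *)
Definition has_par (d : bool) A B (x : H A B) : Prop := tau x = (-1) ^+ d *: x.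

(* The homogeneous component of parity d, as a projection and as a subspace. *)
Definition hpart (d : bool) A B (x : H A B) : H A B :=
  2^-1 *: (x + (-1) ^+ d *: tau x).
Definition hspace (d : bool) A B : {vspace H A B} :=
  lker (tau - (-1) ^+ d *: \1)%VF.

(* Z/2-graded, strictly unital, with m_0 = 0, and cyclic of even dimension n. *)
Record ainf_axioms : Prop := AinfAxioms {
  tauK : forall A B (x : H A B), tau (tau x) = x;
  mm_lin : multilinear (@mm _ _ C);
  mm_nil : forall A : Ob, mm (hnil A) = 0 :> H A A;
  mm_par : forall A B (p : chain H A B),
    tau (mm p) = (-1) ^+ csize p *: mm (cmap (fun _ _ x => tau x) p);
  mm_rel : forall A B (p : chain H A B),
    \sum_(u <- csplits p) \sum_(v <- csplits (csnd u))
      mm (capp (cmap kos (cfst u)) (hcons (mm (cfst v)) (csnd v))) = 0;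
  unit_par : forall A, has_par false (unit C A);
  unit_m1 : forall A, m1 (unit C A) = 0;
  unit_l : forall A B (x : H A B), m2 (unit C A) x = x;
  unit_r : forall A B (x : H A B), m2 x (unit C B) = tau x;
  unit_mm : forall A B D (p : chain H A B) (q : chain H B D),
    (2 <= csize p + csize q)%N -> mm (capp p (hcons (unit C B) q)) = 0;
  cyc_linl : forall A B a (x y : H A B) (z : H B A),
    cyc (a *: x + y) z = a * cyc x z + cyc y z;
  cyc_linr : forall A B a (z : H A B) (x y : H B A),
    cyc z (a *: x + y) = a * cyc z x + cyc z y;
  cyc_par : forall A B (x : H A B) (y : H B A), cyc (tau x) (tau y) = cyc x y;
  cyc_ndl : forall A B (x : H A B), (forall y : H B A, cyc x y = 0) -> x = 0;
  cyc_ndr : forall A B (y : H B A), (forall x : H A B, cyc x y = 0) -> y = 0;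
  (* <m(p, y), z> = (-1)^{|z|'(|p|' + |y|')} <m(z, p), y> *)
  cyc_mm : forall A B D (p : chain H A B) (y : H B D) (z : H D A) d,
    has_par d z ->
    cyc (mm (crcons p y)) z =
    cyc (mm (hcons z (cmap (kosp (~~ d)) p))) (kosp (~~ d) y)
}.

(** *** The product and the supertrace on cohomology *)

(* x . y = (-1)^{|x||y| + |x|} m_2(x, y) *)
Definition hprod A B D (x : H A B) (y : H B D) : H A D :=
  \sum_(a : bool) \sum_(b : bool)
    (-1) ^+ (a * b + a) *: m2 (hpart a x) (hpart b y).

Definition lm1 A B : 'End(H A B) := linfun (@m1 A B).
Definition is_exact A B (x : H A B) : Prop := x \in limg (lm1 A B).

(* The supertrace of the endomorphism of the cohomology of hom(A, B) induced
   by f, the cohomology being identified with a complement of the image of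
   m_1 in its kernel. *)
Definition strH A B (f : H A B -> H A B) : K :=
  let Z := lker (lm1 A B) in
  let I := limg (lm1 A B) in
  let e := vbasis (Z :\: I) in
  \sum_i coord e i (addv_pi1 Z I (tau (f (tnth e i)))).

(** *** Hochschild cochains *)

Definition cochain := forall A B, chain H A B -> H A B.
Implicit Types phi psi : cochain.

(* The length s component has degree d - s. *)
Definition coch_par (d : bool) phi : Prop :=
  forall A B (p : chain H A B), tau (phi _ _ p) =
    (-1) ^+ (d + csize p) *: phi _ _ (cmap (fun _ _ x => tau x) p).

(* [m, phi], for phi of degree d; the double sums run over the decompositions
   p = p1 ++ p2 ++ p3. *)
Definition hh_diff (d : bool) phi : cochain := fun A B p =>
  \sum_(u <- csplits p) \sum_(v <- csplits (csnd u))
    (mm (capp (cmap (kosp (~~ d)) (cfst u)) (hcons (phi _ _ (cfst v)) (csnd v)))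
     - (-1) ^+ (~~ d) *:
       phi _ _ (capp (cmap kos (cfst u)) (hcons (mm (cfst v)) (csnd v)))).

(* Cup product of even cochains:
   sum over p = p1 ++ ... ++ p5 of m(p1, phi(p2), p3, psi(p4), p5), with the
   sign produced by psi (of odd shifted degree) passing p1, p2 and p3, and by
   phi passing p1; the two signs of p1 cancel. *)
Definition hh_cup phi psi : cochain := fun A B p =>
  \sum_(u <- csplits p) \sum_(v <- csplits (csnd u))
  \sum_(w <- csplits (csnd v)) \sum_(z <- csplits (csnd w))
    mm (capp (cfst u)
         (hcons (phi _ _ (cmap kos (cfst v)))
           (capp (cmap kos (cfst w)) (hcons (psi _ _ (cfst z)) (csnd z))))).

Definition hh_unit : cochain := fun A B p =>
  match p with hnil A => unit C A | hcons _ _ _ _ _ => 0 end.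

(* Equality of the classes of even cocycles in Hochschild cohomology. *)
Definition hh_eq phi phi' : Prop :=
  exists psi, [/\ multilinear psi, coch_par true psi &
    forall A B (p : chain H A B), phi _ _ p - phi' _ _ p = hh_diff true psi p].

End AinfCategories.

(** ** Twisted complexes and split generation *)

Section TwistedComplexes.
Variables (K : fieldType) (Ob : Type) (C : ainf K Ob).
Notation H := (hom C).

(* A finite direct sum of shifted objects tc_ob i [tc_sh i] with a matrix of
   morphisms.  hom(A[a], B[b]) is hom(A, B) with degrees shifted by a + b, and
   m_s is multiplied by (-1)^{a_0}, a_0 being the shift of the source of its
   first argument. *)
Record tcomplex := TComplex {
  tc_size : nat;
  tc_ob : 'I_tc_size -> Ob;
  tc_sh : 'I_tc_size -> bool;
  tc_delta : forall i j, H (tc_ob i) (tc_ob j)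
}.

Definition tmat (Y Z : tcomplex) :=
  forall (i : 'I_(tc_size Y)) (j : 'I_(tc_size Z)), H (tc_ob i) (tc_ob j).

(* Lists of composable sequences from each summand of Y to B. *)
Definition tails (Y : tcomplex) (B : Ob) :=
  forall i : 'I_(tc_size Y), seq (chain H (tc_ob i) B).

Definition tstep (Y Z : tcomplex) (a : tmat Y Z) B (S : tails Z B) : tails Y B :=
  fun i => flatten [seq [seq hcons (a i k) p | p <- S k] | k <- enum 'I_(tc_size Z)].

Fixpoint titer (Y : tcomplex) B (n : nat) (S : tails Y B) : tails Y B :=
  if n is n'.+1 then tstep (@tc_delta Y) (titer n' S) else S.

(* Insert any number of delta's in front; as delta is strictly triangular,
   sequences of tc_size Y or more delta's contribute zero. *)
Definition tstar (Y : tcomplex) B (S : tails Y B) : tails Y B :=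
  fun i => flatten [seq titer n S i | n <- iota 0 (tc_size Y)].

(* The sequences ending with the entry a i j, and those ending with a and then
   any number of delta's. *)
Definition tend (Y Z : tcomplex) (a : tmat Y Z) (j : 'I_(tc_size Z)) :
    tails Y (tc_ob j) := fun i => [:: hcons (a i j) (hnil _)].
Definition tlast (Y Z : tcomplex) (a : tmat Y Z) (j : 'I_(tc_size Z)) :
    tails Y (tc_ob j) := fun i =>
  tend a j i ++ tstep a (tstar (tend (@tc_delta Z) j)) i.

(* delta is strictly triangular and odd, and sum_s m_s(delta, ..., delta) = 0 *)
Definition is_twisted (Y : tcomplex) : Prop :=
  [/\ forall i j : 'I_(tc_size Y), (j <= i)%N -> tc_delta i j = 0,
      forall i j : 'I_(tc_size Y),
        has_par (~~ (tc_sh i (+) tc_sh j)) (tc_delta i j)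
    & forall i j : 'I_(tc_size Y),
        \sum_(p <- tstar (tend (@tc_delta Y) j) i) mm p = 0].

Definition tm1 (Y Z : tcomplex) (a : tmat Y Z) : tmat Y Z := fun i j =>
  (-1) ^+ tc_sh i *: \sum_(p <- tstar (tlast a j) i) mm p.
Definition tm2 (Y Z U : tcomplex) (a : tmat Y Z) (b : tmat Z U) : tmat Y U :=
  fun i j =>
    (-1) ^+ tc_sh i *: \sum_(p <- tstar (tstep a (tstar (tlast b j))) i) mm p.

Definition tpar (d : bool) (Y Z : tcomplex) (a : tmat Y Z) : Prop :=
  forall i j, has_par (d (+) (tc_sh i (+) tc_sh j)) (a i j).

(* Cocycles of degree 0, and equality of their classes in H^0. *)
Definition tcocycle (Y Z : tcomplex) (a : tmat Y Z) : Prop :=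
  tpar false a /\ forall i j, tm1 a i j = 0.
Definition tcohom (Y Z : tcomplex) (a b : tmat Y Z) : Prop :=
  exists2 h : tmat Y Z, tpar true h & forall i j, a i j - b i j = tm1 h i j.

(* D^pi is the idempotent completion of H^0 of twisted complexes: its objects
   are pairs (Y, e) with [e] idempotent, and its morphisms (Y, e) -> (Z, f)
   are the classes [u] with [f][u][e] = [u], so the identity of (Y, e) is [e].
   Recall that m_2(u, v) represents the composite of u followed by v. *)
Definition is_dpi (Y : tcomplex) (e : tmat Y Y) : Prop :=
  [/\ is_twisted Y, tcocycle e & tcohom (tm2 e e) e].
Definition dpi_hom (Y : tcomplex) (e : tmat Y Y) (Z : tcomplex) (f : tmat Z Z)
    (u : tmat Y Z) : Prop :=
  [/\ tcocycle u, tcohom (tm2 e u) u & tcohom (tm2 u f) u].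
Definition dpi_iso (Y : tcomplex) (e : tmat Y Y) (Z : tcomplex) (f : tmat Z Z) :
    Prop :=
  exists (u : tmat Y Z) (v : tmat Z Y),
    [/\ dpi_hom e f u, dpi_hom f e v, tcohom (tm2 u v) e & tcohom (tm2 v u) f].

(* The full subcategory on P split generates.  D^pi of it is the full
   subcategory of D^pi on the pairs (Z, f) such that all summands of Z are in
   P, so the inclusion is an equivalence iff it is essentially surjective. *)
Definition split_generates (P : Ob -> Prop) : Prop :=
  forall (Y : tcomplex) (e : tmat Y Y), is_dpi e ->
  exists (Z : tcomplex) (f : tmat Z Z),
    [/\ is_dpi f, forall i : 'I_(tc_size Z), P (tc_ob i) & dpi_iso e f].

End TwistedComplexes.

(** ** The Fukaya category *)

Section FukayaCategory.
Variables (R : realType) (K : fieldType) (N : novikov R K).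

(* The finite family of Lagrangians, as subsets of X. *)
Record lfamily := LFamily {
  lf_point : choiceType;
  lf_idx : finType;
  lf_lag : lf_idx -> lagrangian R;
  lf_set : lf_idx -> set lf_point
}.

Variable F : lfamily.

Definition fobj := {i : lf_idx F & mc N (lf_lag i)}.
Definition fob (i : lf_idx F) (b : mc N (lf_lag i)) : fobj := existT _ i b.
Definition fobW (X : fobj) : K := mc_W (projT2 X).

(* Weakly unobstructed and pairwise transverse. *)
Record lfamily_axioms : Prop := LFamilyAxioms {
  lf_lagP : forall i, lagrangian_axioms (lf_lag (l:=F) i);
  lf_potP : forall i, potential_axioms N (lf_lag (l:=F) i);
  lf_unobstructed : forall i : lf_idx F, inhabited (mc N (lf_lag i));
  lf_transverse : forall i j : lf_idx F, i != j -> finite_set (lf_set i `&` lf_set j)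
}.

(* fk_cls b b' is the identification of H^*(L; Lambda) with
   hom((L, b), (L, b')), for b and b' with the same rho and W. *)
Record fukaya := Fukaya {
  fk_cat : ainf K fobj;
  fk_cls : forall (i : lf_idx F) (b b' : mc N (lf_lag i)),
    'Hom('rV[K]_(lg_dim (lf_lag i)), hom fk_cat (fob b) (fob b'))
}.

Variable A : fukaya.
Notation C := (fk_cat A).

(* The sequence x_1 in hom(b_0, b_1), ..., x_s in hom(b_(s-1), b_s), for
   w = [:: (b_1, x_1); ...; (b_s, x_s)]. *)
Fixpoint fk_chain (i : lf_idx F) (b0 : mc N (lf_lag i))
    (w : seq (mc N (lf_lag i) * 'rV[K]_(lg_dim (lf_lag i)))) :
    chain (hom C) (fob b0) (fob (last b0 (unzip1 w))) :=
  match w with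
  | [::] => hnil (fob b0)
  | bx :: w' => hcons (fk_cls A b0 bx.1 bx.2) (fk_chain bx.1 w')
  end.

(* b_0^{l_0}, x_1, b_1^{l_1}, ..., x_s, b_s^{l_s} *)
Fixpoint fk_insert (i : lf_idx F) (b0 : mc N (lf_lag i))
    (w : seq (mc N (lf_lag i) * 'rV[K]_(lg_dim (lf_lag i)))) (l : seq nat) :
    seq 'rV[K]_(lg_dim (lf_lag i)) :=
  nseq (head 0%N l) (mc_b b0) ++
  match w with
  | [::] => [::]
  | bx :: w' => bx.2 :: fk_insert bx.1 w' (behead l)
  end.

Record fukaya_axioms : Prop := FukayaAxioms {
  fk_ainf : ainf_axioms C;
  fk_hom0 : forall X Y : fobj, fobW X <> fobW Y -> \dim {: hom C X Y} = 0%N;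
  fk_hom_same : forall (i : lf_idx F) (b b' : mc N (lf_lag i)),
    mc_W b = mc_W b' -> forall d : bool,
    \dim (hspace C d (fob b) (fob b')) =
    (\sum_(p < 3 | odd p == d)
       \dim {: lg_loc (fun g => mc_rho b' g / mc_rho b g) p})%N;
  fk_cls_bij : forall (i : lf_idx F) (b b' : mc N (lf_lag i)),
    mc_same b b' -> bijective (fk_cls A b b');
  fk_cls_par : forall (i : lf_idx F) (b b' : mc N (lf_lag i)) x,
    mc_same b b' ->
    tau (fk_cls A b b' x) =
    fk_cls A b b' (\row_k ((-1) ^+ lg_deg k * x 0 k));
  fk_hom_diff : forall (i j : lf_idx F) (b : mc N (lf_lag i)) (b' : mc N (lf_lag j)),
    i != j -> mc_W b = mc_W b' ->
    exists2 e : lf_point F -> hom C (fob b) (fob b'),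
      basis_of fullv [seq e x | x <- fset_set (lf_set i `&` lf_set j)]
      & forall x, exists d, has_par d (e x);
  fk_m : forall (i : lf_idx F) (b0 : mc N (lf_lag i))
      (w : seq (mc N (lf_lag i) * 'rV[K]_(lg_dim (lf_lag i)))),
    (0 < size w)%N ->
    (forall k, (k < size w)%N -> mc_same b0 (nth b0 (unzip1 w) k)) ->
    exists2 v : 'rV[K]_(lg_dim (lf_lag i)),
      (forall k, nov_sum N
         (fun z : (size w).+1.-tuple nat * lg_H2 (lf_lag i) =>
            (disk_term N (mc_rho b0) z.2 (fk_insert b0 w z.1)) 0 k) (v 0 k))
      & mm (fk_chain b0 w) = fk_cls A b0 (last b0 (unzip1 w)) v;
  fk_unit : forall (i : lf_idx F) (b : mc N (lf_lag i)),
    unit C (fob b) = fk_cls A b b (oneL N (lf_lag i));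
  fk_cyc : forall (i : lf_idx F) (b b' : mc N (lf_lag i)) x y,
    mc_same b b' ->
    cyc (fk_cls A b b' x) (fk_cls A b' b y) =
    \sum_k \sum_l x 0 k * y 0 l * novC N (cycL k l)
}.

(** *** Open-closed maps *)

(* oc_q x is a cocycle representing q(x), and oc_p x0 p is the image of the
   Hochschild chain x_0[x_1|...|x_s], p = (x_1, ..., x_s).  QH(X) is
   concentrated in even degrees, hence so is the image of q. *)
Record open_closed := OpenClosed {
  oc_q : 'rV[K]_7 -> cochain C;
  oc_p : forall X Y, hom C Y X -> chain (hom C) X Y -> 'rV[K]_7;
  oc_sigma : bool -> bool
}.

Definition q0 (O : open_closed) (x : 'rV[K]_7) (X : fobj) : hom C X X :=
  oc_q O x (hnil X).
Definition p0 (O : open_closed) (X : fobj) (x0 : hom C X X) : 'rV[K]_7 :=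
  oc_p O x0 (hnil X).

Record open_closed_axioms (Q : quantum_data K) (O : open_closed) : Prop :=
  OpenClosedAxioms {
  oc_q_lin : forall a x y X Y (p : chain (hom C) X Y),
    oc_q O (a *: x + y) p = a *: oc_q O x p + oc_q O y p;
  oc_q_mul : forall x, multilinear (oc_q O x);
  oc_q_par : forall x, coch_par false (oc_q O x);
  oc_q_closed : forall x X Y (p : chain (hom C) X Y),
    hh_diff false (oc_q O x) p = 0;
  (* q is a unital ring homomorphism *)
  oc_q1 : hh_eq (oc_q O (oneX K)) (@hh_unit _ _ C);
  oc_qM : forall x y,
    hh_eq (oc_q O (qmul Q x y)) (hh_cup (oc_q O x) (oc_q O y));
  (* <x, p(x_0[x_1|...|x_s])>_X =
     (-1)^{|x_0|'(|x_1|' + ... + |x_s|')} <q(x)_s(x_1, ..., x_s), x_0>_cyc *)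
  oc_p_adj : forall x X Y (x0 : hom C Y X) (p : chain (hom C) X Y),
    pairX x (oc_p O x0 p) =
    \sum_(d : bool) cyc (oc_q O x (cmap (@kosp _ _ C (~~ d)) p)) (hpart d x0);
  (* the length 0 component of q(eta), eta in H^2(X, L; C) =
     Hom(H_2(X, L; Z), C) with image x in H^2(X; C) *)
  oc_q_rel : forall (i : lf_idx F) (b : mc N (lf_lag i))
      (eta : {additive lg_H2 (lf_lag i) -> R[i]}) (x : 'rV[R[i]]_7),
    (forall k, x 0 k != 0 -> degX k = 2%N) ->
    (forall al, pairX x (h2X R[i] al) = eta (lg_j (lf_lag i) al)) ->
    exists2 v : 'rV[K]_(lg_dim (lf_lag i)),
      (forall k, nov_sum N
         (fun sb : nat * lg_H2 (lf_lag i) =>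
            novC N (eta sb.2) *
            (disk_term N (mc_rho b) sb.2 (nseq sb.1 (mc_b b))) 0 k) (v 0 k))
      & is_exact (q0 O (map_mx (novC N) x) (fob b) - fk_cls A b b v);
  (* compatibility with the Mukai pairing, on classes of length 0; here
     (-1)^{n(n+1)/2} = -1 *)
  oc_mukai : forall X Y (x0 : hom C X X) (y0 : hom C Y Y) (d d' : bool),
    has_par d x0 -> has_par d' y0 -> m1 x0 = 0 -> m1 y0 = 0 ->
    pairX (p0 O x0) (p0 O y0) =
    - (-1) ^+ oc_sigma O d *
      strH (fun z : hom C X Y => \sum_(c : bool)
        (-1) ^+ (d * c + d * d') *: hprod (hprod x0 (hpart c z)) y0);
  oc_p_unit : forall (i : lf_idx F) (b : mc N (lf_lag i)),
    p0 O (unit C (fob b)) = h2X K (lg_class (lf_lag i))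
}.

End FukayaCategory.

(* Main.v *)
From HB Require Import structures.
Require Import Defs.
From mathcomp Require Import all_boot all_order all_algebra.
From mathcomp Require Import finmap.
From mathcomp Require Import boolp classical_sets cardinality fsbigop reals complex.
From mathcomp Require Import zify ring lra.

Set Implicit Arguments.
Unset Strict Implicit.
Unset Printing Implicit Defensive.

Import Order.TTheory GRing.Theory Num.Theory.
Local Open Scope ring_scope.
Local Open Scope complex_scope.

(* Multiplication by c_1 on QH(X) acts by W on p(x), for x closed in the
   endomorphisms of an object (L, b) with value W, because q(c_1) = W 1 there.
   On the classes s_i = p(1_{S_i}) it acts by a common rational multiple of T,
   since the A_4 chain is connected and only curves with c_1 = 1 contribute to
   <c_1 s_i, s_i>; at the tori it acts by (5 +- 5 sqrt 5)/2 T.  As b_1 and b_2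
   are critical, 1_L is not exact there, and duality provides eigenvectors v+ and
   v- in the image of p.  Distinctness of the eigenvalues and nondegeneracy of
   the A_4 form make s_1, ..., s_4, s_1^2, v+, v- a basis of QH(X).
   If n^2 = 0, then <n s_i, s_i> is the trace of a square zero operator, so that
   n s_i^2 = 0, and n kills this basis after replacing it by products with the
   s_i: QH(X) is reduced, hence semi-simple by Frobenius duality.
   The basis also writes 1_X as a combination of classes p(x) supported on the
   six objects.  For any object B and closed y, <1_X, p(y)> = <1_B, y>, while
   <p(x), p(y)> is a supertrace, that is a pairing of y with a sum of products
   through the six objects.  Hence 1_B is cohomologous to such a sum, B is a
   summand of a sum of shifts of the six objects, and cones of retracts are
   retracts of cones. *)

(** No A-infinity category of twisted complexes is constructed. The Leibniz rule and associativity
    up to homotopy come from a single computation, the Bianchi identity for the curvature of a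
    differential that need not satisfy the Maurer-Cartan equation. Placing a matrix [c] as
    off-diagonal entry of a cone makes m_1 of [c] a block of the curvature, and mapping into the
    cone of [b] makes m_2 with [b] a part of m_1; iterating this yields each relation from the
    preceding one. In QH(X), of dimension 7, the spheres span 4 dimensions and the tori give 2. The
    missing vector s_1^2 = p(q(s_1)) has the same eigenvalue as the spheres and, unlike them, pairs
    non-trivially with 1_X. The eigenvalue at the spheres stays an unknown rational multiple of T;
    irrationality of the square root of 5 separates it from those at the tori. Tensors and
    convergent series are handled by tests: multilinear maps for lists of composable sequences,
    finite truncations for sums in the Novikov field. *)

Section LinearMaps.
Variables (K : pzRingType) (U V : lmodType K) (f : U -> V) (fl : linear f).

(** Linearity stays a hypothesis on a bare function: most operations below are linear only under
    [ainf_axioms], so they carry no canonical linear structure. *)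
Lemma linD a b : f (a + b) = f a + f b.
Proof. by have := fl 1 a b; rewrite !scale1r. Qed.
Lemma lin0 : f 0 = 0.
Proof. by have := fl (-1) 0 0; rewrite scaler0 add0r scaleN1r addNr. Qed.
Lemma linZ c a : f (c *: a) = c *: f a.
Proof. by have := fl c a 0; rewrite !addr0 lin0 addr0. Qed.
Lemma linN a : f (- a) = - f a.
Proof. by rewrite -scaleN1r linZ scaleN1r. Qed.
Lemma linB a b : f (a - b) = f a - f b.
Proof. by rewrite linD linN. Qed.
End LinearMaps.

Lemma linfunE (K : fieldType) (U V : vectType K) (f : U -> V) : linear f -> linfun f =1 f.
Proof.
move=> fl x; pose fM := GRing.isLinear.Build _ _ _ _ f fl.
pose F : {linear U -> V} := HB.pack f fM.
exact: (lfunE F x).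
Qed.

(** * Twisted complexes *)

Section PathSums.
Variables (K : fieldType) (Ob : Type) (C : ainf K Ob).
Notation H := (Defs.hom C).
Implicit Types I J : finType.

Lemma cappA A1 A2 A3 A4 (p : chain H A1 A2) (q : chain H A2 A3) (r : chain H A3 A4) :
  capp (capp p q) r = capp p (capp q r).
Proof. by elim: p q => //= *; congr hcons. Qed.

(** A list of composable sequences stands for a sum of tensors. Multilinear maps into an arbitrary
    module are the only tests applied to such lists, which replaces the construction of tensor
    products of morphism spaces. *)
Definition mlin A B (V : lmodType K) (phi : chain H A B -> V) : Prop :=
  forall A' B' (p : chain H A A') (q : chain H B' B) a (x y : H A' B'),
    phi (capp p (hcons (a *: x + y) q)) =
    a *: phi (capp p (hcons x q)) + phi (capp p (hcons y q)).

Lemma mlin_pre A B D (V : lmodType K) (phi : chain H A B -> V) (p : chain H A D) :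
  mlin phi -> mlin (fun q => phi (capp p q)).
Proof. by move=> h A' B' q r a x y; rewrite -!cappA h. Qed.

Lemma mlin_cons A B D (V : lmodType K) (phi : chain H A B -> V) (x : H A D) :
  mlin phi -> mlin (fun q => phi (hcons x q)).
Proof. exact: (@mlin_pre _ _ _ _ phi (hcons x (hnil D))). Qed.

Lemma mlin_suf A B D (V : lmodType K) (phi : chain H A B -> V) (r : chain H D B) :
  mlin phi -> mlin (fun q => phi (capp q r)).
Proof. by move=> h A' B' p q a x y; rewrite !cappA /= h. Qed.

Lemma mlin_sum A B (V : lmodType K) (T : Type) (s : seq T) (F : T -> chain H A B -> V) :
  (forall t, mlin (F t)) -> mlin (fun p => \sum_(t <- s) F t p).
Proof.
move=> h A' B' p q a x y; rewrite scaler_sumr -big_split /=.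
by apply: eq_bigr => t _; rewrite h.
Qed.

Lemma mlin0 A B D E (V : lmodType K) (phi : chain H A B -> V)
    (p : chain H A D) (q : chain H E B) :
  mlin phi -> phi (capp p (hcons 0 q)) = 0.
Proof.
move=> h; have := h _ _ p q (-1) 0 0.
by rewrite scaler0 add0r scaleN1r addNr.
Qed.

Lemma mlin_cons0 A B D (V : lmodType K) (phi : chain H A B -> V) (q : chain H D B) :
  mlin phi -> phi (hcons 0 q) = 0.
Proof. exact: (@mlin0 _ _ _ _ _ phi (hnil A)). Qed.

Lemma mlinD A B D E (V : lmodType K) (phi : chain H A B -> V)
    (p : chain H A D) (q : chain H E B) x y :
  mlin phi -> phi (capp p (hcons (x + y) q)) =
    phi (capp p (hcons x q)) + phi (capp p (hcons y q)).
Proof. by move=> h; have := h _ _ p q 1 x y; rewrite !scale1r. Qed.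

Lemma mlinZ A B D E (V : lmodType K) (phi : chain H A B -> V)
    (p : chain H A D) (q : chain H E B) a x :
  mlin phi -> phi (capp p (hcons (a *: x) q)) = a *: phi (capp p (hcons x q)).
Proof. by move=> h; have := h _ _ p q a x 0; rewrite !addr0 mlin0 // addr0. Qed.

Lemma mlin_bigsum A B D E (V : lmodType K) (phi : chain H A B -> V)
    (p : chain H A D) (q : chain H E B) (T : Type) (s : seq T) (F : T -> H D E) :
  mlin phi -> phi (capp p (hcons (\sum_(t <- s) F t) q)) =
    \sum_(t <- s) phi (capp p (hcons (F t) q)).
Proof.
move=> h; elim: s => [|t s IH]; first by rewrite !big_nil mlin0.
by rewrite !big_cons mlinD // IH.
Qed.

(** Counterparts of [tails], [tstep], [tstar] and [tlast] over any finite index type, with a length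
    bound independent of its cardinality: a cone is then indexed by a sum type, with the sum of the
    two bounds. *)
Definition gtails (I : finType) (ob : I -> Ob) (B : Ob) :=
  forall i, seq (chain H (ob i) B).
Definition gmat (I J : finType) (ob : I -> Ob) (ob' : J -> Ob) :=
  forall i j, H (ob i) (ob' j).

Definition gstep (I J : finType) (ob : I -> Ob) (ob' : J -> Ob) (a : gmat ob ob')
    B (S : gtails ob' B) : gtails ob B :=
  fun i => flatten [seq [seq hcons (a i k) p | p <- S k] | k <- enum J].

Fixpoint giter (I : finType) (ob : I -> Ob) (d : gmat ob ob) B n (S : gtails ob B) :
    gtails ob B :=
  if n is n'.+1 then gstep d (giter d n' S) else S.

Definition gstar (I : finType) (ob : I -> Ob) (d : gmat ob ob) N B (S : gtails ob B) :
    gtails ob B := fun i => flatten [seq giter d n S i | n <- iota 0 N].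

Definition gend (I J : finType) (ob : I -> Ob) (ob' : J -> Ob) (a : gmat ob ob') j :
    gtails ob (ob' j) := fun i => [:: hcons (a i j) (hnil _)].

Definition glast (I J : finType) (ob : I -> Ob) (ob' : J -> Ob) (d' : gmat ob' ob') N'
    (a : gmat ob ob') j : gtails ob (ob' j) :=
  fun i => gend a j i ++ gstep a (gstar d' N' (gend d' j)) i.

Lemma sum_gstep I J (ob : I -> Ob) (ob' : J -> Ob) (a : gmat ob ob') B
    (S : gtails ob' B) (V : lmodType K) i (phi : chain H (ob i) B -> V) :
  \sum_(p <- gstep a S i) phi p =
  \sum_k \sum_(p <- S k) phi (hcons (a i k) p).
Proof.
rewrite /gstep big_flatten /= big_map big_enum /=.
by apply: eq_bigr => k _; rewrite big_map.
Qed.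

Lemma sum_gstar0 I (ob : I -> Ob) (d : gmat ob ob) B
    (S : gtails ob B) (V : lmodType K) i (phi : chain H (ob i) B -> V) :
  \sum_(p <- gstar d 0 S i) phi p = 0.
Proof. by rewrite big_nil. Qed.

Lemma sum_gstarS I (ob : I -> Ob) (d : gmat ob ob) N B
    (S : gtails ob B) (V : lmodType K) i (phi : chain H (ob i) B -> V) :
  \sum_(p <- gstar d N.+1 S i) phi p =
  \sum_(p <- S i) phi p +
  \sum_k \sum_(p <- gstar d N S k) phi (hcons (d i k) p).
Proof.
rewrite /gstar /= big_cat /=; congr (_ + _).
rewrite big_flatten /= -[1%N]addn0 iotaDl !big_map.
under [RHS]eq_bigr => k _ do rewrite big_flatten /= big_map.
rewrite exchange_big /=.
by apply: eq_bigr => n _; rewrite sum_gstep.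
Qed.

Lemma sum_glast I J (ob : I -> Ob) (ob' : J -> Ob) (d' : gmat ob' ob') N' (a : gmat ob ob')
    (V : lmodType K) i j (phi : chain H (ob i) (ob' j) -> V) :
  \sum_(p <- glast d' N' a j i) phi p =
  phi (hcons (a i j) (hnil _)) +
  \sum_k \sum_(p <- gstar d' N' (gend d' j) k) phi (hcons (a i k) p).
Proof. by rewrite /glast big_cat sum_gstep /gend big_seq1. Qed.

(* [d] is strictly triangular for some height function below [N], so that no
   product of more than [N] of its entries matters. *)
Definition tri (I : finType) (ob : I -> Ob) (d : gmat ob ob) (N : nat) : Prop :=
  exists2 ht : I -> nat, forall i, (ht i < N)%N
    & forall i j, (ht j <= ht i)%N -> d i j = 0.

(** A non-zero entry [d i k] raises the height, which stays below [N]; hence induction on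
    [N - ht i]. Together with [gstar_fix] it proves identities between path sums. *)
Lemma tri_ind I (ob : I -> Ob) (d : gmat ob ob) N (P : I -> Prop) : tri d N ->
  (forall i, (forall k, P k \/ d i k = 0) -> P i) -> forall i, P i.
Proof.
move=> [ht htN htd] IH i.
have [n] := ubnP (N - ht i); elim: n i => // n IHn i hn.
apply: IH => k; case: (leqP (ht k) (ht i)) => hk; first by right; apply: htd.
left; apply: IHn; rewrite ltnS in hn; apply: leq_trans hn.
by rewrite ltn_sub2l.
Qed.

Lemma sum_hcons0 A A' B (V : lmodType K) (phi : chain H A B -> V) (s : seq (chain H A' B)) :
  mlin phi -> \sum_(p <- s) phi (hcons 0 p) = 0.
Proof. by move=> h; rewrite big1 // => p _; rewrite mlin_cons0. Qed.

(** The geometric series solves X = S + d X: raising the length bound by one adds no term, since a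
    longer path would have to raise the height too often. *)
Lemma gstar_fix I (ob : I -> Ob) (d : gmat ob ob) N B
    (S : gtails ob B) (V : lmodType K) i (phi : chain H (ob i) B -> V) :
  tri d N -> mlin phi ->
  \sum_(p <- gstar d N S i) phi p =
  \sum_(p <- S i) phi p +
  \sum_k \sum_(p <- gstar d N S k) phi (hcons (d i k) p).
Proof.
move=> [ht htN htd] hphi; rewrite -sum_gstarS.
(* From [i] at most [N - ht i - 1] steps can be non-zero, so any bound from [N - ht i] on already
   lists every path that counts. *)
suff h n : (N - ht i <= n)%N ->
    \sum_(p <- gstar d n S i) phi p = \sum_(p <- gstar d n.+1 S i) phi p.
  by apply: h; rewrite leq_subr.
elim: n i phi hphi => [|n IH] i phi hphi hn.
  by move: hn; rewrite leqn0 subn_eq0 leqNgt htN.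
rewrite [LHS]sum_gstarS [RHS]sum_gstarS; congr (_ + _); apply: eq_bigr => k _.
case: (leqP (ht k) (ht i)) => hk; first by rewrite htd // !sum_hcons0.
apply: IH; first exact: mlin_cons.
by rewrite -ltnS; apply: leq_trans hn; rewrite ltn_sub2l.
Qed.

Lemma gstar_lin I (ob : I -> Ob) (d : gmat ob ob) N B (S S1 S2 : gtails ob B) c
    (V : lmodType K) :
  (forall i (phi : chain H (ob i) B -> V), mlin phi ->
    \sum_(p <- S i) phi p = c *: (\sum_(p <- S1 i) phi p) + \sum_(p <- S2 i) phi p) ->
  forall i (phi : chain H (ob i) B -> V), mlin phi ->
    \sum_(p <- gstar d N S i) phi p =
    c *: (\sum_(p <- gstar d N S1 i) phi p) + \sum_(p <- gstar d N S2 i) phi p.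
Proof.
move=> hS; elim: N => [|N IH] i phi hphi; first by rewrite !sum_gstar0 scaler0 addr0.
rewrite !sum_gstarS hS // scalerDr addrACA; congr (_ + _).
rewrite scaler_sumr -big_split; apply: eq_bigr => k _ /=.
by apply: IH; apply: mlin_cons.
Qed.

Definition eqt (I : finType) (ob : I -> Ob) B (V : lmodType K) (S S' : gtails ob B) :=
  forall i (phi : chain H (ob i) B -> V), mlin phi ->
    \sum_(p <- S i) phi p = \sum_(p <- S' i) phi p.

Lemma gstar_eqt I (ob : I -> Ob) (d : gmat ob ob) N B V (S S' : gtails ob B) :
  eqt V S S' -> eqt V (gstar d N S) (gstar d N S').
Proof.
move=> hS; elim: N => [|N IH] i phi hphi; first by rewrite !sum_gstar0.
rewrite !sum_gstarS hS //; congr (_ + _); apply: eq_bigr => k _ /=.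
by apply: IH; apply: mlin_cons.
Qed.

Lemma gstep_eqt I J (ob : I -> Ob) (ob' : J -> Ob) (a : gmat ob ob') B V
    (S S' : gtails ob' B) : eqt V S S' -> eqt V (gstep a S) (gstep a S').
Proof.
move=> hS i phi hphi; rewrite !sum_gstep; apply: eq_bigr => k _.
by apply: hS; apply: mlin_cons.
Qed.

(* All paths factor as a path [i -> k] of length at least one followed by [S k]. *)
Lemma gstar_prefix I (ob : I -> Ob) (d : gmat ob ob) N B
    (S : gtails ob B) (V : lmodType K) : tri d N ->
  forall i (phi : chain H (ob i) B -> V), mlin phi ->
  \sum_(p <- gstar d N S i) phi p =
  \sum_(p <- S i) phi p +
  \sum_k \sum_(q <- gstar d N (gend d k) i) \sum_(p <- S k) phi (capp q p).
Proof.
move=> hd; apply: (tri_ind hd) => i IH phi hphi.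
rewrite gstar_fix //; congr (_ + _).
transitivity (\sum_k (\sum_(p <- S k) phi (hcons (d i k) p) +
   \sum_l \sum_(q <- gstar d N (gend d l) k) \sum_(p <- S l)
      phi (hcons (d i k) (capp q p)))).
  apply: eq_bigr => k _; case: (IH k) => [IHk | ->].
    by rewrite IHk //; apply: mlin_cons.
  rewrite !sum_hcons0 // add0r big1 // => l _.
  by rewrite big1 // => q _; rewrite big1 // => p _; rewrite mlin_cons0.
rewrite big_split /= [X in _ + X]exchange_big -big_split /=.
apply: eq_bigr => k _; rewrite gstar_fix //; last first.
  by apply: mlin_sum => p; apply: mlin_suf.
by rewrite {2}/gend big_seq1.
Qed.

Lemma sum_csplits_cons A B D (V : lmodType K) (x : H A B) (p : chain H B D)
    (G : forall E, chain H A E -> chain H E D -> V) :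
  \sum_(u <- csplits (hcons x p)) G _ (cfst u) (csnd u) =
  G _ (hnil A) (hcons x p) + \sum_(u <- csplits p) G _ (hcons x (cfst u)) (csnd u).
Proof. by rewrite /= big_cons /= big_map. Qed.

Lemma sum_csplits_nil A (V : lmodType K) (G : forall E, chain H A E -> chain H E A -> V) :
  \sum_(u <- csplits (hnil A)) G _ (cfst u) (csnd u) = G _ (hnil A) (hnil A).
Proof. by rewrite /= big_seq1. Qed.

(** Each cut leaves the varying entry in exactly one of the two parts, where [G] is multilinear. *)
Lemma mlin_csplits A B (V : lmodType K) (G : forall D, chain H A D -> chain H D B -> V) :
  (forall D (p : chain H A D), mlin (G D p)) ->
  (forall D (p : chain H D B), mlin (fun q => G D q p)) ->
  mlin (fun p => \sum_(u <- csplits p) G _ (cfst u) (csnd u)).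
Proof.
move=> hr hl A' B' p q a x y.
elim: p x y G hr hl => [{}A|A1 A2 A3 w p IH] x y G hr hl.
  rewrite !sum_csplits_cons (hr _ (hnil A) _ _ (hnil A)) scalerDr addrACA; congr (_ + _).
  rewrite scaler_sumr -big_split; apply: eq_bigr => u _ /=.
  exact: (hl _ _ _ _ (hnil A)).
rewrite /= !sum_csplits_cons.
rewrite (hr _ (hnil A1) _ _ (hcons w p)) scalerDr addrACA; congr (_ + _).
apply: (IH x y (fun D u v => G D (hcons w u) v)) => [D u|D u]; first exact: hr.
exact: (mlin_cons (phi := fun r => G D r u)).
Qed.

(** The sum of all non-empty paths of [d] is group-like for deconcatenation: a cut with both parts
    non-empty is the same as a middle summand [k] with an independent path on either side of it. *)
Lemma sum_csplits I (ob : I -> Ob) (d : gmat ob ob) N (V : lmodType K) j : tri d N ->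
  forall i (G : forall D, chain H (ob i) D -> chain H D (ob j) -> V),
  (forall D (p : chain H (ob i) D), mlin (G D p)) ->
  (forall D (p : chain H D (ob j)), mlin (fun q => G D q p)) ->
  \sum_(p <- gstar d N (gend d j) i) \sum_(u <- csplits p) G _ (cfst u) (csnd u) =
  \sum_(p <- gstar d N (gend d j) i) G _ (hnil _) p +
  \sum_(p <- gstar d N (gend d j) i) G _ p (hnil _) +
  \sum_k \sum_(p <- gstar d N (gend d k) i) \sum_(q <- gstar d N (gend d j) k) G _ p q.
Proof.
move=> hd; apply: (tri_ind hd) => i IH G hr hl.
rewrite [LHS]gstar_fix //; last exact: mlin_csplits.
rewrite {1}/gend big_seq1 sum_csplits_cons
  (sum_csplits_nil (fun D p q => G D (hcons (d i j) p) q)).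
rewrite [\sum_(p <- _) G _ _ p]gstar_fix // {1}/gend big_seq1.
rewrite [\sum_(p <- _) G _ p _]gstar_fix // {2}/gend big_seq1.
under eq_bigr => k _ do under eq_bigr => p _ do rewrite sum_csplits_cons.
under eq_bigr => k _ do rewrite big_split /=.
rewrite big_split /=.
rewrite [in RHS]addrACA -!addrA; congr (_ + (_ + (_ + _))).
transitivity (\sum_k (\sum_(p <- gstar d N (gend d j) k) G _ (hcons (d i k) (hnil _)) p +
  (\sum_(p <- gstar d N (gend d j) k) G _ (hcons (d i k) p) (hnil _) +
   \sum_l \sum_(p <- gstar d N (gend d l) k) \sum_(q <- gstar d N (gend d j) l)
      G _ (hcons (d i k) p) q))).
  apply: eq_bigr => k _; case: (IH k) => [IHk | ->].
    rewrite (IHk (fun D p q => G D (hcons (d i k) p) q)) ?addrA //.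
    by move=> D p; apply: (mlin_cons (phi := fun r => G D r p)).
  rewrite big1 => [|p _]; last first.
    by rewrite big1 // => u _; rewrite (mlin_cons0 (phi := fun r => G _ r _)).
  rewrite big1 => [|p _]; last by rewrite (mlin_cons0 (phi := fun r => G _ r _)).
  rewrite big1 => [|p _]; last by rewrite (mlin_cons0 (phi := fun r => G _ r _)).
  rewrite big1 ?addr0 // => l _; rewrite big1 // => p _; rewrite big1 // => q _.
  by rewrite (mlin_cons0 (phi := fun r => G _ r _)).
rewrite !big_split /= addrCA; congr (_ + _).
rewrite [X in _ + X]exchange_big -big_split /=; apply: eq_bigr => k _.
rewrite [in RHS]gstar_fix // ?[in RHS]/gend ?big_seq1 //.
by apply: mlin_sum => p.
Qed.

End PathSums.

(** * The Bianchi identity for the curvature of a twisted differential *)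

Section Bianchi.
Variables (K : fieldType) (Ob : Type) (C : ainf K Ob) (hC : ainf_axioms C).
Notation H := (Defs.hom C).
Implicit Types I J : finType.

Lemma cmap_capp (f : forall A B, H A B -> H A B) A B D (p : chain H A B) (q : chain H B D) :
  cmap f (capp p q) = capp (cmap f p) (cmap f q).
Proof. by elim: p q => //= *; congr hcons. Qed.

Lemma kos_lin A B a (x y : H A B) : kos (a *: x + y) = a *: kos x + kos y.
Proof. by rewrite /kos linearP opprD scalerN. Qed.

Lemma mlin_kos A B (V : lmodType K) (phi : chain H A B -> V) :
  mlin phi -> mlin (fun p => phi (cmap (@kos _ _ C) p)).
Proof. by move=> h A' B' p q a x y; rewrite !cmap_capp /= kos_lin h. Qed.

Lemma mlin_mm A B : mlin (@mm _ _ C A B).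
Proof. by move=> A' B' p q a x y; apply: mm_lin. Qed.

Lemma has_par_kos (b : bool) A B (x : H A B) : has_par b x -> kos x = (-1) ^+ (~~ b) *: x.
Proof. by rewrite /has_par /kos => ->; rewrite -scaleNr signrN. Qed.

(** Since m_s has degree 2 - s, its parity sign depends on the number of inputs; passing from [tau]
    to [kos] absorbs exactly that sign. *)
Lemma tau_mm A B (p : chain H A B) : tau (mm p) = mm (cmap (@kos _ _ C) p).
Proof.
have E A1 A2 (q : chain H A1 A2) : forall (V : vectType K) (phi : chain H A1 A2 -> V), mlin phi ->
    phi (cmap (@kos _ _ C) q) = (-1) ^+ csize q *: phi (cmap (fun _ _ x => tau x) q).
  elim: q => [A0|B1 B2 B3 x q IH] V phi hphi /=; first by rewrite scale1r.
  rewrite /kos -scaleN1r (mlinZ (hnil _)) //= (IH _ (fun q => phi (hcons (tau x) q))).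
    by rewrite scalerA -exprS.
  exact: mlin_cons.
by rewrite mm_par // (E _ _ _ _ (@mm _ _ C A B)) //; apply: mlin_mm.
Qed.

Definition godd I (ob : I -> Ob) (sh : I -> bool) (d : gmat C ob ob) :=
  forall i j, has_par (~~ (sh i (+) sh j)) (d i j).

(** All sequences from [i] have total reduced parity [e + sh i]. Testing this through [mlin] maps
    lets it pass through the list constructions without a notion of degree for lists. *)
Definition tkos I (ob : I -> Ob) (sh : I -> bool) B (V : lmodType K) e (S : gtails C ob B) :=
  forall i (phi : chain H (ob i) B -> V), mlin phi ->
  \sum_(p <- S i) phi (cmap (@kos _ _ C) p) = (-1) ^+ (e (+) sh i) *: \sum_(p <- S i) phi p.

Lemma tkos_end I J (ob : I -> Ob) (ob' : J -> Ob) sh sh' x (a : gmat C ob ob') j V :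
  (forall i j, has_par (x (+) (sh i (+) sh' j)) (a i j)) ->
  tkos sh V (~~ (x (+) sh' j)) (gend a j).
Proof.
move=> ha i phi hphi; rewrite !big_seq1 /= (has_par_kos (ha _ _)) (mlinZ (hnil _)) //=.
by congr (_ ^+ nat_of_bool _ *: _); case: x (sh i) (sh' j) {ha} => -[] [].
Qed.

Lemma tkos_step I J (ob : I -> Ob) (ob' : J -> Ob) sh sh' x (a : gmat C ob ob') B e
    (S : gtails C ob' B) V :
  (forall i j, has_par (x (+) (sh i (+) sh' j)) (a i j)) -> tkos sh' V e S ->
  tkos sh V (~~ x (+) e) (gstep a S).
Proof.
move=> ha hS i phi hphi; rewrite !sum_gstep scaler_sumr; apply: eq_bigr => k _ /=.
under eq_bigr => p _ do rewrite (has_par_kos (ha _ _)) (mlinZ (hnil _)) //=.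
rewrite -scaler_sumr (hS k (fun p => phi (hcons (a i k) p))); last exact: mlin_cons.
rewrite scalerA -signr_addb; congr (_ ^+ nat_of_bool _ *: _).
by case: x e (sh i) (sh' k) {ha hS} => -[] [] [].
Qed.

Lemma tkos_star I (ob : I -> Ob) sh (d : gmat C ob ob) N B e (S : gtails C ob B) V :
  godd sh d -> tkos sh V e S -> tkos sh V e (gstar d N S).
Proof.
move=> ho hS; elim: N => [|N IH] i phi hphi; first by rewrite !sum_gstar0 scaler0.
rewrite !sum_gstarS hS // scalerDr; congr (_ + _).
have := tkos_step (x := true) (S := gstar d N S) (a := d) (sh := sh) (sh' := sh) _ IH hphi.
by rewrite !sum_gstep => ->.
Qed.

Lemma tkos_cat I (ob : I -> Ob) sh B V e (S S' : gtails C ob B) :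
  tkos sh V e S -> tkos sh V e S' -> tkos sh V e (fun i => S i ++ S' i).
Proof. by move=> h h' i phi hphi; rewrite !big_cat h // h' // scalerDr. Qed.

Lemma tkos_last I J (ob : I -> Ob) (ob' : J -> Ob) sh sh' x (a : gmat C ob ob') d' N' j V :
  godd sh' d' -> (forall i j, has_par (x (+) (sh i (+) sh' j)) (a i j)) ->
  tkos sh V (~~ (x (+) sh' j)) (glast d' N' a j).
Proof.
move=> ho ha; apply: tkos_cat; first exact: tkos_end.
rewrite -addNb; apply: tkos_step => //.
apply: tkos_star => //; rewrite -[sh' j]negbK.
exact: (tkos_end (x := true)).
Qed.

Lemma sum_kos I (ob : I -> Ob) (d : gmat C ob ob) N sh k (V : lmodType K) :
  godd sh d -> forall i (phi : chain H (ob i) (ob k) -> V), mlin phi ->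
  \sum_(p <- gstar d N (gend d k) i) phi (cmap (@kos _ _ C) p) =
  ((-1) ^+ sh i * (-1) ^+ sh k) *: \sum_(p <- gstar d N (gend d k) i) phi p.
Proof.
move=> ho i phi hphi; rewrite mulrC -signr_addb.
apply: (@tkos_star _ _ _ _ _ _ _ _ _ ho) hphi.
by rewrite -[sh k]negbK; apply: (tkos_end (x := true)).
Qed.

(** The curvature of [d], whose vanishing is the Maurer-Cartan equation. It is kept as a matrix
    because cones of matrices that are not closed are curved. *)
Definition gcurv I (ob : I -> Ob) (sh : I -> bool) (d : gmat C ob ob) N : gmat C ob ob :=
  fun i j => (-1) ^+ sh i *: \sum_(p <- gstar d N (gend d j) i) mm p.

Lemma mm_hcons0 A A' B (p : chain H A' B) : mm (hcons (0 : H A A') p) = 0.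
Proof. by rewrite mlin_cons0 //; apply: mlin_mm. Qed.

(** Sum the A-infinity relation over all paths of [d] from [i] to [j]. Two cuts give prefix, middle
    and suffix; the summed middle is, up to sign, a curvature entry, and the Koszul sign of the
    prefix depends on the shifts alone. *)
Lemma bianchi I (ob : I -> Ob) (d : gmat C ob ob) N sh : tri d N -> godd sh d ->
  forall i j, \sum_(p <- gstar d N (glast d N (gcurv sh d N) j) i) mm p = 0.
Proof.
move=> hd ho i j.
pose F D1 D2 (p1 : chain H (ob i) D1) (p2 : chain H D1 D2) (p3 : chain H D2 (ob j)) :=
  mm (capp (cmap (@kos _ _ C) p1) (hcons (mm p2) p3)).
have F1 D1 D2 p2 p3 : mlin (fun p1 => @F D1 D2 p1 p2 p3).
  by apply: (mlin_kos (phi := fun p => mm (capp p _))); apply: mlin_suf; apply: mlin_mm.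
have F2 D1 D2 p1 p3 : mlin (fun p2 => @F D1 D2 p1 p2 p3).
  by move=> A' B' p q a x y; rewrite /F mm_lin ?mlin_mm //; apply: mlin_mm.
have F3 D1 D2 p1 p2 : mlin (fun p3 => @F D1 D2 p1 p2 p3).
  apply: (mlin_cons (phi := fun q => mm (capp (cmap (@kos _ _ C) p1) q))).
  by apply: mlin_pre; apply: mlin_mm.
(* An empty middle part contributes m_0 = 0, which removes the degenerate cuts. *)
have Fnil D p1 p3 : @F D D p1 (hnil D) p3 = 0.
  by rewrite /F mm_nil // (mlin0 (phi := @mm _ _ C _ _)) //; apply: mlin_mm.
have /esym : \sum_(p <- gstar d N (gend d j) i)
   \sum_(u <- csplits p) \sum_(v <- csplits (csnd u)) F _ _ (cfst u) (cfst v) (csnd v) = 0.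
  by rewrite big1 // => p _; apply: mm_rel.
rewrite (sum_csplits hd (G := fun D p q => \sum_(v <- csplits q) F D _ p (cfst v) (csnd v)));
  last 2 first.
- move=> D p; apply: (mlin_csplits (G := fun D1 => F D D1 p)) => *; [exact: F3|exact: F2].
- by move=> D p; apply: mlin_sum => v; apply: F1.
under [X in _ + X + _]eq_bigr => p _ do
  rewrite (sum_csplits_nil (fun D q r => F _ D p q r)) Fnil.
rewrite [X in _ + X + _]big1 // addr0.
have E k (p : chain H (ob i) (ob k)) :
   \sum_(q <- gstar d N (gend d j) k) \sum_(v <- csplits q) F _ _ p (cfst v) (csnd v) =
   \sum_(q <- gstar d N (gend d j) k) F _ _ p q (hnil _) +
   \sum_l \sum_(q <- gstar d N (gend d l) k) \sum_(r <- gstar d N (gend d j) l) F _ _ p q r.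
  rewrite (sum_csplits hd (G := fun D q r => F _ D p q r)) //.
  by rewrite [X in X + _ + _ = _]big1 ?add0r // => q _; rewrite /= Fnil.
rewrite (E i (hnil _)).
under [X in _ + X]eq_bigr => k _ do under eq_bigr => p _ do rewrite E.
move/esym/(congr1 (fun z => (-1) ^+ sh i *: z)); rewrite scaler0 => E0.
rewrite -[RHS]E0 [LHS]gstar_prefix //; last exact: mlin_mm.
have GL k (phi : chain H (ob k) (ob j) -> H (ob i) (ob j)) : mlin phi ->
  \sum_(p <- glast d N (gcurv sh d N) j k) phi p = (-1) ^+ sh k *:
  (\sum_(q <- gstar d N (gend d j) k) phi (hcons (mm q) (hnil _)) +
   \sum_l \sum_(q <- gstar d N (gend d l) k) \sum_(r <- gstar d N (gend d j) l)
     phi (hcons (mm q) r)).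
  move=> hphi; rewrite sum_glast scalerDr; congr (_ + _).
    by rewrite (mlinZ (hnil _)) // (mlin_bigsum (hnil _)).
  rewrite scaler_sumr; apply: eq_bigr => l _.
  under eq_bigr => p _ do rewrite (mlinZ (hnil _)) // (mlin_bigsum (hnil _)) //=.
  by rewrite -scaler_sumr exchange_big.
rewrite GL; last exact: mlin_mm.
rewrite [RHS]scalerDr; congr (_ + _).
rewrite scaler_sumr; apply: eq_bigr => k _.
pose phi (p : chain H (ob i) (ob k)) :=
  \sum_(q <- gstar d N (gend d j) k) mm (capp p (hcons (mm q) (hnil _))) +
   \sum_l \sum_(q <- gstar d N (gend d l) k) \sum_(r <- gstar d N (gend d j) l)
     mm (capp p (hcons (mm q) r)).
transitivity (\sum_(q <- gstar d N (gend d k) i) (-1) ^+ sh k *: phi q).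
  apply: eq_bigr => q _; rewrite (GL k (fun p => mm (capp q p))) //.
  by apply: mlin_pre; apply: mlin_mm.
rewrite -scaler_sumr.
have hphi : mlin phi.
  have hs D D1 (q : chain H D D1) r : mlin (fun p => mm (capp p (hcons (mm q) r)) : H (ob i) (ob j)).
    by apply: mlin_suf; apply: mlin_mm.
  have h1 : mlin (fun p => \sum_(q <- gstar d N (gend d j) k)
      mm (capp p (hcons (mm q) (hnil _))) : H (ob i) (ob j)) by exact: mlin_sum.
  have h2 : mlin (fun p => \sum_l \sum_(q <- gstar d N (gend d l) k)
      \sum_(r <- gstar d N (gend d j) l) mm (capp p (hcons (mm q) r)) : H (ob i) (ob j)).
    by apply: mlin_sum => l; apply: mlin_sum => q'; apply: mlin_sum => r.
  by move=> A' B' p q a x y; rewrite /phi h1 h2 scalerDr addrACA.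
rewrite -[X in _ = _ *: X]/(\sum_(p <- gstar d N (gend d k) i) phi (cmap (@kos _ _ C) p)).
(* The prefix sign (-1)^{sh i + sh k} times the overall (-1)^{sh i} leaves (-1)^{sh k}, the sign
   built into the curvature entry that starts at [k]. *)
rewrite (sum_kos N ho hphi).
by rewrite !scalerA mulrA -expr2 sqrr_sign mul1r.
Qed.

End Bianchi.

(** * Block-triangular differentials and cones *)

Section Blocks.
Variables (K : fieldType) (Ob : Type) (C : ainf K Ob).
Notation H := (Defs.hom C).
Implicit Types I J : finType.

Lemma tri_comp I J (ob : I -> Ob) (d : gmat C ob ob) N (f : J -> I) :
  tri d N -> tri (ob := ob \o f) (fun i j => d (f i) (f j)) N.
Proof. by case=> ht h1 h2; exists (ht \o f) => [i|i j /h2] //=. Qed.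

Lemma tri_sum I J (ob : I + J -> Ob) (d : gmat C ob ob) N N' :
  tri (ob := ob \o inl) (fun i j => d (inl i) (inl j)) N ->
  tri (ob := ob \o inr) (fun i j => d (inr i) (inr j)) N' ->
  (forall i j, d (inr i) (inl j) = 0) -> tri d (N + N').
Proof.
move=> [h1 h1N h1d] [h2 h2N h2d] h0.
exists (fun k => match k with inl i => h1 i | inr j => N + h2 j end)%N.
  by case=> i; [rewrite (leq_trans (h1N i)) ?leq_addr | rewrite ltn_add2l].
case=> i [] j //.
- exact: h1d.
- by rewrite leqNgt (leq_trans (h1N i)) ?leq_addr.
- by rewrite leq_add2l; apply: h2d.
Qed.

Section Star.
Variables (I J : finType) (ob : I + J -> Ob) (d : gmat C ob ob) (N N1 N2 : nat).
Hypotheses (hd : tri d N)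
  (hd1 : tri (ob := ob \o inl) (fun i j => d (inl i) (inl j)) N1)
  (hd2 : tri (ob := ob \o inr) (fun i j => d (inr i) (inr j)) N2)
  (d0 : forall i j, d (inr i) (inl j) = 0).

(** No entry leads from the second block back to the first, so these paths never leave the second
    block. *)
Lemma gstar_inr B (S : gtails C ob B) (V : lmodType K) i (phi : chain H (ob (inr i)) B -> V) :
  mlin phi ->
  \sum_(p <- gstar d N S (inr i)) phi p =
  \sum_(p <- gstar (ob := ob \o inr) (fun i j => d (inr i) (inr j)) N2
     (fun i => S (inr i)) i) phi p.
Proof.
move: i phi; apply: (tri_ind hd2) => i IH phi hphi.
rewrite [LHS]gstar_fix // [RHS]gstar_fix //; congr (_ + _).
rewrite big_sumType /= big1 ?add0r => [|k _]; last by rewrite d0 sum_hcons0.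
apply: eq_bigr => k _; case: (IH k) => [->|->] //; first exact: mlin_cons.
by rewrite !sum_hcons0.
Qed.

(** A path that starts in the first block crosses over at most once, so it splits at its only
    crossing. *)
Lemma gstar_inl B (S : gtails C ob B) (V : lmodType K) i (phi : chain H (ob (inl i)) B -> V) :
  mlin phi ->
  \sum_(p <- gstar d N S (inl i)) phi p =
  \sum_(p <- gstar (ob := ob \o inl) (fun i j => d (inl i) (inl j)) N1
     (fun i => S (inl i) ++
       gstep (ob := ob \o inl) (ob' := ob \o inr) (fun i j => d (inl i) (inr j))
         (gstar (ob := ob \o inr) (fun i j => d (inr i) (inr j)) N2 (fun i => S (inr i))) i) i)
     phi p.
Proof.
move: i phi; apply: (tri_ind hd1) => i IH phi hphi.
rewrite [LHS]gstar_fix // [RHS]gstar_fix // big_cat /= sum_gstep -addrA; congr (_ + _).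
rewrite big_sumType addrC; congr (_ + _); apply: eq_bigr => k _; last first.
  exact: (gstar_inr S (mlin_cons (d (inl i) (inr k)) hphi)).
case: (IH k) => [->|->] //; first exact: mlin_cons.
by rewrite !sum_hcons0.
Qed.

End Star.

Lemma gstar_reindex I J (ob : I -> Ob) (d : gmat C ob ob) N N' (f : J -> I) g B
    (S : gtails C ob B) (V : lmodType K) : tri d N -> cancel f g -> cancel g f ->
  tri (ob := ob \o f) (fun i j => d (f i) (f j)) N' ->
  forall i (phi : chain H (ob (f i)) B -> V), mlin phi ->
  \sum_(p <- gstar (ob := ob \o f) (fun i j => d (f i) (f j)) N' (fun i => S (f i)) i) phi p =
  \sum_(p <- gstar d N S (f i)) phi p.
Proof.
move=> hd fg gf hd'; apply: (tri_ind hd') => i IH phi hphi.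
rewrite [LHS]gstar_fix // [RHS]gstar_fix //; congr (_ + _).
rewrite [RHS](reindex f) /=; last by exists g => ? _.
apply: eq_bigr => k _; case: (IH k) => [->|->] //; first exact: mlin_cons.
by rewrite !sum_hcons0.
Qed.

(** Bare data: triangularity and the Maurer-Cartan equation are the separate predicates [gtri] and
    [gtw], since curved complexes occur as intermediate objects. *)
Record gtc := Gtc {
  gI : finType;
  gob : gI -> Ob;
  gsh : gI -> bool;
  gd : gmat C gob gob;
  gN : nat
}.
Implicit Types Y Z U W : gtc.

Definition gm Y Z := gmat C (@gob Y) (@gob Z).

(** Without the sign of the source shift the block formulas for cones carry no signs; [gtm1] and
    [gtm2] restore it and match [tm1] and [tm2]. *)
Definition gt1 Y Z (a : gm Y Z) : gm Y Z := fun i j =>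
  \sum_(p <- gstar (@gd Y) (gN Y) (glast (@gd Z) (gN Z) a j) i) mm p.
Definition gt2 Y Z U (a : gm Y Z) (b : gm Z U) : gm Y U := fun i j =>
  \sum_(p <- gstar (@gd Y) (gN Y) (gstep a (gstar (@gd Z) (gN Z)
     (glast (@gd U) (gN U) b j))) i) mm p.
Definition gtm1 Y Z (a : gm Y Z) : gm Y Z := fun i j => (-1) ^+ gsh i *: gt1 a i j.
Definition gtm2 Y Z U (a : gm Y Z) (b : gm Z U) : gm Y U := fun i j =>
  (-1) ^+ gsh i *: gt2 a b i j.
Definition gtpar (x : bool) Y Z (a : gm Y Z) : Prop :=
  forall i j, has_par (x (+) (gsh i (+) gsh j)) (a i j).
Definition gcv Y : gm Y Y := gcurv (@gsh Y) (@gd Y) (gN Y).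
Definition gtri Y : Prop := tri (@gd Y) (gN Y).

Record gtw Y : Prop := Gtw {
  gtw_tri : gtri Y;
  gtw_odd : godd (@gsh Y) (@gd Y);
  gtw_mc : forall i j, gcv (Y := Y) i j = 0
}.

Definition gcone_ob Y Z (k : gI Y + gI Z) : Ob :=
  match k with inl i => gob i | inr j => gob j end.
Definition gcone_d Y Z (c : gm Y Z) : gmat C (@gcone_ob Y Z) (@gcone_ob Y Z) :=
  fun k l => match k, l return H (gcone_ob k) (gcone_ob l) with
    | inl i, inl j => gd i j
    | inl i, inr j => c i j
    | inr _, inl _ => 0
    | inr i, inr j => gd i j
    end.

(** The shift [t] of the second block makes a matrix [c] of parity [~~ t] an odd entry of the
    differential, so that both parities of [c] have a cone. *)
Definition gcone Y Z (c : gm Y Z) (t : bool) : gtc :=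
  {| gI := (gI Y + gI Z)%type;
     gob := @gcone_ob Y Z;
     gsh := fun k => match k with inl i => gsh i | inr j => t (+) gsh j end;
     gd := gcone_d c;
     gN := gN Y + gN Z |}.

Definition grow Y Z U c t (a : gm Y Z) (h : gm Y U) : gm Y (@gcone Z U c t) :=
  fun i k => match k return H (gob i) (gcone_ob k) with inl j => a i j | inr j => h i j end.

End Blocks.
Arguments gcv {K Ob C} Y _ _.

Section MatrixSpace.
Variables (K : fieldType) (Ob : Type) (C : ainf K Ob) (Y Z : gtc C).

HB.instance Definition _ := gen_eqMixin (gm Y Z).
HB.instance Definition _ := gen_choiceMixin (gm Y Z).

Lemma gm_ext (a b : gm Y Z) : (forall i j, a i j = b i j) -> a = b.
Proof.
move=> h; apply: functional_extensionality_dep => i.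
by apply: functional_extensionality_dep => j; apply: h.
Qed.

Definition gm0 : gm Y Z := fun i j => 0.
Definition gmD (a b : gm Y Z) : gm Y Z := fun i j => a i j + b i j.
Definition gmN (a : gm Y Z) : gm Y Z := fun i j => - a i j.
Definition gmZ (c : K) (a : gm Y Z) : gm Y Z := fun i j => c *: a i j.

Fact gmDA : associative gmD. Proof. by move=> a b c; apply: gm_ext => i j; apply: addrA. Qed.
Fact gmDC : commutative gmD. Proof. by move=> a b; apply: gm_ext => i j; apply: addrC. Qed.
Fact gm0D : left_id gm0 gmD. Proof. by move=> a; apply: gm_ext => i j; apply: add0r. Qed.
Fact gmND : left_inverse gm0 gmN gmD.
Proof. by move=> a; apply: gm_ext => i j; apply: addNr. Qed.
HB.instance Definition _ := GRing.isZmodule.Build (gm Y Z) gmDA gmDC gm0D gmND.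

Fact gmZA x y a : gmZ x (gmZ y a) = gmZ (x * y) a.
Proof. by apply: gm_ext => i j; apply: scalerA. Qed.
Fact gmZ1 : left_id 1 gmZ. Proof. by move=> a; apply: gm_ext => i j; apply: scale1r. Qed.
Fact gmZDr : right_distributive gmZ +%R.
Proof. by move=> x a b; apply: gm_ext => i j; apply: scalerDr. Qed.
Fact gmZDl a : {morph gmZ^~ a : x y / x + y}.
Proof. by move=> x y; apply: gm_ext => i j; apply: scalerDl. Qed.
HB.instance Definition _ :=
  GRing.Zmodule_isLmodule.Build K (gm Y Z) gmZA gmZ1 gmZDr gmZDl.

Lemma gmDE (a b : gm Y Z) i j : (a + b) i j = a i j + b i j. Proof. by []. Qed.
Lemma gmNE (a : gm Y Z) i j : (- a) i j = - a i j. Proof. by []. Qed.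
Lemma gmZE c (a : gm Y Z) i j : (c *: a) i j = c *: a i j. Proof. by []. Qed.
Lemma gm0E i j : (0 : gm Y Z) i j = 0. Proof. by []. Qed.
End MatrixSpace.

Section Ops.
Variables (K : fieldType) (Ob : Type) (C : ainf K Ob) (hC : ainf_axioms C).
Notation H := (Defs.hom C).
Implicit Types Y Z U W : gtc C.
Let hmm A B : mlin (@mm _ _ C A B) := @mlin_mm _ _ _ hC A B.

Lemma sum_glast_lin Y Z (V : lmodType K) x (a b : gm Y Z) j i (phi : chain H (gob i) (gob j) -> V) :
  mlin phi ->
  \sum_(p <- glast (@gd _ _ _ Z) (gN Z) (x *: a + b) j i) phi p =
  x *: (\sum_(p <- glast (@gd _ _ _ Z) (gN Z) a j i) phi p) +
  \sum_(p <- glast (@gd _ _ _ Z) (gN Z) b j i) phi p.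
Proof.
move=> h; rewrite !sum_glast (h _ _ (hnil _)) scalerDr addrACA; congr (_ + _).
rewrite scaler_sumr -big_split; apply: eq_bigr => k _.
rewrite scaler_sumr -big_split; apply: eq_bigr => p _.
exact: (h _ _ (hnil _)).
Qed.

Lemma sum_gstep_linl Y Z B (S : gtails C (@gob _ _ _ Z) B) (V : lmodType K) x (a b : gm Y Z) i
    (phi : chain H (gob i) B -> V) : mlin phi ->
  \sum_(p <- gstep (x *: a + b) S i) phi p =
  x *: (\sum_(p <- gstep a S i) phi p) + \sum_(p <- gstep b S i) phi p.
Proof.
move=> h; rewrite !sum_gstep scaler_sumr -big_split; apply: eq_bigr => k _.
rewrite scaler_sumr -big_split; apply: eq_bigr => p _.
exact: (h _ _ (hnil _)).
Qed.

Lemma sum_gstep_linr Y Z B (S S1 S2 : gtails C (@gob _ _ _ Z) B) (V : lmodType K) x (a : gm Y Z) :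
  (forall i (phi : chain H (gob i) B -> V), mlin phi ->
    \sum_(p <- S i) phi p = x *: (\sum_(p <- S1 i) phi p) + \sum_(p <- S2 i) phi p) ->
  forall i (phi : chain H (gob i) B -> V), mlin phi ->
  \sum_(p <- gstep a S i) phi p =
  x *: (\sum_(p <- gstep a S1 i) phi p) + \sum_(p <- gstep a S2 i) phi p.
Proof.
move=> hS i phi h; rewrite !sum_gstep scaler_sumr -big_split; apply: eq_bigr => k _ /=.
by apply: hS; apply: mlin_cons.
Qed.

Lemma gt1_lin Y Z : linear (@gt1 _ _ _ Y Z).
Proof.
move=> x a b; apply: gm_ext => i j; rewrite /gt1 gmDE gmZE.
apply: gstar_lin; last exact: hmm.
by move=> k phi h; apply: sum_glast_lin.
Qed.

Lemma gt2_linl Y Z U (b : gm Z U) : linear ((@gt2 _ _ _ Y Z U)^~ b).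
Proof.
move=> x a a'; apply: gm_ext => i j; rewrite /gt2 gmDE gmZE.
apply: gstar_lin; last exact: hmm.
by move=> k phi h; apply: sum_gstep_linl.
Qed.

Lemma gt2_linr Y Z U (a : gm Y Z) : linear (@gt2 _ _ _ Y Z U a).
Proof.
move=> x b b'; apply: gm_ext => i j; rewrite /gt2 gmDE gmZE.
apply: gstar_lin; last exact: hmm.
apply: sum_gstep_linr; apply: gstar_lin.
by move=> k phi h; apply: sum_glast_lin.
Qed.

Lemma gtm1_lin Y Z : linear (@gtm1 _ _ _ Y Z).
Proof.
move=> x a b; apply: gm_ext => i j; rewrite /gtm1 gmDE gmZE gt1_lin.
by rewrite gmDE gmZE scalerDr !scalerA mulrC.
Qed.

Lemma gtm2_linl Y Z U (b : gm Z U) : linear ((@gtm2 _ _ _ Y Z U)^~ b).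
Proof.
move=> x a a'; apply: gm_ext => i j; rewrite /gtm2 gmDE gmZE gt2_linl.
by rewrite gmDE gmZE scalerDr !scalerA mulrC.
Qed.

Lemma gtm2_linr Y Z U (a : gm Y Z) : linear (@gtm2 _ _ _ Y Z U a).
Proof.
move=> x a' b; apply: gm_ext => i j; rewrite /gtm2 gmDE gmZE gt2_linr.
by rewrite gmDE gmZE scalerDr !scalerA mulrC.
Qed.

End Ops.

Section ZeroTails.
Variables (K : fieldType) (Ob : Type) (C : ainf K Ob).
Notation H := (Defs.hom C).
Implicit Types I J : finType.

Lemma gstar_eq0 I (ob : I -> Ob) (d : gmat C ob ob) N B (S : gtails C ob B) (V : lmodType K) :
  (forall i (phi : chain H (ob i) B -> V), mlin phi -> \sum_(p <- S i) phi p = 0) ->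
  forall i (phi : chain H (ob i) B -> V), mlin phi -> \sum_(p <- gstar d N S i) phi p = 0.
Proof.
move=> hS; elim: N => [|N IH] i phi hphi; first by rewrite sum_gstar0.
rewrite sum_gstarS hS // add0r big1 // => k _.
by apply: IH; apply: mlin_cons.
Qed.

Lemma gstep_eq0r I J (ob : I -> Ob) (ob' : J -> Ob) (a : gmat C ob ob') B (S : gtails C ob' B)
    (V : lmodType K) :
  (forall i (phi : chain H (ob' i) B -> V), mlin phi -> \sum_(p <- S i) phi p = 0) ->
  forall i (phi : chain H (ob i) B -> V), mlin phi -> \sum_(p <- gstep a S i) phi p = 0.
Proof.
move=> hS i phi hphi; rewrite sum_gstep big1 // => k _.
by apply: hS; apply: mlin_cons.
Qed.

Lemma gstep_eq0l I J (ob : I -> Ob) (ob' : J -> Ob) (a : gmat C ob ob') B (S : gtails C ob' B)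
    (V : lmodType K) i (phi : chain H (ob i) B -> V) :
  (forall k, a i k = 0) -> mlin phi -> \sum_(p <- gstep a S i) phi p = 0.
Proof. by move=> ha hphi; rewrite sum_gstep big1 // => k _; rewrite ha sum_hcons0. Qed.

Lemma glast_eq0 I J (ob : I -> Ob) (ob' : J -> Ob) (d' : gmat C ob' ob') N'
    (a : gmat C ob ob') j (V : lmodType K) i (phi : chain H (ob i) (ob' j) -> V) :
  (forall k, a i k = 0) -> mlin phi -> \sum_(p <- glast d' N' a j i) phi p = 0.
Proof.
by move=> ha hphi; rewrite /glast big_cat /= big_seq1 ha mlin_cons0 // gstep_eq0l ?addr0.
Qed.
End ZeroTails.

Section ConeFormulas.
Variables (K : fieldType) (Ob : Type) (C : ainf K Ob).
Notation H := (Defs.hom C).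
Implicit Types Y Z U W : gtc C.
Notation star Y := (gstar (@gd _ _ _ Y) (gN Y)).
Notation last_ Z := (glast (@gd _ _ _ Z) (gN Z)).
Notation end_ Z := (gend (@gd _ _ _ Z)).

Section OneCone.
Variables (Y Z : gtc C) (c : gm Y Z) (t : bool) (hY : gtri Y) (hZ : gtri Z).
Notation W := (gcone c t).

Lemma tri_cone : gtri W.
Proof. by apply: tri_sum. Qed.

Lemma star_cone_inr B (S : gtails C (@gob _ _ _ W) B) (V : lmodType K) j
    (phi : chain H (@gob _ _ _ Z j) B -> V) : mlin phi ->
  \sum_(p <- star W S (inr j)) phi p = \sum_(p <- star Z (fun j => S (inr j)) j) phi p.
Proof. by move=> h; apply: (gstar_inr (ob := @gob _ _ _ W) tri_cone hZ). Qed.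

Lemma star_cone_inl B (S : gtails C (@gob _ _ _ W) B) (V : lmodType K) i
    (phi : chain H (@gob _ _ _ Y i) B -> V) : mlin phi ->
  \sum_(p <- star W S (inl i)) phi p =
  \sum_(p <- star Y (fun i => S (inl i) ++ gstep c (star Z (fun j => S (inr j))) i) i) phi p.
Proof. by move=> h; apply: (gstar_inl (ob := @gob _ _ _ W) tri_cone hY hZ). Qed.

Lemma star_end_rl (V : lmodType K) j k (phi : chain H (@gob _ _ _ Z j) (@gob _ _ _ Y k) -> V) :
  mlin phi -> \sum_(p <- star W (end_ W (inl k)) (inr j)) phi p = 0.
Proof.
move=> h; rewrite star_cone_inr //.
by apply: gstar_eq0 => // i psi hpsi; rewrite big_seq1 mlin_cons0.
Qed.

Lemma star_end_ll (V : lmodType K) i k (phi : chain H (@gob _ _ _ Y i) (@gob _ _ _ Y k) -> V) :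
  mlin phi -> \sum_(p <- star W (end_ W (inl k)) (inl i)) phi p =
  \sum_(p <- star Y (end_ Y k) i) phi p.
Proof.
move=> h; rewrite star_cone_inl //; apply: gstar_eqt => // {h}i {}phi h.
rewrite big_cat /= gstep_eq0r ?addr0 // => {h}j {}phi h.
by apply: gstar_eq0 => // l psi hpsi; rewrite big_seq1 mlin_cons0.
Qed.

Lemma star_end_rr (V : lmodType K) j l (phi : chain H (@gob _ _ _ Z j) (@gob _ _ _ Z l) -> V) :
  mlin phi -> \sum_(p <- star W (end_ W (inr l)) (inr j)) phi p =
  \sum_(p <- star Z (end_ Z l) j) phi p.
Proof. by move=> h; rewrite star_cone_inr. Qed.

(** A path across the cone is a path in [Y], the entry [c] and a path in [Z], which is a term of m_1
    of [c]. *)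
Lemma star_end_lr (V : lmodType K) i l (phi : chain H (@gob _ _ _ Y i) (@gob _ _ _ Z l) -> V) :
  mlin phi -> \sum_(p <- star W (end_ W (inr l)) (inl i)) phi p =
  \sum_(p <- star Y (last_ Z c l) i) phi p.
Proof. by move=> h; rewrite star_cone_inl. Qed.

Definition coll X (a : gm X W) : gm X Y := fun i j => a i (inl j).
Definition colr X (a : gm X W) : gm X Z := fun i j => a i (inr j).
Definition rowl X (a : gm W X) : gm Y X := fun i j => a (inl i) j.
Definition rowr X (a : gm W X) : gm Z X := fun i j => a (inr i) j.

Lemma sum_gstep_col X (a : gm X W) B (S : gtails C (@gob _ _ _ W) B) (V : lmodType K) i
    (phi : chain H (gob i) B -> V) :
  \sum_(p <- gstep a S i) phi p =
  \sum_(p <- gstep (coll a) (fun k => S (inl k)) i) phi p +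
  \sum_(p <- gstep (colr a) (fun k => S (inr k)) i) phi p.
Proof. by rewrite !sum_gstep big_sumType. Qed.

Lemma last_cone_l X (a : gm X W) k (V : lmodType K) i
    (phi : chain H (gob i) (@gob _ _ _ Y k) -> V) : mlin phi ->
  \sum_(p <- last_ W a (inl k) i) phi p = \sum_(p <- last_ Y (coll a) k i) phi p.
Proof.
move=> h; rewrite /glast !big_cat /=; congr (_ + _).
rewrite sum_gstep_col addrC gstep_eq0r ?add0r //; last first.
  by move=> j psi hpsi; rewrite star_end_rl.
by apply: gstep_eqt => // j psi hpsi; rewrite star_end_ll.
Qed.

(** The matrix [a] enters the cone either in [Z], or in [Y] with a later crossing through [c]; paths
    of the second kind are the terms of m_2 of [coll a] and [c]. In this way m_1 into a cone
    contains m_2. *)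
Lemma last_cone_r X (a : gm X W) l (V : lmodType K) i
    (phi : chain H (gob i) (@gob _ _ _ Z l) -> V) : mlin phi ->
  \sum_(p <- last_ W a (inr l) i) phi p =
  \sum_(p <- last_ Z (colr a) l i) phi p +
  \sum_(p <- gstep (coll a) (star Y (last_ Z c l)) i) phi p.
Proof.
move=> h; rewrite /glast !big_cat /= -addrA; congr (_ + _).
rewrite sum_gstep_col [LHS]addrC; congr (_ + _).
  by apply: gstep_eqt => // j psi hpsi; rewrite star_end_rr.
by apply: gstep_eqt => // j psi hpsi; rewrite star_end_lr.
Qed.

End OneCone.
End ConeFormulas.

Section TwRelations.
Variables (K : fieldType) (Ob : Type) (C : ainf K Ob) (hC : ainf_axioms C).
Notation H := (Defs.hom C).
Implicit Types X Y Z U W : gtc C.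
Let hmm A B : mlin (@mm _ _ C A B) := @mlin_mm _ _ _ hC A B.

Section Cone.
Variables (Y Z : gtc C) (c : gm Y Z) (t : bool) (hY : gtri Y) (hZ : gtri Z).
Notation W := (gcone c t).

Lemma gt1_coll X (a : gm X W) : coll (gt1 a) = gt1 (coll a).
Proof.
apply: gm_ext => i j; apply: gstar_eqt; last exact: hmm.
by move=> k phi h; apply: last_cone_l.
Qed.

Lemma gt1_colr X (a : gm X W) : colr (gt1 a) = gt1 (colr a) + gt2 (coll a) c.
Proof.
apply: gm_ext => i j; rewrite gmDE /colr /gt1 /gt2.
rewrite -[X in X + _]scale1r; apply: gstar_lin; last exact: hmm.
by move=> k phi h; rewrite scale1r; apply: last_cone_r.
Qed.

Lemma gt2_coll X X' (a : gm X X') (b : gm X' W) : coll (gt2 a b) = gt2 a (coll b).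
Proof.
apply: gm_ext => i j; apply: gstar_eqt; last exact: hmm.
apply: gstep_eqt; apply: gstar_eqt.
by move=> k phi h; apply: last_cone_l.
Qed.

Lemma gt2_colr X X' (a : gm X X') (b : gm X' W) :
  coll b = 0 -> colr (gt2 a b) = gt2 a (colr b).
Proof.
move=> b0; apply: gm_ext => i j; apply: gstar_eqt; last exact: hmm.
apply: gstep_eqt; apply: gstar_eqt.
move=> k phi h; rewrite last_cone_r // b0 [X in _ + X]gstep_eq0l ?addr0 //.
Qed.

Lemma gt1_rowr U (a : gm W U) : rowr (gt1 a) = gt1 (rowr a).
Proof. by apply: gm_ext => i j; apply: star_cone_inr. Qed.

Lemma gt1_rowl U (a : gm W U) : rowl (gt1 a) = gt1 (rowl a) + gt2 c (rowr a).
Proof.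
apply: gm_ext => i j; rewrite gmDE /gt1 /gt2 /rowl star_cone_inl //.
rewrite -[X in X + _]scale1r; apply: gstar_lin; last exact: hmm.
by move=> k phi h; rewrite scale1r big_cat.
Qed.

Lemma gt2_rowr U U' (a : gm W U) (b : gm U U') : rowr (gt2 a b) = gt2 (rowr a) b.
Proof. by apply: gm_ext => i j; apply: star_cone_inr. Qed.

Lemma gt2_rowl U U' (a : gm W U) (b : gm U U') :
  rowr a = 0 -> rowl (gt2 a b) = gt2 (rowl a) b.
Proof.
move=> a0; apply: gm_ext => i j; rewrite /gt2 /rowl star_cone_inl //.
apply: gstar_eqt; last exact: hmm.
move=> k phi h; rewrite big_cat /= [X in _ + X]gstep_eq0r ?addr0 // => l psi hpsi.
apply: gstar_eq0 => // m chi hchi.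
apply: (@gstep_eq0l _ _ _ _ _ (@gob _ _ _ W) _ _ _ _ _ (inr m)) => // n.
exact: (congr1 (fun f : gm Z U => f m n) a0).
Qed.

Lemma gt2_mid X U (a : gm X W) (b : gm W U) :
  rowr b = 0 -> gt2 a b = gt2 (coll a) (rowl b).
Proof.
move=> b0; apply: gm_ext => i j; apply: gstar_eqt; last exact: hmm.
have bz k phi : mlin phi ->
    \sum_(p <- glast (@gd _ _ _ U) (gN U) b j (inr k)) phi p = 0 :> H (gob i) (gob j).
  move=> h; apply: glast_eq0 => // n.
  exact: (congr1 (fun f : gm Z U => f k n) b0).
move=> k phi h; rewrite sum_gstep_col [X in _ + X]gstep_eq0r ?addr0 //; last first.
  by move=> l psi hpsi; rewrite star_cone_inr //; apply: gstar_eq0 => // m; apply: bz.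
apply: gstep_eqt => // l psi hpsi; rewrite star_cone_inl //; apply: gstar_eqt => // m chi hchi.
rewrite big_cat /= [X in _ + X]gstep_eq0r ?addr0 // => n xi hxi.
by apply: gstar_eq0 => // r; apply: bz.
Qed.

Lemma gtm1_coll X (a : gm X W) : coll (gtm1 a) = gtm1 (coll a).
Proof. by rewrite /gtm1 -gt1_coll. Qed.

Lemma gtm1_colr X (a : gm X W) : colr (gtm1 a) = gtm1 (colr a) + gtm2 (coll a) c.
Proof.
apply: gm_ext => i j; rewrite gmDE /gtm1 /gtm2 /colr -scalerDr; congr (_ *: _).
by rewrite -gmDE -gt1_colr.
Qed.

Lemma gtm2_coll X X' (a : gm X X') (b : gm X' W) : coll (gtm2 a b) = gtm2 a (coll b).
Proof. by rewrite /gtm2 -gt2_coll. Qed.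

Lemma gtm2_colr X X' (a : gm X X') (b : gm X' W) :
  coll b = 0 -> colr (gtm2 a b) = gtm2 a (colr b).
Proof. by move=> b0; rewrite /gtm2 -gt2_colr. Qed.

Lemma gtm1_rowr U (a : gm W U) : rowr (gtm1 a) = (-1) ^+ t *: gtm1 (rowr a).
Proof.
apply: gm_ext => i j; rewrite gmZE /gtm1 -gt1_rowr scalerA -signr_addb.
by [].
Qed.

Lemma gtm1_rowl U (a : gm W U) : rowl (gtm1 a) = gtm1 (rowl a) + gtm2 c (rowr a).
Proof.
apply: gm_ext => i j; rewrite gmDE /gtm1 /gtm2 /rowl -scalerDr; congr (_ *: _).
by rewrite -gmDE -gt1_rowl.
Qed.

Lemma gtm2_rowr U U' (a : gm W U) (b : gm U U') :
  rowr (gtm2 a b) = (-1) ^+ t *: gtm2 (rowr a) b.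
Proof. by apply: gm_ext => i j; rewrite gmZE /gtm2 -gt2_rowr scalerA -signr_addb. Qed.

Lemma gtm2_rowl U U' (a : gm W U) (b : gm U U') :
  rowr a = 0 -> rowl (gtm2 a b) = gtm2 (rowl a) b.
Proof. by move=> a0; rewrite /gtm2 -gt2_rowl. Qed.

Lemma gtm2_mid X U (a : gm X W) (b : gm W U) :
  rowr b = 0 -> gtm2 a b = gtm2 (coll a) (rowl b).
Proof. by move=> b0; rewrite /gtm2 gt2_mid. Qed.

(** The four blocks of the curvature of a cone. Through the upper right one the Bianchi identity
    speaks about m_1 of [c], and a closed [c] between flat complexes has a flat cone. *)
Lemma gcv_ll : rowl (coll (gcv W)) = gcv Y.
Proof. by apply: gm_ext => i j; rewrite /gcv /gcurv /coll /rowl star_end_ll. Qed.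
Lemma gcv_lr : rowl (colr (gcv W)) = gtm1 c.
Proof. by apply: gm_ext => i j; rewrite /gcv /gcurv /colr /rowl star_end_lr. Qed.
Lemma gcv_rl : rowr (coll (gcv W)) = 0.
Proof. by apply: gm_ext => i j; rewrite /gcv /gcurv /coll /rowr star_end_rl ?scaler0. Qed.
Lemma gcv_rr : rowr (colr (gcv W)) = (-1) ^+ t *: gcv Z.
Proof.
apply: gm_ext => i j; rewrite gmZE /gcv /gcurv /colr /rowr star_end_rr //.
by rewrite scalerA -signr_addb.
Qed.

End Cone.
End TwRelations.

(** * Leibniz rule and associativity up to homotopy *)

Section TwCategory.
Variables (K : fieldType) (Ob : Type) (C : ainf K Ob) (hC : ainf_axioms C).
Notation H := (Defs.hom C).
Implicit Types X Y Z U V W : gtc C.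
Let hmm A B : mlin (@mm _ _ C A B) := @mlin_mm _ _ _ hC A B.

Lemma has_par0 x A B : has_par x (0 : H A B).
Proof. by rewrite /has_par linear0 scaler0. Qed.

Lemma has_par_lin x c A B (a b : H A B) : has_par x a -> has_par x b -> has_par x (c *: a + b).
Proof. by rewrite /has_par => ha hb; rewrite (linearP tau) /= ha hb scalerDr !scalerA mulrC. Qed.

Lemma gtpar_lin x c Y Z (a b : gm Y Z) : gtpar x a -> gtpar x b -> gtpar x (c *: a + b).
Proof. by move=> ha hb i j; apply: has_par_lin. Qed.
Lemma gtpar0 x Y Z : gtpar x (0 : gm Y Z).
Proof. by move=> i j; apply: has_par0. Qed.
Lemma gtparZ x c Y Z (a : gm Y Z) : gtpar x a -> gtpar x (c *: a).
Proof. by move=> ha; rewrite -[_ *: _]addr0; apply: gtpar_lin => //; apply: gtpar0. Qed.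
Lemma gtparN x Y Z (a : gm Y Z) : gtpar x a -> gtpar x (- a).
Proof. by rewrite -scaleN1r; apply: gtparZ. Qed.
Lemma gtparD x Y Z (a b : gm Y Z) : gtpar x a -> gtpar x b -> gtpar x (a + b).
Proof. by move=> ha hb; rewrite -[a]scale1r; apply: gtpar_lin. Qed.

Lemma gtpar_tkos Y e B (S : gtails C (@gob _ _ _ Y) B) i :
  tkos (@gsh _ _ _ Y) (H (gob i) B) e S ->
  has_par (e (+) gsh i) (\sum_(p <- S i) mm p).
Proof.
move=> hS; rewrite /has_par -(hS _ mm (@hmm _ _)) linear_sum.
by apply: eq_bigr => p _; apply: tau_mm.
Qed.

Lemma has_par_eq b b' A B (a : H A B) : has_par b a -> b = b' -> has_par b' a.
Proof. by move=> h <-. Qed.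

Lemma has_par_sign x s A B (a : H A B) : has_par x a -> has_par x ((-1) ^+ s *: a).
Proof. by move=> h; rewrite -[_ *: _]addr0; apply: has_par_lin => //; apply: has_par0. Qed.

Lemma gtpar1 x Y Z (a : gm Y Z) : gtw Y -> gtw Z -> gtpar x a -> gtpar (~~ x) (gtm1 a).
Proof.
move=> [_ hY _] [_ hZ _] ha i j; apply: has_par_sign.
apply: (has_par_eq (@gtpar_tkos Y _ _ _ i (tkos_star _ hY (tkos_last _ hZ ha)))).
by case: x (gsh i) (gsh j) {ha} => -[] [].
Qed.

Lemma gtpar2 x y Y Z U (a : gm Y Z) (b : gm Z U) : gtw Y -> gtw Z -> gtw U ->
  gtpar x a -> gtpar y b -> gtpar (x (+) y) (gtm2 a b).
Proof.
move=> [_ hY _] [_ hZ _] [_ hU _] ha hb i j; apply: has_par_sign.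
apply: (has_par_eq (@gtpar_tkos Y _ _ _ i
  (tkos_star _ hY (tkos_step ha (tkos_star _ hZ (tkos_last _ hU hb)))))).
by case: x y (gsh i) (gsh j) {ha hb} => -[] [] [].
Qed.

Lemma tw_bianchi Y : gtri Y -> godd (@gsh _ _ _ Y) (@gd _ _ _ Y) -> gt1 (gcv Y) = 0.
Proof. by move=> hd ho; apply: gm_ext => i j; apply: bianchi. Qed.

Lemma gtm10 Y Z : gtm1 (0 : gm Y Z) = 0. Proof. exact: (lin0 (@gtm1_lin _ _ _ hC Y Z)). Qed.

Lemma godd_cone Y Z (c : gm Y Z) t : godd (@gsh _ _ _ Y) (@gd _ _ _ Y) ->
  godd (@gsh _ _ _ Z) (@gd _ _ _ Z) -> gtpar (~~ t) c ->
  godd (@gsh _ _ _ (gcone c t)) (@gd _ _ _ (gcone c t)).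
Proof.
move=> hY hZ hc [i|i] [j|j] /=; [exact: hY| |exact: has_par0|].
  by apply: (has_par_eq (hc i j)); case: t (gsh i) (gsh j) {hc} => -[] [].
by apply: (has_par_eq (hZ i j)); case: t (gsh i) (gsh j) {hc} => -[] [].
Qed.

Lemma gtw_cone Y Z (c : gm Y Z) t : gtw Y -> gtw Z -> gtpar (~~ t) c -> gtm1 c = 0 ->
  gtw (gcone c t).
Proof.
move=> [tY oY mY] [tZ oZ mZ] hc c0; split; first exact: tri_cone.
  exact: godd_cone.
case=> i [] j.
- rewrite -[LHS]/(rowl (coll (gcv (gcone c t))) i j). rewrite gcv_ll //; exact: mY.
- by rewrite -[LHS]/(rowl (colr (gcv _)) i j) gcv_lr // c0.
- by rewrite -[LHS]/(rowr (coll (gcv _)) i j) gcv_rl.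
- by rewrite -[LHS]/(rowr (colr (gcv _)) i j) gcv_rr // gmZE mZ scaler0.
Qed.

(** This is the block from [Y] to [W] of the Bianchi identity for the cone of [c]. The term with the
    curvature of [Y] disappears as [Y] is flat; [W] may be curved, which the Leibniz rule
    exploits. *)
Lemma tw_rel1 Y W (c : gm Y W) x : gtw Y -> gtri W -> godd (@gsh _ _ _ W) (@gd _ _ _ W) ->
  gtpar x c -> gtm1 (gtm1 c) = (-1) ^+ x *: gtm2 c (gcv W).
Proof.
move=> [tY oY mY] tW oW hc; pose D := gcone c (~~ x).
have oD : godd (@gsh _ _ _ D) (@gd _ _ _ D) by apply: godd_cone => //; rewrite negbK.
have tD : gtri D by apply: tri_cone.
have /(congr1 (@rowl _ _ _ _ _ c (~~ x) _)) := tw_bianchi tD oD.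
rewrite (gt1_rowl hC) //.
move/(congr1 (@colr _ _ _ _ _ c (~~ x) _)).
set A := colr _ => E.
have {E} : A = 0 by rewrite E; apply: gm_ext.
rewrite {}/A.
have -> (u v : gm Y D) : colr (u + v) = colr u + colr v by apply: gm_ext.
rewrite (gt1_colr hC) // -[colr (rowl _)]/(rowl (colr (gcv D))) gcv_lr //.
have -> : coll (rowl (gcv D)) = 0 by apply: gm_ext => i j; rewrite -[LHS]/(rowl (coll (gcv D)) i j) gcv_ll.
rewrite (lin0 (@gt2_linl _ _ _ hC _ _ _ c)) addr0 (gt2_colr hC) //; last first.
  by apply: gm_ext => i j; rewrite -[LHS]/(rowr (coll (gcv D)) i j) gcv_rl.
rewrite -[colr (rowr _)]/(rowr (colr (gcv D))) gcv_rr // (linZ (@gt2_linr _ _ _ hC _ _ _ c)).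
move=> E; apply: gm_ext => i j; rewrite gmZE /gtm1 /gtm2 scalerA mulrC -scalerA; congr (_ *: _).
have /(congr1 (fun f : gm Y W => f i j)) := E; rewrite gmDE gmZE => /eqP.
by rewrite addr_eq0 => /eqP ->; rewrite signrN scaleNr opprK.
Qed.

End TwCategory.

Section TwCategory2.
Variables (K : fieldType) (Ob : Type) (C : ainf K Ob) (hC : ainf_axioms C).
Notation H := (Defs.hom C).
Implicit Types X Y Z U V W : gtc C.

Let gtm1l Y Z := @gtm1_lin _ _ _ hC Y Z.
Let gtm2ll Y Z U b := @gtm2_linl _ _ _ hC Y Z U b.
Let gtm2lr Y Z U a := @gtm2_linr _ _ _ hC Y Z U a.

Lemma colrZ Y Z (c : gm Y Z) t X s (u : gm X (gcone c t)) : colr (s *: u) = s *: colr u.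
Proof. by []. Qed.

(** Apply [tw_rel1] to the row (a, 0) into the cone of [b]. The curvature of that cone is m_1 of
    [b], whence the right-hand side; on the left, each of the two applications of m_1 produces one
    m_2 with [b]. *)
Lemma tw_rel2 x y Y Z U (a : gm Y Z) (b : gm Z U) : gtw Y -> gtw Z -> gtw U ->
  gtpar x a -> gtpar y b ->
  gtm1 (gtm2 a b) + gtm2 (gtm1 a) b = (-1) ^+ x *: gtm2 a (gtm1 b).
Proof.
move=> hY hZ hU ha hb; have [tZ oZ mZ] := hZ; have [tU oU mU] := hU.
pose W := gcone b (~~ y).
have tW : gtri W by apply: tri_cone.
have oW : godd (@gsh _ _ _ W) (@gd _ _ _ W) by apply: godd_cone => //; rewrite negbK.
pose c : gm Y W := @grow _ _ _ Y Z U b (~~ y) a 0.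
have hc : gtpar x c.
  by move=> i [k|l] /=; [exact: ha | exact: has_par0].
have E := congr1 (@colr _ _ _ _ _ b (~~ y) _) (tw_rel1 hC hY tW oW hc).
have m10 : coll (gtm1 c) = gtm1 a by rewrite gtm1_coll.
move: E; rewrite gtm1_colr // m10 gtm1_colr // -/(coll c) -/(colr c).
have -> : colr c = 0 by apply: gm_ext.
have -> : coll c = a by apply: gm_ext.
rewrite (gtm10 hC) add0r => ->; rewrite colrZ; congr (_ *: _).
rewrite gtm2_colr //; last first.
  apply: gm_ext => -[k|k] l.
    by rewrite -[LHS]/(rowl (coll (gcv W)) k l) gcv_ll // mZ.
  by rewrite -[LHS]/(rowr (coll (gcv W)) k l) gcv_rl.
rewrite (gtm2_mid hC) //; last first.
  apply: gm_ext => k l.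
  by rewrite -[LHS]/(rowr (colr (gcv W)) k l) gcv_rr // gmZE mU scaler0.
have -> : coll c = a by apply: gm_ext.
by rewrite gcv_lr.
Qed.

Definition tclosed x Y Z (a : gm Y Z) : Prop := gtpar x a /\ gtm1 a = 0.

Definition hq x Y Z (a b : gm Y Z) : Prop :=
  exists2 h, gtpar (~~ x) h & a - b = gtm1 h.

Lemma hq_refl x Y Z (a : gm Y Z) : hq x a a.
Proof. by exists 0; [exact: gtpar0 | rewrite subrr gtm10]. Qed.

Lemma hq_sym x Y Z (a b : gm Y Z) : hq x a b -> hq x b a.
Proof.
move=> [h hh e]; exists (- h); first exact: gtparN.
by rewrite (linN (@gtm1l _ _)) -e opprB.
Qed.

Lemma hqZ x Y Z c (a b : gm Y Z) : hq x a b -> hq x (c *: a) (c *: b).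
Proof.
move=> [h hh e]; exists (c *: h); first exact: gtparZ.
by rewrite (linZ (@gtm1l _ _)) -e scalerBr.
Qed.

Lemma hqN x Y Z (a b : gm Y Z) : hq x a b -> hq x (- a) (- b).
Proof. by rewrite -scaleN1r -[- b]scaleN1r; apply: hqZ. Qed.

Lemma hq_trans x Y Z (b a c : gm Y Z) : hq x a b -> hq x b c -> hq x a c.
Proof.
move=> [h hh e] [h' hh' e']; exists (h + h'); first exact: gtparD.
by rewrite (linD (@gtm1l _ _)) -e -e' addrA subrK.
Qed.

Lemma closed_lin x Y Z c (a b : gm Y Z) : tclosed x a -> tclosed x b -> tclosed x (c *: a + b).
Proof.
move=> [pa ea] [pb eb]; split; first exact: gtpar_lin.
by rewrite gtm1l ea eb scaler0 addr0.
Qed.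

Lemma closed0 x Y Z : tclosed x (0 : gm Y Z).
Proof. by split; [exact: gtpar0 | exact: gtm10]. Qed.

Lemma closedZ x Y Z c (a : gm Y Z) : tclosed x a -> tclosed x (c *: a).
Proof. by move=> h; rewrite -[_ *: _]addr0; apply: closed_lin => //; apply: closed0. Qed.
Lemma closedD x Y Z (a b : gm Y Z) : tclosed x a -> tclosed x b -> tclosed x (a + b).
Proof. by move=> h h'; rewrite -[a]scale1r; apply: closed_lin. Qed.
Lemma closedN x Y Z (a : gm Y Z) : tclosed x a -> tclosed x (- a).
Proof. by rewrite -scaleN1r; apply: closedZ. Qed.
Lemma closedB x Y Z (a b : gm Y Z) : tclosed x a -> tclosed x b -> tclosed x (a - b).
Proof. by move=> h h'; apply: closedD => //; apply: closedN. Qed.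

Section Comp.
Variables (x y : bool) (Y Z U : gtc C) (hY : gtw Y) (hZ : gtw Z) (hU : gtw U).

Lemma closed2 (a : gm Y Z) (b : gm Z U) :
  tclosed x a -> tclosed y b -> tclosed (x (+) y) (gtm2 a b).
Proof.
move=> [pa ea] [pb eb]; split; first exact: gtpar2.
have := tw_rel2 hY hZ hU pa pb.
by rewrite ea eb (lin0 (@gtm2ll _ _ _ _)) (lin0 (@gtm2lr _ _ _ _)) scaler0 addr0.
Qed.

Lemma hq2l (a a' : gm Y Z) (b : gm Z U) :
  hq x a a' -> tclosed y b -> hq (x (+) y) (gtm2 a b) (gtm2 a' b).
Proof.
move=> [h ph e] [pb eb]; exists (- gtm2 h b).
  by apply: gtparN; rewrite -addNb; apply: gtpar2.
rewrite -(linB (@gtm2ll _ _ _ _)) e (linN (@gtm1l _ _)).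
have := tw_rel2 hY hZ hU ph pb.
rewrite eb (lin0 (@gtm2lr _ _ _ _)) scaler0 => /eqP.
by rewrite addrC addr_eq0 => /eqP.
Qed.

Lemma hq2r (a : gm Y Z) (b b' : gm Z U) :
  tclosed x a -> hq y b b' -> hq (x (+) y) (gtm2 a b) (gtm2 a b').
Proof.
move=> [pa ea] [h ph e]; exists ((-1) ^+ x *: gtm2 a h).
  by apply: gtparZ; rewrite -addbN; apply: gtpar2.
rewrite -(linB (@gtm2lr _ _ _ _)) e (linZ (@gtm1l _ _)).
have := tw_rel2 hY hZ hU pa ph.
rewrite ea (lin0 (@gtm2ll _ _ _ _)) addr0 => ->.
by rewrite scalerA -signr_addb addbb scale1r.
Qed.

End Comp.

(** The second column of the Leibniz rule for [a] and the row (b, 0) into the cone of [c], which is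
    flat because [c] is closed. Up to sign the homotopy is m_3(a, b, c), in the guise of
    [colr (gtm2 a b')]. *)
Lemma hqA x y z Y Z U V (a : gm Y Z) (b : gm Z U) (c : gm U V) :
  gtw Y -> gtw Z -> gtw U -> gtw V ->
  tclosed x a -> tclosed y b -> tclosed z c ->
  hq (x (+) y (+) z) (gtm2 (gtm2 a b) c) ((-1) ^+ x *: gtm2 a (gtm2 b c)).
Proof.
move=> hY hZ hU hV [pa ea] [pb eb] [pc ec].
pose W := gcone c (~~ z).
have tU := gtw_tri hU; have tV := gtw_tri hV.
have hW : gtw W by apply: gtw_cone => //; rewrite negbK.
pose b' : gm Z W := @grow _ _ _ Z U V c (~~ z) b 0.
have pb' : gtpar y b' by move=> i [k|l] /=; [exact: pb | exact: has_par0].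
have b'l : coll b' = b by apply: gm_ext.
have b'r : colr b' = 0 by apply: gm_ext.
have := congr1 (@colr _ _ _ _ _ c (~~ z) _) (tw_rel2 hY hZ hW pa pb').
rewrite ea (lin0 (@gtm2ll _ _ _ _)) addr0 gtm1_colr // gtm2_coll // b'l colrZ.
rewrite [colr (gtm2 a (gtm1 _))]gtm2_colr //; last by rewrite gtm1_coll // b'l eb.
rewrite gtm1_colr // b'l b'r (gtm10 hC) add0r => E.
exists (- colr (gtm2 a b')); last first.
  by rewrite (linN (@gtm1l _ _)) -E opprD addrCA subrr addr0.
apply: gtparN => i l; apply: (has_par_eq (gtpar2 hC hY hZ hW pa pb' i (inr l))) => /=.
by move: (gsh i) (gsh l); case: (x) (y) (z) => -[] [] [] [].
Qed.

End TwCategory2.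

Section Positive.
Variables (K : fieldType) (Ob : Type) (C : ainf K Ob).
Notation H := (Defs.hom C).
Implicit Types I J : finType.

(** Strict unitality kills a product containing a unit only from three entries on; positive lengths
    are what allows it to be applied inside path sums. *)
Definition csize_gt0 A B (p : chain H A B) := (0 < csize p)%N.

Lemma sum_csize0 A B (V : nmodType) (s : seq (chain H A B)) (phi : chain H A B -> V) :
  all (@csize_gt0 A B) s -> (forall p, csize_gt0 p -> phi p = 0) ->
  \sum_(p <- s) phi p = 0.
Proof.
move=> + h; elim: s => [|p s IH]; first by rewrite big_nil.
by case/andP=> hp hs; rewrite big_cons h // IH // addr0.
Qed.

Lemma all_flatten (T : Type) (P : pred T) (s : seq (seq T)) :
  all P (flatten s) = all (all P) s.
Proof. by elim: s => //= x s IH; rewrite all_cat IH. Qed.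

Lemma csize_gstep I J (ob : I -> Ob) (ob' : J -> Ob) (a : gmat C ob ob') B
    (S : gtails C ob' B) i : all (@csize_gt0 _ _) (gstep a S i).
Proof.
rewrite /gstep all_flatten all_map; apply/allP => k _ /=.
by rewrite all_map; elim: (S k) => //=.
Qed.

Lemma csize_gend I J (ob : I -> Ob) (ob' : J -> Ob) (a : gmat C ob ob') j i :
  all (@csize_gt0 _ _) (gend a j i).
Proof. by []. Qed.

Lemma csize_glast I J (ob : I -> Ob) (ob' : J -> Ob) d' N' (a : gmat C ob ob') j i :
  all (@csize_gt0 _ _) (glast d' N' a j i).
Proof. by rewrite /glast all_cat csize_gend csize_gstep. Qed.

Lemma csize_gstar I (ob : I -> Ob) (d : gmat C ob ob) N B (S : gtails C ob B) :
  (forall i, all (@csize_gt0 _ _) (S i)) ->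
  forall i, all (@csize_gt0 _ _) (gstar d N S i).
Proof.
move=> hS i; rewrite /gstar all_flatten all_map; apply/allP => -[|n] _ /=; first exact: hS.
exact: csize_gstep.
Qed.

Lemma csize_capp A B D (p : chain H A B) (q : chain H B D) :
  csize (capp p q) = (csize p + csize q)%N.
Proof. by elim: p q => //= A1 A2 A3 x p IH q; rewrite IH. Qed.

End Positive.

(** * Identity matrices of twisted complexes *)

Section Identity.
Variables (K : fieldType) (Ob : Type) (C : ainf K Ob) (hC : ainf_axioms C).
Notation H := (Defs.hom C).
Implicit Types X Y Z U V W : gtc C.
Let hmm A B : mlin (@mm _ _ C A B) := @mlin_mm _ _ _ hC A B.

(* The sign compensates the one in [gtm2]. *)
Definition gid Y : gm Y Y := fun i j =>
  match @eqP _ i j with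
  | ReflectT e => (-1) ^+ gsh i *: ecast k (H (gob i) (gob k)) e (Defs.unit C (gob i))
  | ReflectF _ => 0
  end.

Lemma gid_eq Y (i : gI Y) : gid i i = (-1) ^+ gsh i *: Defs.unit C (gob i).
Proof. by rewrite /gid; case: eqP => // e; rewrite eq_axiomK. Qed.

Lemma gid_neq Y (i j : gI Y) : i != j -> gid i j = 0.
Proof. by rewrite /gid; case: eqP. Qed.

Lemma sum_gidl Y (i : gI Y) A B (p : chain H A (gob i)) (F : forall k, seq (chain H (gob k) B)) :
  \sum_k \sum_(q <- F k) mm (capp p (hcons (gid i k) q)) =
  (-1) ^+ gsh i *: \sum_(q <- F i) mm (capp p (hcons (Defs.unit C (gob i)) q)).
Proof.
rewrite (bigD1 i) //= [X in _ + X]big1 ?addr0 => [|k ne]; last first.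
  rewrite big1 // => q _; rewrite gid_neq; last by rewrite eq_sym.
  by rewrite (mlin0 (phi := @mm _ _ C _ _)).
rewrite scaler_sumr; apply: eq_bigr => q _.
by rewrite gid_eq (mlinZ (phi := @mm _ _ C _ _)).
Qed.

Lemma sum_gidr Y (j : gI Y) A (F : forall k, seq (chain H A (gob k))) :
  \sum_k \sum_(q <- F k) mm (crcons q (gid k j)) =
  (-1) ^+ gsh j *: \sum_(q <- F j) mm (crcons q (Defs.unit C (gob j))).
Proof.
rewrite (bigD1 j) //= [X in _ + X]big1 ?addr0 => [|k ne]; last first.
  rewrite big1 // => q _; rewrite gid_neq //.
  by rewrite (mlin0 (phi := @mm _ _ C _ _)).
rewrite scaler_sumr; apply: eq_bigr => q _.
by rewrite gid_eq (mlinZ (phi := @mm _ _ C _ _)).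
Qed.

Notation star Y := (gstar (@gd _ _ _ Y) (gN Y)).
Notation last_ Z := (glast (@gd _ _ _ Z) (gN Z)).
Notation end_ Z := (gend (@gd _ _ _ Z)).

Let pstar Y B (S : gtails C (@gob _ _ _ Y) B) := @csize_gstar _ _ C _ _ (@gd _ _ _ Y) (gN Y) B S.

(* Only the shortest product survives when a unit is inserted. *)
Lemma star_gid Y (hY : gtri Y) (j k : gI Y) A (p : chain H A (gob k)) : csize_gt0 p ->
  \sum_(q <- star Y (last_ Y (@gid Y) j) k) mm (capp p q) = mm (crcons p (gid k j)).
Proof.
move=> hp.
have L l (r : chain H A (gob l)) : csize_gt0 r ->
    \sum_(q <- last_ Y (@gid Y) j l) mm (capp r q) = mm (crcons r (gid l j)).
  move=> hr; rewrite sum_glast sum_gidl sum_csize0 ?scaler0 ?addr0 //.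
    by apply: pstar => i; apply: csize_gend.
  by move=> q hq; apply: unit_mm => //; apply: (@leq_add 1 1).
rewrite gstar_prefix //; last by apply: mlin_pre; apply: hmm.
rewrite L // big1 ?addr0 // => l _; apply: sum_csize0.
  by apply: pstar => i; apply: csize_gend.
move=> q hq; under eq_bigr => r _ do rewrite -cappA.
rewrite L; last by rewrite /csize_gt0 csize_capp addn_gt0 [X in X || _]hp.
have [e|ne] := eqVneq l j; last first.
  by rewrite gid_neq // (mlin0 (phi := @mm _ _ C _ _)).
subst l; rewrite gid_eq /crcons (mlinZ (phi := @mm _ _ C _ _)) // unit_mm ?scaler0 //.
by rewrite csize_capp addn0; apply: (@leq_add 1 1).
Qed.

Let unit_cons A B D (x : H A B) (p : chain H B D) : csize_gt0 p ->
  mm (hcons (Defs.unit C A) (hcons x p)) = 0.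
Proof. by move=> hp; apply: (unit_mm hC (p := hnil A)). Qed.

Lemma star_unitl Y (hY : gtri Y) B (S : gtails C (@gob _ _ _ Y) B) i :
  (forall i, all (@csize_gt0 _ _ _ _ _) (S i)) ->
  \sum_(p <- star Y S i) mm (hcons (Defs.unit C (gob i)) p) =
  \sum_(p <- S i) mm (hcons (Defs.unit C (gob i)) p).
Proof.
move=> hS; rewrite gstar_fix //; last by apply: mlin_cons; apply: hmm.
rewrite [X in _ + X]big1 ?addr0 // => k _.
by apply: sum_csize0 => [|p]; [exact: pstar | exact: unit_cons].
Qed.

Lemma last_unitl Y Z (a : gm Y Z) i j :
  \sum_(p <- last_ Z a j i) mm (hcons (Defs.unit C (gob i)) p) = a i j.
Proof.
rewrite sum_glast [X in _ + X]big1 ?addr0 => [|k _]; first exact: unit_l.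
apply: sum_csize0 => [|p]; last exact: unit_cons.
by apply: pstar => l; apply: csize_gend.
Qed.

Lemma gtm2_idl Y Z (a : gm Y Z) : gtw Y -> gtm2 (@gid Y) a = a.
Proof.
move=> hY; have tY := gtw_tri hY; apply: gm_ext => i j.
have pS l : all (@csize_gt0 _ _ C _ _) (star Y (last_ Z a j) l).
  by apply: pstar => m; apply: csize_glast.
rewrite /gtm2 /gt2 gstar_prefix //.
rewrite sum_gstep (@sum_gidl Y i (gob i) _ (hnil _)) star_unitl //; last by move=> l; apply: csize_glast.
rewrite last_unitl [X in _ + X]big1 ?addr0 => [|k _].
  by rewrite scalerA -signr_addb addbb scale1r.
apply: sum_csize0 => [|q hq]; first by apply: pstar => l; apply: csize_gend.
rewrite sum_gstep sum_gidl sum_csize0 ?scaler0 // => p hp.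
by rewrite unit_mm //; apply: (@leq_add 1 1).
Qed.

(** Right multiplication by a unit is [tau], hence a sign. The shift signs of [gid] and [gtm2] turn
    the parity of the entry [a i j] into the parity [x] of the matrix. *)
Lemma gtm2_idr x Y Z (a : gm Y Z) : gtw Y -> gtw Z -> gtpar x a ->
  gtm2 a (@gid Z) = (-1) ^+ x *: a.
Proof.
move=> hY hZ ha; have tY := gtw_tri hY; have tZ := gtw_tri hZ.
apply: gm_ext => i j; rewrite /gtm2 /gt2 gstar_prefix //.
have E A l (p : chain H A (gob l)) : 
    \sum_(q <- gstep a (star Z (last_ Z (@gid Z) j)) l) mm (capp p q) =
    (-1) ^+ gsh j *: mm (capp p (hcons (a l j) (hcons (Defs.unit C (gob j)) (hnil _)))).
  rewrite sum_gstep.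
  transitivity (\sum_k mm (crcons (crcons p (a l k)) (gid k j))).
    apply: eq_bigr => k _; under eq_bigr => q _ do rewrite -[hcons _ q]/(capp (hcons (a l k) (hnil _)) q) -cappA.
    by rewrite star_gid // /csize_gt0 csize_capp addn1.
  transitivity (\sum_k \sum_(q <- [:: crcons p (a l k)]) mm (crcons q (gid k j))).
    by apply: eq_bigr => k _; rewrite big_seq1.
  by rewrite sum_gidr big_seq1 /crcons cappA.
rewrite (E _ i (hnil _)) big1 ?addr0 => [|k _]; last first.
  apply: sum_csize0 => [|q hq]; first by apply: pstar => l; apply: csize_gend.
  rewrite E -[hcons _ (hcons _ _)]/(capp (hcons (a k j) (hnil _)) _) -cappA unit_mm ?scaler0 //.
  by rewrite csize_capp addn1 addn0.
rewrite /= -[mm _]/(m2 (a i j) (Defs.unit C (gob j))) unit_r // ha !scalerA gmZE.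
rewrite -!signr_addb; congr (_ ^+ nat_of_bool _ *: _).
by case: (x) (gsh i) (gsh j) => -[] [].
Qed.

(** Besides m_1 of units, which is 0, only products of a unit with a single entry of the
    differential survive. The unit stands before or after that entry, and the two terms cancel
    because the differential is odd. *)
Lemma closed_id Y : gtw Y -> tclosed false (@gid Y).
Proof.
move=> hY; have tY := gtw_tri hY; split.
  move=> i j; have [<-|ne] := eqVneq i j; last by rewrite gid_neq //; apply: has_par0.
  by rewrite gid_eq addbb; apply: has_par_sign; apply: unit_par.
apply: gm_ext => i j; rewrite /gtm1 /gt1 gstar_prefix //.
rewrite sum_glast (@sum_gidl Y i (gob i) _ (hnil _)) star_unitl //.
rewrite big_seq1 -[mm _ in X in _ + X + _]/(m2 (Defs.unit C (gob i)) (gd i j)) unit_l //.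
rewrite -[mm (hcons _ (hnil _))]/(m1 (gid i j)).
have -> : m1 (gid i j) = 0.
  have [<-|ne] := eqVneq i j; last by rewrite gid_neq // /m1 mm_hcons0.
  by rewrite gid_eq /m1 (mlinZ (hnil _)) //= -/(m1 _) unit_m1 // scaler0.
have E l (p : chain H (gob i) (gob l)) : csize_gt0 p ->
    \sum_(q <- last_ Y (@gid Y) j l) mm (capp p q) = mm (crcons p (gid l j)).
  move=> hp; rewrite sum_glast sum_gidl sum_csize0 ?scaler0 ?addr0 //.
    by apply: pstar => k; apply: csize_gend.
  by move=> q hq; apply: unit_mm => //; apply: (@leq_add 1 1).
transitivity ((-1) ^+ gsh i *: (0 + (-1) ^+ gsh i *: gd i j +
  \sum_k \sum_(q <- star Y (end_ Y k) i) mm (crcons q (gid k j)))).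
  congr (_ *: (_ + _)); apply: eq_bigr => k _.
  have := pstar (fun l => csize_gend (@gd _ _ _ Y) k l) i.
  elim: (star Y _ i) => [|q s IH]; first by rewrite !big_nil.
  by case/andP=> hq hs; rewrite [LHS]big_cons [RHS]big_cons IH // E.
have E2 : \sum_(q <- star Y (end_ Y j) i) mm (crcons q (Defs.unit C (gob j))) = tau (gd i j).
  rewrite gstar_fix //; last by apply: mlin_suf; apply: hmm.
  rewrite big_seq1 [X in _ + X]big1 ?addr0 => [|k _]; first exact: unit_r.
  apply: sum_csize0 => [|q hq]; first by apply: pstar => l; apply: csize_gend.
  by rewrite /crcons (unit_mm hC (p := hcons _ q) (q := hnil _)) //= addn0.
rewrite sum_gidr E2 add0r.
have [_ oY _] := hY; rewrite (oY i j) scalerA -signr_addb -scalerDl scalerA gm0E.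
have -> : (-1) ^+ gsh i + (-1) ^+ (gsh j (+) ~~ (gsh i (+) gsh j)) = 0 :> K.
  by case: (gsh i) (gsh j) => -[] /=; rewrite ?expr0 ?expr1 ?addNr ?subrr.
by rewrite mulr0 scale0r.
Qed.

End Identity.

(** * Retracts and split generation *)

Section Retracts.
Variables (K : fieldType) (Ob : Type) (C : ainf K Ob) (hC : ainf_axioms C).
Notation H := (Defs.hom C).
Implicit Types X Y Z U V W : gtc C.

Let gtm1l Y Z := @gtm1_lin _ _ _ hC Y Z.
Let gtm2ll Y Z U b := @gtm2_linl _ _ _ hC Y Z U b.
Let gtm2lr Y Z U a := @gtm2_linr _ _ _ hC Y Z U a.
Let hmm A B : mlin (@mm _ _ C A B) := @mlin_mm _ _ _ hC A B.

(** [Y] is a direct summand of [Z] in H^0: u followed by v is the identity. *)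
Definition retract Y Z : Prop := exists (u : gm Y Z) (v : gm Z Y),
  [/\ tclosed false u, tclosed false v & hq false (gtm2 u v) (@gid _ _ _ Y)].

Lemma hqA0 y z Y Z U V (a : gm Y Z) (b : gm Z U) (c : gm U V) :
  gtw Y -> gtw Z -> gtw U -> gtw V ->
  tclosed false a -> tclosed y b -> tclosed z c ->
  hq (y (+) z) (gtm2 (gtm2 a b) c) (gtm2 a (gtm2 b c)).
Proof.
move=> hY hZ hU hV ha hb hc.
by have := hqA hC hY hZ hU hV ha hb hc; rewrite expr0 scale1r.
Qed.

Lemma retract_refl Y : gtw Y -> retract Y Y.
Proof.
move=> hY; exists (@gid _ _ _ Y), (@gid _ _ _ Y); split; try exact: closed_id.
by rewrite gtm2_idl //; apply: hq_refl.
Qed.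

Lemma retract_trans Y Z U : gtw Y -> gtw Z -> gtw U ->
  retract Y Z -> retract Z U -> retract Y U.
Proof.
move=> hY hZ hU [u [v [hu hv e]]] [u' [v' [hu' hv' e']]].
exists (gtm2 u u'), (gtm2 v' v); split; try exact: (@closed2 _ _ _ hC false false).
have hv'v : tclosed false (gtm2 v' v) by apply: (@closed2 _ _ _ hC false false).
apply: (hq_trans hC (hqA0 hY hZ hU hY hu hu' hv'v)).
apply: (hq_trans hC _ e).
apply: (@hq2r _ _ _ hC false false) => //.
apply: (hq_trans hC (hq_sym hC (hqA0 hZ hU hZ hY hu' hv' hv))).
rewrite -[X in hq _ _ X](gtm2_idl hC v hZ).
exact: (@hq2l _ _ _ hC false false).
Qed.

(* Inverts [1 + N] when [N] has square zero. *)
Lemma retract_unip Y Z (u : gm Y Z) (v : gm Z Y) (N : gm Y Y) : gtw Y -> gtw Z ->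
  tclosed false u -> tclosed false v -> tclosed false N -> gtm2 N N = 0 ->
  hq false (gtm2 u v) (@gid _ _ _ Y + N) -> retract Y Z.
Proof.
move=> hY hZ hu hv hN NN e.
have hid := closed_id hC hY.
have hi : tclosed false (@gid _ _ _ Y - N) by apply: closedB.
exists u, (gtm2 v (@gid _ _ _ Y - N)); split=> //.
  exact: (@closed2 _ _ _ hC false false).
apply: (hq_trans hC (hq_sym hC (hqA0 hY hZ hY hY hu hv hi))).
apply: (hq_trans hC (@hq2l _ _ _ hC false false _ _ _ hY hY hY _ _ _ e hi)).
rewrite (linB (@gtm2lr _ _ _ _)) !(linD (@gtm2ll _ _ _ _)) !gtm2_idl // NN.
rewrite (gtm2_idr hC hY hY (proj1 hN)) expr0 scale1r addr0 addrK.
exact: hq_refl.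
Qed.

Definition castH A A' B B' (ea : A = A') (eb : B = B') (x : H A B) : H A' B' :=
  match ea in _ = A1, eb in _ = B1 return H A1 B1 with erefl, erefl => x end.

Section Reindex.
Variables (Y : gtc C) (J : finType) (f : J -> gI Y) (g : gI Y -> J) (N : nat).
Hypotheses (fg : cancel f g) (gf : cancel g f).

Definition reidx : gtc C :=
  @Gtc _ _ C J (@gob _ _ _ Y \o f) (@gsh _ _ _ Y \o f) (fun i j => gd (f i) (f j)) N.

Hypotheses (hY : gtw Y) (hN : gtri reidx).

Lemma star_reidx B (S : gtails C (@gob _ _ _ Y) B) (V : lmodType K) i
    (phi : chain H (gob (f i)) B -> V) : mlin phi ->
  \sum_(p <- gstar (@gd _ _ _ reidx) N (fun i => S (f i)) i) phi p =
  \sum_(p <- gstar (@gd _ _ _ Y) (gN Y) S (f i)) phi p.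
Proof. by move=> h; apply: (gstar_reindex _ (gtw_tri hY) fg gf hN h). Qed.

Lemma last_reidx X (a : gm X Y) (a' : gm X reidx) k (V : lmodType K) i
    (phi : chain H (gob i) (gob (f k)) -> V) :
  (forall i k, a' i k = a i (f k)) -> mlin phi ->
  \sum_(p <- glast (@gd _ _ _ reidx) N a' k i) phi p =
  \sum_(p <- glast (@gd _ _ _ Y) (gN Y) a (f k) i) phi p.
Proof.
move=> e h; rewrite !sum_glast e; congr (_ + _).
rewrite [RHS](reindex f) /=; last by exists g => ? _.
apply: eq_bigr => l _; rewrite e.
exact: (star_reidx (gend (@gd _ _ _ Y) (f k)) (mlin_cons _ h)).
Qed.

Definition reidx_to : gm Y reidx := fun i k => @gid _ _ _ Y i (f k).
Definition reidx_from : gm reidx Y := fun k i => @gid _ _ _ Y (f k) i.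

Lemma gtw_reidx : gtw reidx.
Proof.
have [tY oY mY] := hY; split=> //; first by move=> i j; apply: oY.
move=> i j; rewrite -[RHS](mY (f i) (f j)); congr (_ *: _).
exact: (star_reidx (gend (@gd _ _ _ Y) (f j)) (@hmm _ _)).
Qed.

Lemma closed_reidx_to : tclosed false reidx_to.
Proof.
have [pid cid] := closed_id hC hY.
split=> [i k|]; first exact: (pid i (f k)).
apply: gm_ext => i k; have /(congr1 (fun a : gm Y Y => a i (f k))) := cid.
rewrite !gm0E /= => <-; congr (_ *: _); apply: gstar_eqt; last exact: hmm.
by move=> l phi h; apply: last_reidx.
Qed.

Lemma closed_reidx_from : tclosed false reidx_from.
Proof.
have [pid cid] := closed_id hC hY.
split=> [i k|]; first exact: (pid (f i) k).
apply: gm_ext => i k; have /(congr1 (fun a : gm Y Y => a (f i) k)) := cid.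
rewrite !gm0E /= => <-; congr (_ *: _).
exact: (star_reidx (glast _ _ (@gid _ _ _ Y) k) (@hmm _ _)).
Qed.

Lemma sum_gstep_reidx X (a : gm X Y) (a' : gm X reidx) B
    (S : gtails C (@gob _ _ _ Y) B) (S' : gtails C (@gob _ _ _ reidx) B) (V : lmodType K) i
    (phi : chain H (gob i) B -> V) :
  (forall i k, a' i k = a i (f k)) ->
  (forall k (psi : chain H (gob (f k)) B -> V), mlin psi ->
     \sum_(p <- S' k) psi p = \sum_(p <- S (f k)) psi p) -> mlin phi ->
  \sum_(p <- gstep a' S' i) phi p = \sum_(p <- gstep a S i) phi p.
Proof.
move=> e eS h; rewrite !sum_gstep [RHS](reindex f) /=; last by exists g => ? _.
by apply: eq_bigr => l _; rewrite e; apply: eS; apply: mlin_cons.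
Qed.

Lemma reidx_to_from : gtm2 reidx_to reidx_from = @gid _ _ _ Y.
Proof.
rewrite -[RHS](gtm2_idl hC _ hY); apply: gm_ext => i j; congr (_ *: _).
apply: gstar_eqt; last exact: hmm.
move=> l phi h; apply: sum_gstep_reidx => // k psi hpsi.
exact: (star_reidx (glast _ _ (@gid _ _ _ Y) j) hpsi).
Qed.

Lemma retract_reidx : retract Y reidx.
Proof.
exists reidx_to, reidx_from; split; [exact: closed_reidx_to|exact: closed_reidx_from|].
by rewrite reidx_to_from; apply: hq_refl.
Qed.

End Reindex.

Lemma castH_id A B (ea : A = A) (eb : B = B) (x : H A B) : castH ea eb x = x.
Proof. by rewrite (Prop_irrelevance ea erefl) (Prop_irrelevance eb erefl). Qed.

(** The objects of [Z] are tied to those of [Y] only by the equalities [e], which hold after case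
    analysis. Extensionality makes them an equality of families, after which [Z] is literally a
    [reidx]. *)
Lemma retract_reindex Y Z (f : gI Z -> gI Y) (g : gI Y -> gI Z)
    (e : forall k, gob (f k) = @gob _ _ _ Z k) :
  cancel f g -> cancel g f -> gtw Y -> gtri Z ->
  (forall k, @gsh _ _ _ Z k = gsh (f k)) ->
  (forall k l, @gd _ _ _ Z k l = castH (e k) (e l) (gd (f k) (f l))) ->
  gtw Z /\ retract Y Z.
Proof.
case: Z f g e => J ob sh d N /= f g e fg gf hY hZ hsh hd.
have eob : ob = @gob _ _ _ Y \o f by apply: functional_extensionality_dep => k; rewrite /= e.
subst ob.
have esh : sh = @gsh _ _ _ Y \o f by apply: functional_extensionality_dep.
subst sh.
have ed : d = fun i j => gd (f i) (f j).
  apply: functional_extensionality_dep => i; apply: functional_extensionality_dep => j.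
  by rewrite hd castH_id.
subst d.
by split; [exact: (gtw_reidx fg gf hY hZ) | exact: (retract_reidx fg gf hY hZ)].
Qed.

End Retracts.

(** * Cones of retracts *)

Section ConeRetract.
Variables (K : fieldType) (Ob : Type) (C : ainf K Ob) (hC : ainf_axioms C).
Notation H := (Defs.hom C).
Implicit Types X Y Z U V W : gtc C.

Let gtm1l Y Z := @gtm1_lin _ _ _ hC Y Z.
Let gtm2ll Y Z U b := @gtm2_linl _ _ _ hC Y Z U b.
Let gtm2lr Y Z U a := @gtm2_linr _ _ _ hC Y Z U a.
Let hmm A B : mlin (@mm _ _ C A B) := @mlin_mm _ _ _ hC A B.

Lemma gtm2_midr Y Z (c : gm Y Z) t X U (a : gm X (gcone c t)) (b : gm (gcone c t) U) :
  gtri Y -> gtri Z -> coll a = 0 -> gtm2 a b = gtm2 (colr a) (rowr b).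
Proof.
move=> hY hZ a0; apply: gm_ext => i j; congr (_ *: _); apply: gstar_eqt; last exact: hmm.
move=> k phi h; rewrite sum_gstep_col a0 [X in X + _]gstep_eq0l // add0r.
by apply: gstep_eqt => // l psi hpsi; rewrite star_cone_inr.
Qed.

Definition gblk Y1 Y2 Z1 Z2 (c : gm Y1 Y2) t (d : gm Z1 Z2) s
    (a : gm Y1 Z1) (k : gm Y1 Z2) (b : gm Y2 Z2) : gm (gcone c t) (gcone d s) :=
  fun i j => match i, j return H (gcone_ob i) (gcone_ob j) with
    | inl i, inl j => a i j
    | inl i, inr j => k i j
    | inr _, inl _ => 0
    | inr i, inr j => b i j
    end.

Lemma blk_ext Y1 Y2 Z1 Z2 (c : gm Y1 Y2) t (d : gm Z1 Z2) s (A B : gm (gcone c t) (gcone d s)) :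
  rowl (coll A) = rowl (coll B) -> rowl (colr A) = rowl (colr B) ->
  rowr (coll A) = rowr (coll B) -> rowr (colr A) = rowr (colr B) -> A = B.
Proof.
move=> e1 e2 e3 e4; apply: gm_ext => -[i|i] [j|j].
- exact: (congr1 (fun f : gm Y1 Z1 => f i j) e1).
- exact: (congr1 (fun f : gm Y1 Z2 => f i j) e2).
- exact: (congr1 (fun f : gm Y2 Z1 => f i j) e3).
- exact: (congr1 (fun f : gm Y2 Z2 => f i j) e4).
Qed.

Section Blocks.
Variables (Y1 Y2 Z1 Z2 U1 U2 : gtc C) (c : gm Y1 Y2) (d : gm Z1 Z2) (e : gm U1 U2).
Hypotheses (hY1 : gtri Y1) (hY2 : gtri Y2) (hZ1 : gtri Z1) (hZ2 : gtri Z2)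
  (hU1 : gtri U1) (hU2 : gtri U2).
Notation blk a k b := (@gblk _ _ _ _ c false d false a k b).

Lemma gblkB a k b a' k' b' :
  blk a k b - blk a' k' b' = blk (a - a') (k - k') (b - b').
Proof. by apply: gm_ext => -[i|i] [j|j]; rewrite gmDE gmNE //= subr0. Qed.

Lemma gtm1_blk a k b :
  gtm1 (blk a k b) = blk (gtm1 a) (gtm1 k + gtm2 a d + gtm2 c b) (gtm1 b).
Proof.
have e1 : rowl (coll (blk a k b)) = a by apply: gm_ext.
have e2 : rowl (colr (blk a k b)) = k by apply: gm_ext.
have e3 : rowr (coll (blk a k b)) = 0 by apply: gm_ext.
have e4 : rowr (colr (blk a k b)) = b by apply: gm_ext.
apply: blk_ext.
- rewrite gtm1_coll // gtm1_rowl // e1 e3 (lin0 (@gtm2lr _ _ _ _)) addr0.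
  by apply: gm_ext.
- rewrite gtm1_colr //.
  rewrite -[LHS]/(rowl (gtm1 (colr (blk a k b))) + rowl (gtm2 (coll (blk a k b)) d)).
  rewrite gtm1_rowl // gtm2_rowl // e1 e2 e4 addrAC.
  by apply: gm_ext.
- rewrite gtm1_coll // gtm1_rowr // e3 (gtm10 hC) scaler0.
  by apply: gm_ext.
- rewrite gtm1_colr //.
  rewrite -[LHS]/(rowr (gtm1 (colr (blk a k b))) + rowr (gtm2 (coll (blk a k b)) d)).
  rewrite gtm1_rowr // gtm2_rowr // e3 e4 (lin0 (@gtm2ll _ _ _ _)) scaler0 addr0 scale1r.
  by apply: gm_ext.
Qed.

Lemma gtm2_blk a k b a' k' b' : exists k'',
  gtm2 (blk a k b) (@gblk _ _ _ _ d false e false a' k' b') =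
  @gblk _ _ _ _ c false e false (gtm2 a a') k'' (gtm2 b b').
Proof.
set A := blk a k b; set B := gblk _ _ _.
exists (rowl (colr (gtm2 A B))).
have a1 : rowl (coll A) = a by apply: gm_ext.
have a3 : rowr (coll A) = 0 by apply: gm_ext.
have a3' : coll (rowr A) = 0 by apply: gm_ext.
have a4 : colr (rowr A) = b by apply: gm_ext.
have b1 : rowl (coll B) = a' by apply: gm_ext.
have b3 : rowr (coll B) = 0 by apply: gm_ext.
have b3' : coll (rowr B) = 0 by apply: gm_ext.
have b4 : colr (rowr B) = b' by apply: gm_ext.
apply: blk_ext.
- rewrite gtm2_coll // gtm2_mid // gtm2_rowl // a1 b1.
  by apply: gm_ext.
- rewrite gtm2_coll // gtm2_rowr // gtm2_midr // b3 (lin0 (@gtm2lr _ _ _ _)) scaler0.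
  by apply: gm_ext.
- rewrite -[LHS]/(colr (rowr (gtm2 A B))) gtm2_rowr // gtm2_midr // scale1r.
  by rewrite gtm2_colr // a4 b4.
Qed.

Lemma gtpar_blk x a k b : gtpar x a -> gtpar x k -> gtpar x b -> gtpar x (blk a k b).
Proof. by move=> ha hk hb [i|i] [j|j] //=; exact: has_par0. Qed.

Lemma gid_blk : @gid _ _ _ (gcone c false) = @gblk _ _ _ _ c false c false
  (@gid _ _ _ Y1) 0 (@gid _ _ _ Y2).
Proof.
apply: gm_ext => -[i|i] [j|j].
- have [e'|ne] := eqVneq i j; first by subst j; rewrite gid_eq /= gid_eq.
  by rewrite gid_neq //= gid_neq.
- by rewrite gid_neq.
- by rewrite gid_neq.
- have [e'|ne] := eqVneq i j; first by subst j; rewrite gid_eq /= gid_eq.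
  by rewrite gid_neq //= gid_neq.
Qed.

End Blocks.

(** Conjugating [c] gives [d]. The two squares commute only up to homotopies [k] and [k'], which
    become the off-diagonal entries of triangular maps between the cones. Their composite is
    homotopic to the identity plus a strictly triangular error, which [retract_unip] inverts. *)
Lemma retract_cone Y1 Y2 Z1 Z2 (c : gm Y1 Y2) : gtw Y1 -> gtw Y2 -> gtw Z1 -> gtw Z2 ->
  tclosed true c -> retract Y1 Z1 -> retract Y2 Z2 ->
  exists d : gm Z1 Z2, gtw (gcone d false) /\ retract (gcone c false) (gcone d false).
Proof.
move=> hY1 hY2 hZ1 hZ2 hc [u1 [v1 [hu1 hv1 e1]]] [u2 [v2 [hu2 hv2 e2]]].
have [tY1 tY2 tZ1 tZ2] := And4 (gtw_tri hY1) (gtw_tri hY2) (gtw_tri hZ1) (gtw_tri hZ2).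
pose w := gtm2 v1 c.
have hw : tclosed true w by apply: (@closed2 _ _ _ hC false true).
have hwu : tclosed true (gtm2 w u2) by apply: (@closed2 _ _ _ hC true false).
(* The minus sign is forced by the off-diagonal entry in [gtm1_blk], where the terms with [d] and
   with [c] have the same sign. *)
pose d : gm Z1 Z2 := - gtm2 w u2.
have hd : tclosed true d by apply: closedN.
have hZ : gtw (gcone d false) by case: hd => *; apply: (gtw_cone hC).
have hY : gtw (gcone c false) by case: hc => *; apply: (gtw_cone hC).
exists d; split=> //.
have [k hk ek] : exists2 k, gtpar false k & gtm1 k + gtm2 u1 d + gtm2 c u2 = 0.
  have [h hh eh] : hq true (gtm2 c u2) (gtm2 u1 (gtm2 w u2)).
    apply: hq_trans (@hqA0 _ _ _ hC true false _ _ _ _ _ _ _ hY1 hZ1 hY2 hZ2 hu1 hw hu2) => //.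
    apply: (@hq2l _ _ _ hC true false) => //.
    apply: hq_trans (@hqA0 _ _ _ hC false true _ _ _ _ _ _ _ hY1 hZ1 hY1 hY2 hu1 hv1 hc) => //.
    rewrite -[X in hq _ X _](gtm2_idl hC c hY1).
    by apply: (@hq2l _ _ _ hC false true) => //; apply: hq_sym.
  exists (- h); first exact: gtparN.
  by rewrite (linN (@gtm1l _ _)) -eh (linN (@gtm2lr _ _ _ _)) opprB addrAC subrK subrr.
have [k' hk' ek'] : exists2 k', gtpar false k' & gtm1 k' + gtm2 v1 c + gtm2 d v2 = 0.
  have [h hh eh] : hq true w (gtm2 (gtm2 w u2) v2).
    apply: hq_sym => //.
    apply: (hq_trans hC (hqA hC hZ1 hY2 hZ2 hY2 hw hu2 hv2)).
    (* Associativity with the odd [w] in front and right multiplication by the identity each bring a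
       minus sign; the two cancel. *)
    rewrite expr1 scaleN1r -[X in hq _ _ X]opprK; apply: hqN => //.
    have -> : - w = gtm2 w (@gid _ _ _ Y2).
      by rewrite (gtm2_idr hC hZ1 hY2 (proj1 hw)) expr1 scaleN1r.
    exact: (@hq2r _ _ _ hC true false).
  exists (- h); first exact: gtparN.
  by rewrite (linN (@gtm1l _ _)) -eh (linN (@gtm2ll _ _ _ _)) opprB subrK addrN.
pose UU := @gblk _ _ _ _ c false d false u1 k u2.
pose VV := @gblk _ _ _ _ d false c false v1 k' v2.
have blk0 W1 W2 V1 V2 (r : gm W1 W2) (s : gm V1 V2) :
  @gblk _ _ _ _ r false s false 0 0 0 = 0 by apply: gm_ext => -[i|i] [j|j].
have hUU : tclosed false UU.
  have [[p1 m1] [p2 m2]] := (hu1, hu2); split; first exact: gtpar_blk.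
  by rewrite gtm1_blk // m1 m2 ek blk0.
have hVV : tclosed false VV.
  have [[p1 m1] [p2 m2]] := (hv1, hv2); split; first exact: gtpar_blk.
  by rewrite gtm1_blk // m1 m2 ek' blk0.
have [h1 ph1 eh1] := e1; have [h2 ph2 eh2] := e2.
have [kk ekk] := gtm2_blk c d c tY1 tY2 tZ1 tZ2 tY1 tY2 u1 k u2 v1 k' v2.
pose hh := @gblk _ _ _ _ c false c false h1 0 h2.
have phh : gtpar true hh by apply: gtpar_blk => //; apply: gtpar0.
(* The homotopies [h1] and [h2] remove the diagonal errors exactly, so only an off-diagonal block is
   left, and its square is zero. *)
pose N := gtm2 UU VV - gtm1 hh - @gid _ _ _ (gcone c false).
have [nn eN] : exists nn, N = @gblk _ _ _ _ c false c false 0 nn 0.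
  exists (kk - (gtm1 0 + gtm2 h1 c + gtm2 c h2)).
  have z1 : gtm2 u1 v1 - gtm1 h1 - @gid _ _ _ Y1 = 0 by rewrite addrAC eh1 subrr.
  have z2 : gtm2 u2 v2 - gtm1 h2 - @gid _ _ _ Y2 = 0 by rewrite addrAC eh2 subrr.
  rewrite /N /UU /VV ekk /hh gtm1_blk // gid_blk !gblkB.
  by rewrite z1 z2 subr0.
have hUV : tclosed false (gtm2 UU VV) by apply: (@closed2 _ _ _ hC false false).
have hhh : tclosed false (gtm1 hh).
  split; first exact: (gtpar1 hC hY hY phh).
  rewrite (tw_rel1 hC hY (gtw_tri hY) (gtw_odd hY) phh).
  have -> : gcv (gcone c false) = 0 by apply: gm_ext; apply: gtw_mc.
  by rewrite (lin0 (@gtm2lr _ _ _ _)) scaler0.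
apply: (retract_unip hC (N := N) hY hZ hUU hVV).
- by apply: closedB => //; [apply: closedB | apply: closed_id].
- rewrite eN gtm2_midr //; last by apply: gm_ext => -[i|i] j.
  have -> : rowr (@gblk _ _ _ _ c false c false 0 nn 0) = 0 by apply: gm_ext => i [j|j].
  exact: (lin0 (@gtm2lr _ _ _ _)).
- exists hh => //; rewrite /N addrCA subrr addr0 opprB addrC subrK.
  by [].
Qed.

End ConeRetract.

(** * From objects to all twisted complexes *)

Section Generation.
Variables (K : fieldType) (Ob : Type) (C : ainf K Ob) (hC : ainf_axioms C).
Notation H := (Defs.hom C).
Implicit Types X Y Z U V W : gtc C.
Let hmm A B : mlin (@mm _ _ C A B) := @mlin_mm _ _ _ hC A B.

Definition gzero (I : finType) (ob : I -> Ob) (sh : I -> bool) : gtc C :=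
  @Gtc _ _ C I ob sh (fun _ _ => 0) 1.

Section Zero.
Variables (I : finType) (ob : I -> Ob) (sh : I -> bool).

Lemma star_zero B (S : gtails C ob B) (V : lmodType K) i (phi : chain H (ob i) B -> V) :
  \sum_(p <- gstar (@gd _ _ _ (gzero ob sh)) 1 S i) phi p = \sum_(p <- S i) phi p.
Proof. by rewrite sum_gstarS [X in _ + X]big1 ?addr0 // => k _; rewrite sum_gstar0. Qed.

Lemma gtri_zero : gtri (gzero ob sh).
Proof. by exists (fun=> 0%N). Qed.

Lemma gtw_zero : gtw (gzero ob sh).
Proof.
split; [exact: gtri_zero|by move=> i j; apply: has_par0|move=> i j].
by rewrite /gcv /gcurv star_zero big_seq1 mm_hcons0 // scaler0.
Qed.

Lemma last_zero (Y : gtc C) (a : gm Y (gzero ob sh)) j (V : lmodType K) i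
    (phi : chain H (gob i) (ob j) -> V) : mlin phi ->
  \sum_(p <- glast (@gd _ _ _ (gzero ob sh)) 1 a j i) phi p = phi (hcons (a i j) (hnil _)).
Proof.
move=> h; rewrite sum_glast big1 ?addr0 // => k _.
by rewrite (star_zero (gend (@gd _ _ _ (gzero ob sh)) j) (fun p => phi (hcons (a i k) p))) big_seq1 (mlin_cons0 _ (mlin_cons _ h)).
Qed.

End Zero.

Section ZeroOps.
Variables (I J L : finType) (ob : I -> Ob) (ob' : J -> Ob) (ob'' : L -> Ob)
  (sh : I -> bool) (sh' : J -> bool) (sh'' : L -> bool).

Lemma gt1_zero (a : gm (gzero ob sh) (gzero ob' sh')) i j : gt1 a i j = m1 (a i j).
Proof. rewrite /gt1 star_zero; exact: (@last_zero _ ob' sh' (gzero ob sh) a j _ i _ (@hmm _ _)). Qed.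

Lemma gt2_zero (a : gm (gzero ob sh) (gzero ob' sh')) (b : gm (gzero ob' sh') (gzero ob'' sh'')) i j :
  gt2 a b i j = \sum_k m2 (a i k) (b k j).
Proof.
rewrite /gt2 star_zero sum_gstep; apply: eq_bigr => k _.
rewrite (@star_zero _ ob' sh' _ _ _ k (fun p => mm (hcons (a i k) p))).
exact: (@last_zero _ ob'' sh'' (gzero ob' sh') b j _ k _ (mlin_cons _ (@hmm _ _))).
Qed.

End ZeroOps.

(* [A] is a direct summand, up to homotopy, of a sum of shifts of objects in [P]. *)
Definition obj_gen (P : Ob -> Prop) (A : Ob) : Prop :=
  exists (T : finType) (E : T -> Ob) (p : T -> bool)
    (u : forall t, H A (E t)) (v : forall t, H (E t) A) (h : H A A),
  [/\ forall t, P (E t),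
      forall t, has_par (p t) (u t) /\ m1 (u t) = 0,
      forall t, has_par (p t) (v t) /\ m1 (v t) = 0,
      has_par true h &
      Defs.unit C A = \sum_t m2 (u t) (v t) + m1 h].

Lemma obj_gen_retract P A s : obj_gen P A ->
  exists Z, [/\ gtw Z, forall k, P (@gob _ _ _ Z k) &
    retract (@gzero Datatypes_unit__canonical__fintype_Finite (fun=> A) (fun=> s)) Z].
Proof.
move=> [T [E [p [u [v [h [hP hu hv ph eh]]]]]]].
pose Y := @gzero Datatypes_unit__canonical__fintype_Finite (fun=> A) (fun=> s).
(* Shifting [E t] by the parity of [u t] and [v t] turns both families into matrices of degree 0. *)
pose Z := @gzero T E (fun t => s (+) p t).
exists Z; split=> //; first exact: gtw_zero.
pose U : gm Y Z := fun _ t => u t.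
pose V : gm Z Y := fun t _ => v t.
exists U, V; split.
- split=> [i t|]; last by apply: gm_ext => i t; rewrite /gtm1 gt1_zero (proj2 (hu t)) scaler0.
  by apply: (has_par_eq (proj1 (hu t))) => /=; case: (s) (p t) => -[].
- split=> [t i|]; last by apply: gm_ext => t i; rewrite /gtm1 gt1_zero (proj2 (hv t)) scaler0.
  by apply: (has_par_eq (proj1 (hv t))) => /=; case: (s) (p t) => -[].
apply: hq_sym => //.
exists (fun _ _ => h).
  by move=> i j; apply: (has_par_eq ph) => /=; case: (s).
apply: gm_ext => -[] []; rewrite gmDE gmNE gid_eq /gtm2 /gtm1 gt1_zero gt2_zero /=.
by rewrite -scalerBr eh addrC addKr.
Qed.

(** Induction on the number of summands: a summand of maximal height has no outgoing differential,
    so the complex is the cone of a map from the rest to that object, and [retract_cone] applies. *)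
Lemma gtc_gen P : (forall A, obj_gen P A) -> forall n Y, gtw Y -> #|gI Y| = n ->
  exists Z, [/\ gtw Z, forall k, P (@gob _ _ _ Z k) & retract Y Z].
Proof.
move=> hP; elim=> [|n IH] Y hY cY.
  exists Y; split=> //; last exact: retract_refl.
  by move=> k; move/eqP: cY; rewrite -cardsT cards_eq0 => /eqP/setP/(_ k); rewrite !inE.
have [ht htN htd] := gtw_tri hY.
have /card_gt0P [x0 _] : (0 < #|gI Y|)%N by rewrite cY.
pose i0 := [arg max_(i > x0) ht i].
have hi0 i : (ht i <= ht i0)%N by rewrite /i0; case: arg_maxnP => // j _; apply.
pose J : finType := {i | i != i0}.
pose Y1 : gtc C := @Gtc _ _ C J (fun j => gob (val j)) (fun j => gsh (val j))
  (fun i j => gd (val i) (val j)) (gN Y).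
pose Y2 := @gzero Datatypes_unit__canonical__fintype_Finite (fun=> gob i0) (fun=> gsh i0).
pose c : gm Y1 Y2 := fun j _ => gd (val j) i0.
pose W := gcone c false.
pose f (k : gI W) : gI Y := match k with inl j => val j | inr _ => i0 end.
pose g (i : gI Y) : gI W := if insub i is Some j then inl j else inr tt.
have fg : cancel f g.
  by case=> [j|[]] /=; rewrite /g ?valK // insubF // eqxx.
have gf : cancel g f.
  by move=> i; rewrite /g; case: insubP => [j _ //|]; rewrite negbK => /eqP.
have t1 : gtri Y1 by apply: (tri_comp _ (gtw_tri hY)).
have t2 : gtri Y2 by apply: gtri_zero.
have tW : gtri W by apply: tri_cone.
pose e k : gob (f k) = @gob _ _ _ W k := match k with inl _ => erefl | inr _ => erefl end.
have [hW rW] : gtw W /\ retract Y W.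
  apply: (@retract_reindex _ _ _ hC Y W f g e) => //; first by case.
  by case=> [i|i] [j|j] //=; rewrite htd.
have [_ oW mW] := hW.
have h1 : gtw Y1.
  split=> //; first by move=> i j; apply: (oW (inl i) (inl j)).
  by move=> i j; have := mW (inl i) (inl j); rewrite -[gcv W _ _]/(rowl (coll (gcv W)) i j) gcv_ll.
have h2 : gtw Y2 by apply: gtw_zero.
have hc : tclosed true c.
  split; first by move=> i j; apply: (has_par_eq (oW (inl i) (inr j))).
  apply: gm_ext => i j; have := mW (inl i) (inr j).
  by rewrite -[gcv W _ _]/(rowl (colr (gcv W)) i j) gcv_lr.
have c1 : #|gI Y1| = n.
  by rewrite /= card_sig; have := cardC1 i0; rewrite cY /= => <-; apply: eq_card.
have [Z1 [w1 p1 r1]] := IH Y1 h1 c1.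
have [Z2 [w2 p2 r2]] := obj_gen_retract (gsh i0) (hP (gob i0)).
have [d [wd rd]] := retract_cone hC h1 h2 w1 w2 hc r1 r2.
exists (gcone d false); split=> //; first by case=> k; [apply: p1|apply: p2].
exact: (retract_trans hC hY hW wd rW rd).
Qed.

Definition g_of (T : tcomplex C) : gtc C :=
  @Gtc _ _ C (ordinal (tc_size T)) (@tc_ob _ _ _ T) (@tc_sh _ _ _ T) (@tc_delta _ _ _ T) (tc_size T).

Lemma tstarE (T : tcomplex C) B (S : tails T B) :
  tstar S = gstar (@gd _ _ _ (g_of T)) (tc_size T) S.
Proof.
have E n : titer n S = giter (@gd _ _ _ (g_of T)) n S by elim: n => //= n ->.
apply: functional_extensionality_dep => i; rewrite /tstar /gstar; congr flatten.
by apply: eq_map => n; rewrite E.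
Qed.

Lemma tm1E (Y Z : tcomplex C) (a : tmat Y Z) :
  tm1 a = gtm1 (a : gm (g_of Y) (g_of Z)) :> gm (g_of Y) (g_of Z).
Proof. by apply: gm_ext => i j; rewrite /tm1 tstarE /tlast tstarE. Qed.

Lemma tm2E (Y Z U : tcomplex C) (a : tmat Y Z) (b : tmat Z U) :
  tm2 a b = gtm2 (a : gm (g_of Y) (g_of Z)) (b : gm (g_of Z) (g_of U)) :> gm (g_of Y) (g_of U).
Proof. by apply: gm_ext => i j; rewrite /tm2 !tstarE /tlast tstarE. Qed.

Lemma is_twistedE (T : tcomplex C) : is_twisted T <-> gtw (g_of T) /\
  (forall i j : 'I_(tc_size T), (j <= i)%N -> tc_delta i j = 0).
Proof.
split=> [[h1 h2 h3]|[[_ h2 h3] h1]].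
  split=> //; split=> //; first by exists val => //= i j; apply: h1.
  by move=> i j; rewrite /gcv /gcurv -[gN _]/(tc_size T) -tstarE h3 scaler0.
split=> // i j; rewrite tstarE.
have /(congr1 ( *:%R ((-1) ^+ @gsh _ _ _ (g_of T) i))) := h3 i j.
by rewrite scaler0 scalerA -signr_addb addbb scale1r.
Qed.

Lemma tcocycleE (Y Z : tcomplex C) (a : tmat Y Z) :
  tcocycle a <-> tclosed false (a : gm (g_of Y) (g_of Z)).
Proof.
rewrite /tcocycle /tclosed -tm1E; split=> -[h1 h2]; split=> //.
  by apply: gm_ext => i j; apply: h2.
by move=> i j; have /(congr1 (fun f : gm (g_of Y) (g_of Z) => f i j)) := h2.
Qed.

Lemma tcohomE (Y Z : tcomplex C) (a b : tmat Y Z) :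
  tcohom a b <-> hq false (a : gm (g_of Y) (g_of Z)) b.
Proof.
split=> -[h ph eh]; exists h => //; rewrite -?tm1E; first by apply: gm_ext => i j; apply: eh.
move=> i j; have /(congr1 (fun f : gm (g_of Y) (g_of Z) => f i j)) := eh.
by rewrite -tm1E.
Qed.

(** Sorting the summands by height gives the strictly triangular numbering by ordinals that
    [is_twisted] demands. *)
Lemma gtc_sort Y : gtw Y -> exists T : tcomplex C,
  [/\ is_twisted T, forall k : 'I_(tc_size T), exists i, tc_ob k = @gob _ _ _ Y i &
      retract Y (g_of T)].
Proof.
move=> hY; have [ht htN htd] := gtw_tri hY.
pose le i j := (ht i <= ht j)%N.
pose s := sort le (enum (gI Y)).
have us : uniq s by rewrite sort_uniq enum_uniq.
have ms i : i \in s by rewrite mem_sort mem_enum.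
pose f (k : 'I_(size s)) := tnth (in_tuple s) k.
have is_ i : (index i s < size s)%N by rewrite index_mem.
pose g i := Ordinal (is_ i).
have fg : cancel f g.
  move=> k; apply: val_inj => /=.
  rewrite /f (tnth_nth (f k)) /= index_uniq //.
have gf : cancel g f by move=> i; rewrite /f (tnth_nth i) /= nth_index.
pose T := @TComplex _ _ C (size s) (@gob _ _ _ Y \o f) (@gsh _ _ _ Y \o f)
  (fun i j => gd (f i) (f j)).
have hT (i j : 'I_(size s)) : (j <= i)%N -> gd (f i) (f j) = 0.
  move=> ji; apply: htd; rewrite /f !(tnth_nth (f i)) /=.
  have tr : transitive le by move=> x y z; apply: leq_trans.
  have so : sorted le s by apply: sort_sorted => x y; apply: leq_total.
  by apply: (sorted_leq_nth tr) => //; rewrite ?inE ?ltn_ord // => x; apply: leqnn.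
have tT : gtri (g_of T) by exists val => //= i j; apply: hT.
have [wT rT] := @retract_reindex _ _ _ hC Y (g_of T) f g (fun=> erefl) fg gf hY tT
  (fun=> erefl) (fun _ _ => erefl).
by exists T; split=> //; [apply/is_twistedE | move=> k; exists (f k)].
Qed.

Theorem split_generates_obj P : (forall A, obj_gen P A) -> split_generates C P.
Proof.
move=> hP T e [/is_twistedE [hT sT] ce ee].
have [Z [hZ pZ rZ]] := gtc_gen hP hT erefl.
have [T' [/is_twistedE [hT' sT'] oT' rT']] := gtc_sort hZ.
have [u [v [hu hv uv]]] := retract_trans hC hT hZ hT' rZ rT'.
move/tcocycleE: ce => ce; move/tcohomE: ee; rewrite tm2E => ee.
set Y := g_of T in hT rZ u v hu hv uv ce ee; set W := g_of T' in hT' rT' u v hu hv uv.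
pose E : gm Y Y := e.
(* As [T] is a retract of [T'], the idempotent [e] is carried to [f] = v e u on [T'], and e u and v
   e are inverse isomorphisms between (T, e) and (T', f). Composites are read from left to right. *)
pose U := gtm2 E u; pose V := gtm2 v E; pose f := gtm2 v U.
have c2 X1 X2 X3 (a : gm X1 X2) (b : gm X2 X3) : gtw X1 -> gtw X2 -> gtw X3 ->
  tclosed false a -> tclosed false b -> tclosed false (gtm2 a b).
  by move=> h1 h2 h3; apply: (@closed2 _ _ _ hC false false).
have asl X1 X2 X3 X4 (a : gm X1 X2) (b : gm X2 X3) (c : gm X3 X4) :
    gtw X1 -> gtw X2 -> gtw X3 -> gtw X4 ->
    tclosed false a -> tclosed false b -> tclosed false c ->
    hq false (gtm2 (gtm2 a b) c) (gtm2 a (gtm2 b c)).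
  by move=> h1 h2 h3 h4; apply: (@hqA0 _ _ _ hC false false).
have cl X1 X2 X3 (a a' : gm X1 X2) (b : gm X2 X3) : gtw X1 -> gtw X2 -> gtw X3 ->
    hq false a a' -> tclosed false b -> hq false (gtm2 a b) (gtm2 a' b).
  by move=> h1 h2 h3; apply: (@hq2l _ _ _ hC false false).
have cr X1 X2 X3 (a : gm X1 X2) (b b' : gm X2 X3) : gtw X1 -> gtw X2 -> gtw X3 ->
    tclosed false a -> hq false b b' -> hq false (gtm2 a b) (gtm2 a b').
  by move=> h1 h2 h3; apply: (@hq2r _ _ _ hC false false).
have hU : tclosed false U by apply: c2.
have hV : tclosed false V by apply: c2.
have hf : tclosed false f by apply: c2.
(* u (v U) ~ U, where U = e u *)
have uf : hq false (gtm2 u f) U.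
  apply: (hq_trans hC (hq_sym hC (asl _ _ _ _ _ _ _ hT hT' hT hT' hu hv hU))).
  by rewrite -[X in hq _ _ X](gtm2_idl hC U hT); apply: cl.
have EU : hq false (gtm2 E U) U.
  apply: (hq_trans hC (hq_sym hC (asl _ _ _ _ _ _ _ hT hT hT hT' ce ce hu))).
  exact: cl.
have Uf : hq false (gtm2 U f) U.
  apply: (hq_trans hC (asl _ _ _ _ _ _ _ hT hT hT' hT' ce hu hf)).
  by apply: (hq_trans hC _ EU); apply: cr.
have VE : hq false (gtm2 V E) V.
  apply: (hq_trans hC (asl _ _ _ _ _ _ _ hT' hT hT hT hv ce ce)).
  exact: cr.
have Vu : hq false (gtm2 V u) f by apply: asl.
have ff : hq false (gtm2 f f) f.
  apply: (hq_trans hC (asl _ _ _ _ _ _ _ hT' hT hT' hT' hv hU hf)).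
  exact: cr.
have UV : hq false (gtm2 U V) E.
  apply: (hq_trans hC (asl _ _ _ _ _ _ _ hT hT hT' hT ce hu hV)).
  apply: (hq_trans hC (cr _ _ _ _ _ _ hT hT hT ce
    (hq_sym hC (asl _ _ _ _ _ _ _ hT hT' hT hT hu hv ce)))).
  apply: (hq_trans hC (cr _ _ _ _ _ _ hT hT hT ce (cl _ _ _ _ _ _ hT hT hT uv ce))).
  by rewrite gtm2_idl.
have VU : hq false (gtm2 V U) f.
  apply: (hq_trans hC (asl _ _ _ _ _ _ _ hT' hT hT hT' hv ce hU)).
  exact: cr.
have fV : hq false (gtm2 f V) V.
  apply: (hq_trans hC (asl _ _ _ _ _ _ _ hT' hT hT' hT hv hU hV)).
  exact: cr.
have dE : is_dpi (f : tmat T' T').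
  split; [exact/is_twistedE|exact/tcocycleE|].
  by apply/tcohomE; rewrite tm2E.
exists T', (f : tmat T' T'); split=> //.
  by move=> i; have [k ->] := oT' i; apply: pZ.
exists (U : tmat T T'), (V : tmat T' T); split.
- by split; [exact/tcocycleE| |]; apply/tcohomE; rewrite tm2E.
- by split; [exact/tcocycleE| |]; apply/tcohomE; rewrite tm2E.
- by apply/tcohomE; rewrite tm2E.
- by apply/tcohomE; rewrite tm2E.
Qed.

End Generation.

(** * Duality and traces *)

Section Cohomology.
Variables (K : fieldType) (Ob : Type) (C : ainf K Ob) (hC : ainf_axioms C).
Hypothesis two_neq0 : (2 : K) != 0.
Notation H := (Defs.hom C).
Let hmm A B : mlin (@mm _ _ C A B) := @mlin_mm _ _ _ hC A B.

Lemma m1_lin A B : linear (@m1 _ _ C A B).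
Proof. by move=> a x y; apply: (@hmm _ _ _ _ (hnil A) (hnil B)). Qed.

Lemma m2_linl A B D (y : H B D) : linear (fun x : H A B => m2 x y).
Proof. by move=> a x x'; apply: (@hmm _ _ _ _ (hnil A) (hcons y (hnil D))). Qed.

Lemma m2_linr A B D (x : H A B) : linear (fun y : H B D => m2 x y).
Proof. by move=> a y y'; apply: (@hmm _ _ _ _ (hcons x (hnil B)) (hnil D)). Qed.

Lemma m2Dl A B D (x x' : H A B) (y : H B D) : m2 (x + x') y = m2 x y + m2 x' y.
Proof. exact: (linD (@m2_linl _ _ _ y)). Qed.
Lemma m2Zl A B D a (x : H A B) (y : H B D) : m2 (a *: x) y = a *: m2 x y.
Proof. exact: (linZ (@m2_linl _ _ _ y)). Qed.
Lemma m2Dr A B D (x : H A B) (y y' : H B D) : m2 x (y + y') = m2 x y + m2 x y'.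
Proof. exact: (linD (@m2_linr _ _ _ x)). Qed.
Lemma m2Zr A B D a (x : H A B) (y : H B D) : m2 x (a *: y) = a *: m2 x y.
Proof. exact: (linZ (@m2_linr _ _ _ x)). Qed.
Lemma m20l A B D (y : H B D) : m2 (0 : H A B) y = 0.
Proof. exact: (lin0 (@m2_linl _ _ _ y)). Qed.
Lemma m20r A B D (x : H A B) : m2 x (0 : H B D) = 0.
Proof. exact: (lin0 (@m2_linr _ _ _ x)). Qed.

Lemma m1_tau A B (x : H A B) : tau (m1 x) = - m1 (tau x).
Proof. by rewrite /m1 mm_par // expr1 scaleN1r. Qed.

Lemma m2_tau A B D (x : H A B) (y : H B D) : tau (m2 x y) = m2 (tau x) (tau y).
Proof. by rewrite /m2 mm_par //= sqrrN expr1n scale1r. Qed.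

Lemma has_par_m1 b A B (x : H A B) : has_par b x -> has_par (~~ b) (m1 x).
Proof.
by rewrite /has_par m1_tau => ->; rewrite (linZ (@m1_lin A B)) signrN scaleNr.
Qed.

Lemma has_par_m2 b b' A B D (x : H A B) (y : H B D) :
  has_par b x -> has_par b' y -> has_par (b (+) b') (m2 x y).
Proof.
rewrite /has_par m2_tau => -> ->; rewrite (linZ (@m2_linl _ _ _ _)).
by rewrite (linZ (@m2_linr _ _ _ _)) scalerA -signr_addb.
Qed.

Lemma mm_hcons10 A B D E (x : H A B) (p : chain H D E) : mm (hcons x (hcons 0 p)) = 0.
Proof. exact: (mlin0 (hcons x (hnil _)) p (@hmm _ _)). Qed.

Lemma mm_hcons20 A B D E F (x : H A B) (y : H B D) (p : chain H E F) :
  mm (hcons x (hcons y (hcons 0 p))) = 0.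
Proof. exact: (mlin0 (hcons x (hcons y (hnil _))) p (@hmm _ _)). Qed.

Lemma mm_hcons30 A B D E F G (x : H A B) (y : H B D) (z : H D E) (p : chain H F G) :
  mm (hcons x (hcons y (hcons z (hcons 0 p)))) = 0.
Proof. exact: (mlin0 (hcons x (hcons y (hcons z (hnil _)))) p (@hmm _ _)). Qed.

Let mmE := (mm_nil hC, mm_hcons0 hC, mm_hcons10, mm_hcons20, mm_hcons30, addr0, add0r).

Lemma m1m2 A B D (x : H A B) (y : H B D) :
  m1 (m2 x y) = - m2 (m1 x) y - m2 (kos x) (m1 y).
Proof.
have := mm_rel hC (hcons x (hcons y (hnil D))).
rewrite /= ?(big_cons, big_nil) /cfst /csnd /= ?(big_cons, big_nil) /= !mmE.
rewrite -/(m1 x) -/(m1 y) -/(m2 (m1 x) y) -/(m2 x y) -/(m1 (m2 x y)) -/(m2 (kos x) (m1 y)).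
by move/eqP; rewrite addrAC addrC addr_eq0 opprD => /eqP.
Qed.

(** The three-input relation. The condition on m_3 holds wherever m_1 vanishes, as on endomorphisms
    of a sphere; there associativity is exact. *)
Lemma m2A A B D E (x : H A B) (y : H B D) (z : H D E) :
  m1 x = 0 -> m1 y = 0 -> m1 z = 0 ->
  m1 (mm (hcons x (hcons y (hcons z (hnil E))))) = 0 ->
  m2 (m2 x y) z = - m2 (kos x) (m2 y z).
Proof.
move=> hx hy hz h3.
have := mm_rel hC (hcons x (hcons y (hcons z (hnil E)))).
rewrite /= ?(big_cons, big_nil) /cfst /csnd /= ?(big_cons, big_nil) /= !mmE.
rewrite -/(m1 x) -/(m1 y) -/(m1 z) hx hy hz !mmE.
rewrite -/(m2 x y) -/(m2 y z) -[mm (hcons (mm _) (hnil E))]/(m1 (mm _)) h3 addr0.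
by move/eqP; rewrite addr_eq0 => /eqP.
Qed.

Lemma m1m2_closed A B D (x : H A B) (y : H B D) : m1 x = 0 -> m1 y = 0 -> m1 (m2 x y) = 0.
Proof.
move=> hx hy; rewrite m1m2 hx hy /m2 mm_hcons0 // mm_hcons10.
by rewrite subr0 oppr0.
Qed.

Section Parity.
Variables A B : Ob.
Implicit Types x y : H A B.

Lemma hpart_lin d : linear (@hpart _ _ C d A B).
Proof.
move=> a x y; rewrite /hpart (linearP tau) !scalerDr !scalerA.
by rewrite addrACA; congr (_ + _ + (_ + _)); congr (_ *: _); ring.
Qed.

Lemma hpart_par d x : has_par d (hpart d x).
Proof.
rewrite /has_par /hpart linearZ /= linearD linearZ /= tauK //.
rewrite [RHS]scalerA [(-1) ^+ d * _]mulrC -scalerA; congr (_ *: _).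
by rewrite scalerDr scalerA -signr_addb addbb scale1r addrC.
Qed.

Lemma hpart_id d x : has_par d x -> hpart d x = x.
Proof.
rewrite /has_par /hpart => ->; rewrite scalerA -signr_addb addbb scale1r.
by rewrite -mulr2n -scaler_nat scalerA mulVf // scale1r.
Qed.

Lemma hpart0 d x : has_par (~~ d) x -> hpart d x = 0.
Proof.
rewrite /has_par /hpart => ->; rewrite scalerA -signr_addb addbN addbb expr1 scaleN1r.
by rewrite subrr scaler0.
Qed.

Lemma hpartE x : \sum_(d : bool) hpart d x = x.
Proof.
rewrite big_bool /hpart /= -scalerDr expr0 expr1 scale1r scaleN1r addrACA addNr addr0.
by rewrite -mulr2n -scaler_nat scalerA mulVf // scale1r.
Qed.

Lemma hpart_m1 d x : hpart d (m1 x) = m1 (hpart (~~ d) x).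
Proof.
rewrite /hpart m1_tau (linZ (@m1_lin A B)) (linD (@m1_lin A B)) (linZ (@m1_lin A B)).
by rewrite signrN scalerN scaleNr.
Qed.

Lemma hpart_closed d x : m1 x = 0 -> m1 (hpart d x) = 0.
Proof. by move=> h; rewrite -[d]negbK -hpart_m1 h (lin0 (hpart_lin _)). Qed.

Lemma cyc_linear_l (z : H B A) : linear (fun x => cyc x z : K^o).
Proof. by move=> a x y; apply: (cyc_linl hC). Qed.

Lemma cyc_linear_r x : linear (fun z : H B A => cyc x z : K^o).
Proof. by move=> a z z'; apply: (cyc_linr hC). Qed.

Lemma cycNl x (z : H B A) : cyc (- x) z = - cyc x z.
Proof. exact: (linN (@cyc_linear_l z)). Qed.
Lemma cycNr x (z : H B A) : cyc x (- z) = - cyc x z.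
Proof. exact: (linN (@cyc_linear_r x)). Qed.
Lemma cycDl x y (z : H B A) : cyc (x + y) z = cyc x z + cyc y z.
Proof. exact: (linD (@cyc_linear_l z)). Qed.
Lemma cycDr x (y z : H B A) : cyc x (y + z) = cyc x y + cyc x z.
Proof. exact: (linD (@cyc_linear_r x)). Qed.
Lemma cycZl a x (z : H B A) : cyc (a *: x) z = a * cyc x z.
Proof. exact: (linZ (@cyc_linear_l z)). Qed.
Lemma cycZr a x (z : H B A) : cyc x (a *: z) = a * cyc x z.
Proof. exact: (linZ (@cyc_linear_r x)). Qed.
Lemma cyc0l (z : H B A) : cyc (0 : H A B) z = 0.
Proof. exact: (lin0 (@cyc_linear_l z)). Qed.
Lemma cyc0r x : cyc x (0 : H B A) = 0.
Proof. exact: (lin0 (@cyc_linear_r x)). Qed.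

Lemma cyc_has_par d d' x (z : H B A) : has_par d x -> has_par d' z -> d != d' -> cyc x z = 0.
Proof.
move=> hx hz ne; have := cyc_par hC x z; rewrite hx hz.
rewrite cycZl cycZr.
have /eqP := two_neq0; case: d d' ne {hx hz} => -[] // _ h2; rewrite /= !expr0 !expr1 ?mul1r ?mulN1r => /eqP.
  by rewrite eq_sym -subr_eq0 opprK -mulr2n -mulr_natl mulf_eq0 => /orP[/eqP|/eqP].
by rewrite eq_sym -subr_eq0 opprK -mulr2n -mulr_natl mulf_eq0 => /orP[/eqP|/eqP].
Qed.

End Parity.

(** Cyclicity for each parity of [w]; the remaining sign is absorbed because the pairing, of even
    degree, is invariant under [tau]. *)
Lemma cyc_m1 A B (x : H A B) (w : H B A) : cyc (m1 x) w = cyc (m1 w) x.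
Proof.
have P d (w' : H B A) : has_par d w' -> cyc (m1 x) w' = cyc (m1 w') x.
  move=> hw; rewrite /m1 (cyc_mm hC (hnil A) x hw).
  case: d hw => hw //=; have := has_par_m1 hw.
  rewrite /has_par -/(m1 w') expr1 scaleN1r => e.
  by rewrite -(cyc_par hC) e /kos linearN /= tauK // cycNl cycNr opprK.
rewrite -[in LHS](hpartE w) -[in RHS](hpartE w) !big_bool /=.
rewrite cycDr (linD (@m1_lin _ _)) cycDl.
by rewrite !(P _ _ (hpart_par _ _)).
Qed.

End Cohomology.

(** Some coordinate of the component of [x] outside [W] is non-zero. *)
Lemma separating (K : fieldType) (V : vectType K) (W : {vspace V}) (x : V) : x \notin W ->
  exists phi : V -> K^o, [/\ linear phi, forall y, y \in W -> phi y = 0 & phi x != 0].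
Proof.
move=> xW; pose r y := y - projv W y.
have rW y : y \in W -> r y = 0 by move=> yW; rewrite /r projv_id // subrr.
have rx : r x != 0.
  by apply: contra xW; rewrite subr_eq0 => /eqP ->; apply: memv_proj.
have rl : linear r.
  by move=> a y z; rewrite /r linearP scalerBr opprD addrACA.
have [i hi] : exists i, coord (vbasis fullv) i (r x) != 0.
  apply/existsP; apply: contraNT rx; rewrite negb_exists => /forallP h.
  rewrite (coord_vbasis (memvf (r x))) big1 // => i _.
  by have := h i; rewrite negbK => /eqP ->; rewrite scale0r.
exists (fun y => coord (vbasis fullv) i (r y)); split=> //.
  by move=> a y z; rewrite rl linearP.
by move=> y yW; rewrite rW // linear0.
Qed.

Section Duality.
Variables (K : fieldType) (Ob : Type) (C : ainf K Ob) (hC : ainf_axioms C).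
Hypothesis two_neq0 : (2 : K) != 0.
Notation H := (Defs.hom C).

Lemma cyc_m2 d A B D (x : H A B) (y : H B D) (w : H D A) : has_par d w ->
  cyc (m2 x y) w = cyc (m2 w (kosp (~~ d) x)) (kosp (~~ d) y).
Proof. exact: (cyc_mm hC (hcons x (hnil B)) y). Qed.

Lemma cyc_m2_even A B D (x : H A B) (y : H B D) (w : H D A) : has_par false w ->
  cyc (m2 x y) w = cyc (m2 w (tau x)) (tau y).
Proof.
move=> hw; rewrite (cyc_m2 _ _ hw) /= /kos (cycNr hC).
by rewrite (linN (@m2_linr _ _ _ hC _ _ _ _)) (cycNl hC) opprK.
Qed.

Lemma cyc_m2_unit A B (x : H A B) (y : H B A) : cyc (m2 x y) (Defs.unit C A) = cyc x y.
Proof. by rewrite cyc_m2_even ?unit_l //; [exact: cyc_par | exact: unit_par]. Qed.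

Lemma cyc_exact A B (x : H A B) (w : H B A) : m1 w = 0 -> cyc (m1 x) w = 0.
Proof. by move=> h; rewrite (cyc_m1 hC) // h (cyc0l hC). Qed.

Definition cycrow A B (w : H B A) : 'rV[K]_(\dim (fullv : {vspace H A B})) :=
  \row_i cyc (tnth (vbasis fullv) i) w.

Lemma cycrow_lin A B : linear (@cycrow A B).
Proof. by move=> a x y; apply/rowP => i; rewrite !mxE (cyc_linr hC). Qed.

Lemma cycrow_inj A B (w : H B A) : cycrow w = 0 -> w = 0.
Proof.
move=> h; apply: (cyc_ndr hC) => x.
rewrite (coord_vbasis (memvf x)).
rewrite (big_morph (fun z => cyc z w) (fun a b => cycDl hC a b w) (cyc0l hC w)).
apply: big1 => i _; rewrite (cycZl hC) -tnth_nth.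
have /rowP/(_ i) := h; rewrite !mxE => ->.
by rewrite mulr0.
Qed.

Lemma cycrow_dim A B : (\dim {: H B A} <= \dim {: H A B})%N.
Proof.
have := limg_dim_eq (f := linfun (@cycrow A B)) (U := fullv).
rewrite capfv => /(_ _)/esym -> //; last first.
  apply/eqP; rewrite -subv0; apply/subvP => w; rewrite memv_ker memv0 linfunE; last exact: cycrow_lin.
  by move=> /eqP/cycrow_inj ->.
by rewrite (leq_trans (dimvS (subvf _))) // dimvf /dim /= mul1n.
Qed.

(** Non-degeneracy embeds each of hom(A, B) and hom(B, A) into the dual of the other; the dimensions
    are therefore equal and the embedding is onto. *)
Lemma cyc_represent A B (phi : H A B -> K^o) : linear phi ->
  exists w : H B A, forall x, phi x = cyc x w.
Proof.
move=> hphi.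
have lf : limg (linfun (@cycrow A B)) = fullv.
  apply/eqP; rewrite eqEdim subvf /= limg_dim_eq; last first.
    rewrite capfv; apply/eqP; rewrite -subv0; apply/subvP => w; rewrite memv_ker memv0 linfunE; last exact: cycrow_lin.
    by move=> /eqP/cycrow_inj ->.
  by rewrite [X in (X <= _)%N]dimvf /dim /= mul1n cycrow_dim.
have /memv_imgP [w _] : \row_i (phi (tnth (vbasis fullv) i) : K) \in limg (linfun (@cycrow A B)).
  by rewrite lf memvf.
rewrite linfunE; last exact: cycrow_lin.
move/rowP => hw; exists w => x.
rewrite (coord_vbasis (memvf x)).
rewrite (big_morph (fun z => cyc z w) (fun a b => cycDl hC a b w) (cyc0l hC w)).
rewrite (big_morph phi (linD hphi) (lin0 hphi)).
apply: eq_bigr => i _; rewrite (linZ hphi) (cycZl hC) -tnth_nth.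
by have := hw i; rewrite !mxE => ->.
Qed.

(** By [cyc_m1], a functional that kills boundaries is represented by a cocycle. *)
Lemma cyc_represent_closed A B (phi : H A B -> K^o) : linear phi ->
  (forall x, phi (m1 x) = 0) ->
  exists2 w : H B A, m1 w = 0 & forall x, phi x = cyc x w.
Proof.
move=> hphi h0; have [w hw] := cyc_represent hphi; exists w => //.
by apply: (cyc_ndl hC) => x; rewrite -(cyc_m1 hC) // -hw.
Qed.

(* Poincare duality on cohomology. *)
Lemma exactP A B (x : H A B) :
  (forall w : H B A, m1 w = 0 -> cyc x w = 0) -> exists h, x = m1 h.
Proof.
move=> hx; have [|/separating] := boolP (x \in limg (linfun (@m1 _ _ C A B))).
  by case/memv_imgP => h _ ->; exists h; rewrite linfunE //; apply: m1_lin.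
case=> phi [hphi phi0 phix].
have [y|w hw ew] := cyc_represent_closed hphi.
  by apply: phi0; rewrite -(linfunE (@m1_lin _ _ _ hC A B)) memv_img ?memvf.
by move: phix; rewrite ew hx ?eqxx.
Qed.

(** The summands are kept explicitly, with closed homogeneous factors of a common parity, since they
    become the entries of the two matrices of a retract. *)
Definition factors (P : Ob -> Prop) B (r : H B B) : Prop :=
  exists (T : finType) (E : T -> Ob) (p : T -> bool)
    (u : forall t, H B (E t)) (v : forall t, H (E t) B),
  [/\ forall t, P (E t),
      forall t, has_par (p t) (u t) /\ m1 (u t) = 0,
      forall t, has_par (p t) (v t) /\ m1 (v t) = 0 &
      r = \sum_t m2 (u t) (v t)].

Lemma factors0 P B : factors P (0 : H B B).
Proof.
exists (void : finType), (fun=> B), (fun=> false), (fun=> 0), (fun=> 0).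
by split; [case|case|case|rewrite big1 // => -[]].
Qed.

Lemma factorsD P B (r s : H B B) : factors P r -> factors P s -> factors P (r + s).
Proof.
move=> [T [E [p [u [v [hP hu hv ->]]]]]] [T' [E' [p' [u' [v' [hP' hu' hv' ->]]]]]].
pose EE (t : T + T') := match t with inl t => E t | inr t => E' t end.
exists (T + T')%type, EE, (fun t => match t with inl t => p t | inr t => p' t end),
  (fun t => match t return H B (EE t) with inl t => u t | inr t => u' t end),
  (fun t => match t return H (EE t) B with inl t => v t | inr t => v' t end).
split; [by case|by case|by case|].
by rewrite big_sumType.
Qed.

Lemma factorsZ P B a (r : H B B) : factors P r -> factors P (a *: r).
Proof.
move=> [T [E [p [u [v [hP hu hv ->]]]]]].
exists T, E, p, (fun t => a *: u t), v; split=> // [t|].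
  have [h1 h2] := hu t; split; last by rewrite (linZ (@m1_lin _ _ _ hC _ _)) h2 scaler0.
  by rewrite /has_par linearZ /= h1 !scalerA mulrC.
rewrite scaler_sumr; apply: eq_bigr => t _.
by rewrite (linZ (@m2_linl _ _ _ hC _ _ _ _)).
Qed.

Lemma factors1 (P : Ob -> Prop) A B p (u : H B A) (v : H A B) : P A ->
  has_par p u -> m1 u = 0 -> has_par p v -> m1 v = 0 -> factors P (m2 u v).
Proof.
move=> hP pu mu pv mv; exists (Datatypes.unit : finType), (fun=> A), (fun=> p), (fun=> u), (fun=> v).
by split=> //; rewrite (big_pred1 tt) //; case.
Qed.

Lemma factors_par P B (r : H B B) : factors P r -> has_par false r.
Proof.
move=> [T [E [p [u [v [hP hu hv ->]]]]]].
rewrite /has_par linear_sum scaler_sumr; apply: eq_bigr => t _.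
by have := has_par_m2 hC (proj1 (hu t)) (proj1 (hv t)); rewrite addbb.
Qed.

End Duality.

(** * The Mukai supertrace as a cyclic pairing *)

Section Trace.
Variables (K : fieldType) (Ob : Type) (C : ainf K Ob) (hC : ainf_axioms C).
Hypothesis two_neq0 : (2 : K) != 0.
Notation H := (Defs.hom C).

Lemma hprod_evenl A B D (x : H A B) (y : H B D) : has_par false x -> hprod x y = m2 x y.
Proof.
move=> hx; rewrite /hprod big_bool /= [X in X + _]big1 ?add0r => [|b _]; last first.
  by rewrite (hpart0 (d := true)) // (m20l hC) scaler0.
rewrite (hpart_id two_neq0 hx) -[in RHS](hpartE two_neq0 y) !big_bool /= !mul0n !addn0 !expr0 !scale1r.
by rewrite (m2Dr hC).
Qed.

Lemma hprod_evenr A B D (x : H A B) (y : H B D) : has_par false y -> hprod x y = m2 (tau x) y.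
Proof.
move=> hy; rewrite /hprod.
have E (a : bool) : \sum_(b : bool) (-1) ^+ (a * b + a) *: m2 (hpart a x) (hpart b y) =
    (-1) ^+ a *: m2 (hpart a x) y.
  rewrite big_bool /= (hpart0 (d := true)) // (hpart_id two_neq0 hy).
  by rewrite (m20r hC) scaler0 add0r muln0.
transitivity (\sum_(a : bool) (-1) ^+ a *: m2 (hpart a x) y); first by apply: eq_bigr => a _.
rewrite big_bool /= -!(m2Zl hC) -(m2Dl hC); congr m2.
rewrite -[X in tau X](hpartE two_neq0 x) big_bool linearD /=.
by rewrite !(hpart_par hC).
Qed.

(** For even [x] and [y] the explicit signs are trivial: right multiplication by [y] inserts one
    [tau], and the [tau] of the supertrace removes it. *)
Lemma mukai_integrand A B (x : H A A) (y : H B B) (z : H A B) :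
  has_par false x -> has_par false y ->
  tau (\sum_(c : bool) (-1) ^+ (false * c + false * false) *: hprod (hprod x (hpart c z)) y) =
  m2 (m2 x z) y.
Proof.
move=> hx hy; rewrite big_bool /= !mul0n !addn0 !expr0 !scale1r.
rewrite !(hprod_evenl _ hx) !(hprod_evenr _ hy) -(m2Dl hC) -linearD -(m2Dr hC).
have := hpartE two_neq0 z; rewrite big_bool /= => ->.
by rewrite (m2_tau hC) tauK // hy expr0 scale1r.
Qed.

(** The trace sums the i-th coordinates of x e_i y. Each coordinate functional kills boundaries, so
    it is the pairing with a cocycle w_i; cyclicity turns the pairing of x e_i y with w_i into that
    of w_i x e_i with [y], and w_i x e_i runs through [A]. *)
Lemma strH_factors (P : Ob -> Prop) A B (x : H A A) : P A -> has_par false x -> m1 x = 0 ->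
  exists2 q : H B B, factors P q &
    forall y : H B B, has_par false y -> m1 y = 0 ->
    strH (fun z : H A B => \sum_(c : bool)
      (-1) ^+ (false * c + false * false) *: hprod (hprod x (hpart c z)) y) = cyc q y.
Proof.
move=> hP px mx.
set Z := lker (lm1 C A B); set I := limg (lm1 C A B).
pose e := vbasis (Z :\: I)%VS.
have lm1E : lm1 C A B =1 @m1 _ _ C A B by apply: linfunE; apply: m1_lin.
have em i : m1 (tnth e i) = 0.
  have : tnth e i \in (Z :\: I)%VS by apply: vbasis_mem; apply: mem_tnth.
  by move/(subvP (diffvSl _ _)); rewrite memv_ker lm1E => /eqP.
pose phi i (z : H A B) : K^o := coord e i (addv_pi1 Z I z).
have phil i : linear (phi i) by move=> a y z; rewrite /phi !linearP.
have phi0 i y : phi i (m1 y) = 0.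
  have yI : m1 y \in I by rewrite -lm1E memv_img ?memvf.
  have mZ : m1 y \in (Z + I)%VS by rewrite (subvP (addvSr _ _)).
  have := addv_pi1_pi2 mZ; rewrite addv_pi2_id // => /eqP.
  by rewrite -subr_eq0 addrK /phi => /eqP ->; rewrite linear0.
have /choice [w hw] : forall i, exists w : H B A, m1 w = 0 /\ forall z, phi i z = cyc z w.
  by move=> i; have [w w0 hw] := cyc_represent_closed hC two_neq0 (phil i) (phi0 i); exists w.
exists (\sum_i \sum_(d : bool) m2 (hpart d (w i)) (m2 x (hpart d (tnth e i)))).
  apply: big_ind => [||i _]; [exact: factors0|by move=> ? ?; apply: factorsD|].
  apply: big_ind => [||d _]; [exact: factors0|by move=> ? ?; apply: factorsD|].
  apply: (@factors1 _ _ _ P _ _ d) => //.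
  - exact: hpart_par.
  - by apply: hpart_closed => //; case: (hw i).
  - by have := has_par_m2 hC px (hpart_par hC d (tnth e i)); rewrite addFb.
  - by apply: m1m2_closed => //; apply: hpart_closed.
move=> y py my; rewrite /strH -/Z -/I -/e.
rewrite (big_morph (fun q => cyc q y) (fun a b => cycDl hC a b y) (cyc0l hC y)).
apply: eq_bigr => i _; rewrite mukai_integrand //.
have [wi ei] := hw i; rewrite -/(phi i _) ei.
rewrite -[in LHS](hpartE two_neq0 (w i)) !big_bool /= (cycDr hC) (cycDl hC).
have pe d := hpart_par hC d (tnth e i).
(* Components of e_i and w_i of different parity pair to 0, so both may be projected to the same
   parity, as [factors] requires. *)
have E d : cyc (m2 (m2 x (tnth e i)) y) (hpart d (w i)) =
   cyc (m2 (m2 x (hpart d (tnth e i))) y) (hpart d (w i)).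
  rewrite -[in LHS](hpartE two_neq0 (tnth e i)) big_bool /= (m2Dr hC).
  rewrite (m2Dl hC) (cycDl hC).
  have Z0 d' : d' != d -> cyc (m2 (m2 x (hpart d' (tnth e i))) y) (hpart d (w i)) = 0.
    move=> ne; apply: (cyc_has_par hC two_neq0 (d := d') (d' := d)) => //; last exact: hpart_par.
    by have := has_par_m2 hC (has_par_m2 hC px (pe d')) py; rewrite addFb addbF.
  by case: (d) Z0 => Z0; [rewrite (Z0 false) // addr0 | rewrite (Z0 true) // add0r].
rewrite !E; congr (_ + _).
  exact: (cyc_m2 hC _ _ (hpart_par hC true (w i))).
rewrite (cyc_m2_even hC _ _ (hpart_par hC false (w i))); congr cyc.
  by rewrite (m2_tau hC) px pe !expr0 !scale1r.
by rewrite py expr0 scale1r.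
Qed.

Lemma obj_genP (P : Ob -> Prop) B (q : H B B) : factors P q ->
  (forall y : H B B, has_par false y -> m1 y = 0 -> cyc (Defs.unit C B) y = cyc q y) ->
  obj_gen C P B.
Proof.
move=> fq hq.
have pr : has_par false (Defs.unit C B - q).
  rewrite addrC -scaleN1r; apply: has_par_lin; last exact: unit_par.
  exact: (factors_par hC fq).
have [h' eh] : exists h, Defs.unit C B - q = m1 h.
  apply: (exactP hC two_neq0) => w w0.
  rewrite -(hpartE two_neq0 w) big_bool /= (cycDr hC).
  rewrite (cyc_has_par hC two_neq0 pr (hpart_par hC true w)) // add0r.
  have p0 := hpart_par hC false w.
  have m0 : m1 (hpart false w) = 0 by apply: hpart_closed.
  by rewrite (cycDl hC) (cycNl hC) (hq _ p0 m0) subrr.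
have [T [E [p [u [v [hP hu hv eq]]]]]] := fq.
(* A homogeneous homotopy is required; as [1 - q] is even, the odd part of [h'] has the same
   boundary. *)
exists T, E, p, u, v, (hpart true h'); split=> //; first exact: hpart_par.
rewrite -eq -[true]/(~~ false) -hpart_m1 // -eh (hpart_id two_neq0 pr).
by rewrite addrC subrK.
Qed.

End Trace.

(** * Novikov series *)

Section Novikov.
Variables (R : realType) (K : fieldType) (N : novikov R K).
Notation nc := (nov_coef N).

Lemma nov_ext (x y : K) : (forall l, nc x l = nc y l) -> x = y.
Proof. exact: nov_coef_inj. Qed.

Lemma ncD x y l : nc (x + y) l = nc x l + nc y l.
Proof. exact: nov_coefD. Qed.

Lemma nc0 l : nc 0 l = 0.
Proof. by have /esym/eqP := ncD 0 0 l; rewrite addr0 -subr_eq0 addrK => /eqP. Qed.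

Lemma ncN x l : nc (- x) l = - nc x l.
Proof. by apply/eqP; rewrite -addr_eq0 -ncD addNr nc0. Qed.

Lemma ncB x y l : nc (x - y) l = nc x l - nc y l.
Proof. by rewrite ncD ncN. Qed.

Lemma nc_sum (I : Type) (s : seq I) (P : pred I) (F : I -> K) l :
  nc (\sum_(i <- s | P i) F i) l = \sum_(i <- s | P i) nc (F i) l.
Proof. exact: (big_morph (fun x => nc x l) (fun x y => ncD x y l) (nc0 l)). Qed.

Definition vgt (c : R) (x : K) : Prop := forall l, l <= c -> nc x l = 0.

Lemma vgt0 c : vgt c 0.
Proof. by move=> l _; apply: nc0. Qed.

Lemma vgtD c x y : vgt c x -> vgt c y -> vgt c (x + y).
Proof. by move=> hx hy l hl; rewrite ncD hx // hy // addr0. Qed.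

Lemma vgtN c x : vgt c x -> vgt c (- x).
Proof. by move=> hx l hl; rewrite ncN hx // oppr0. Qed.

Lemma vgtB c x y : vgt c x -> vgt c y -> vgt c (x - y).
Proof. by move=> hx hy; apply: vgtD => //; apply: vgtN. Qed.

Lemma vgt_sum c (I : eqType) (s : seq I) (P : pred I) (F : I -> K) :
  (forall i, i \in s -> P i -> vgt c (F i)) -> vgt c (\sum_(i <- s | P i) F i).
Proof.
move=> h; rewrite big_seq_cond; elim/big_ind: _ => [|x y|i /andP[]]; first exact: vgt0.
  exact: vgtD.
exact: h.
Qed.

Lemma vgt_le c d x : c <= d -> vgt d x -> vgt c x.
Proof. by move=> cd h l lc; apply: h; apply: le_trans cd. Qed.

Lemma vgtM c d x y : vgt c x -> vgt d y -> vgt (c + d) (x * y).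
Proof.
move=> hx hy l hl; rewrite nov_coefM fsbig1 // => a _.
have [ac|ca] := leP a c; first by rewrite hx // mul0r.
by rewrite hy ?mulr0 // lerBlDr (le_trans hl) // addrC lerD2l ltW.
Qed.

Lemma finite_lbound (A : set R) : finite_set A -> exists m, forall l, A l -> m < l.
Proof.
move=> fA; exists (\big[Order.min/0]_(l <- fset_set A) l - 1) => l Al.
rewrite ltrBlDr (le_lt_trans (y := l)) ?ltrDl //.
have : l \in (fset_set A : seq R) by rewrite in_fset_set // inE.
elim: (fset_set A : seq R) => // a s IH; rewrite inE big_cons ge_min => /orP[/eqP->|/IH ->].
  by rewrite lexx.
by rewrite orbT.
Qed.

Lemma vgt_exists x : exists c, vgt c x.
Proof.
have [m hm] := finite_lbound (nov_coef_fin N x 0).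
exists (Order.min m 0) => l; rewrite le_min => /andP[lm l0].
apply/eqP; apply/negP => /negP h.
have /hm : (l <= 0) /\ nc x l != 0 by [].
by rewrite ltNge lm.
Qed.

(** Convergence becomes approximation by finite partial sums modulo each power of T, the form in
    which products and regroupings are proved. *)
Lemma nov_sumP (I : choiceType) (F : I -> K) s :
  nov_sum N F s <-> forall c, exists D : {fset I},
    (forall i, i \notin D -> vgt c (F i)) /\ vgt c (s - \sum_(i <- D) F i).
Proof.
split=> [[hf hs] c|h].
  exists (fset_set [set i | exists2 l, l <= c & nc (F i) l != 0]); split=> [i|l hl].
    rewrite in_fset_set // notin_setE /= => hi l hl; apply/eqP.
    by apply: contra_notT hi => h; exists l.
  rewrite ncB hs nc_sum (fsbigTE (fset_set [set i | exists2 l, l <= c & nc (F i) l != 0])) ?subrr //.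
  move=> i; rewrite in_fset_set // notin_setE /= => hi; apply/eqP.
  by apply: contra_notT hi => h; exists l.
split=> [c|l].
  have [D [hD _]] := h c; apply: (sub_finite_set (B := [set` D])); last exact: finite_fset.
  by move=> i /= [l lc]; apply: contra_neqT => hi; apply: hD.
have [D [hD hs]] := h l.
have := hs l (lexx l); rewrite ncB nc_sum => /eqP; rewrite subr_eq0 => /eqP ->.
by rewrite (fsbigTE D) // => i hi; apply: hD.
Qed.

Lemma nov_sum_ge (I : choiceType) (F : I -> K) s (D E : {fset I}) c :
  (D `<=` E)%fset -> (forall i, i \notin D -> vgt c (F i)) ->
  vgt c (s - \sum_(i <- D) F i) -> vgt c (s - \sum_(i <- E) F i).
Proof.
move=> DE hD hs.
have -> : s - \sum_(i <- E) F i = s - \sum_(i <- D) F i - \sum_(i <- E | i \notin D) F i.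
  rewrite -addrA -opprD; congr (_ - _).
  rewrite (bigID (mem D)) /=; congr (_ + _).
  rewrite -[LHS]big_filter; apply: perm_big; apply: uniq_perm; rewrite ?filter_uniq ?fset_uniq //.
  by move=> i; rewrite mem_filter andb_idr // => /(fsubsetP DE).
by apply: vgtB => //; apply: vgt_sum => i _; apply: hD.
Qed.

Lemma nov_sum_uniq (I : choiceType) (F : I -> K) s t :
  nov_sum N F s -> nov_sum N F t -> s = t.
Proof. by move=> [_ hs] [_ ht]; apply: nov_ext => l; rewrite hs ht. Qed.

Lemma nov_sum_ext (I : choiceType) (F G : I -> K) s : F =1 G -> nov_sum N F s -> nov_sum N G s.
Proof. by move=> /funext ->. Qed.

Lemma nov_sum_fset (I : choiceType) (F : I -> K) (D : {fset I}) :
  (forall i, i \notin D -> F i = 0) -> nov_sum N F (\sum_(i <- D) F i).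
Proof.
move=> hD; apply/nov_sumP => c; exists D; rewrite subrr.
by split=> [i /hD ->|]; apply: vgt0.
Qed.

Lemma nov_sumZ (I : choiceType) (F : I -> K) s a :
  nov_sum N F s -> nov_sum N (fun i => a * F i) (a * s).
Proof.
move=> /nov_sumP h; apply/nov_sumP => c; have [v hv] := vgt_exists a.
have [D [hD hs]] := h (c - v); exists D.
have e : c = v + (c - v) by rewrite addrC subrK.
split=> [i /hD hi|]; first by rewrite e; apply: vgtM.
by rewrite -mulr_sumr -mulrBr e; apply: vgtM.
Qed.

Lemma nov_sum_lbound (I : choiceType) (F : I -> K) s : nov_sum N F s ->
  exists p, forall i, vgt p (F i).
Proof.
move=> /nov_sumP/(_ 0) [D [hD _]].
have L (r : seq I) : exists p, forall i, i \in r -> vgt p (F i).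
  elim: r => [|i r [p IH]]; first by exists 0.
  have [q hq] := vgt_exists (F i).
  exists (Order.min p q) => j; rewrite inE => /orP[/eqP->|/IH].
    by apply: vgt_le hq; rewrite ge_min lexx orbT.
  by apply: vgt_le; rewrite ge_min lexx.
have [p hp] := L D.
exists (Order.min p 0) => i; have [/hp|/hD] := boolP (i \in D).
  by apply: vgt_le; rewrite ge_min lexx.
by apply: vgt_le; rewrite ge_min lexx orbT.
Qed.

Lemma sum_fset_seq (I : choiceType) (r : seq I) (F : I -> K) : uniq r ->
  \sum_(i <- [fset x in r]%fset) F i = \sum_(i <- r) F i.
Proof.
by move=> ur; apply: perm_big; rewrite uniq_perm ?fset_uniq // => i; rewrite !inE.
Qed.

(** Lower bounds for the valuations of one family tell how precisely the other must be truncated.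
    [E] is chosen after [D], because its precision also depends on the valuation of the finite sum
    over [D]. *)
Lemma nov_sumM (I J : choiceType) (F : I -> K) (G : J -> K) s t :
  nov_sum N F s -> nov_sum N G t ->
  nov_sum N (fun ij : I * J => F ij.1 * G ij.2) (s * t).
Proof.
move=> hF hG; have [p hp] := nov_sum_lbound hF; have [q hq] := nov_sum_lbound hG.
have [q' hq'] := vgt_exists t.
apply/nov_sumP => c.
have [D [hD hs]] := (proj1 (nov_sumP F s) hF) (Order.max (c - q) (c - q')).
have [p' hp'] := vgt_exists (\sum_(i <- D) F i).
have [E [hE ht]] := (proj1 (nov_sumP G t) hG) (Order.max (c - p) (c - p')).
pose r := [seq (i, j) | i <- D, j <- E].
have ur : uniq r by apply: allpairs_uniq; rewrite ?fset_uniq // => -[? ?] [? ?].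
have ce (x : R) : c = c - x + x by rewrite subrK.
exists [fset x in r]%fset; split=> [[i j]|].
  rewrite !inE /= => hij.
  have [iD|iD] := boolP (i \in D).
    have jE : j \notin E.
      apply: contra hij => jE; apply/allpairsP; exists (i, j) => //.
    rewrite (ce p) addrC; apply: vgtM => //; apply: vgt_le (hE _ jE).
    by rewrite le_max lexx.
  rewrite (ce q); apply: vgtM => //; apply: vgt_le (hD _ iD).
  by rewrite le_max lexx.
rewrite sum_fset_seq // /r big_allpairs /=.
under eq_bigr => i _ do rewrite -mulr_sumr.
rewrite -mulr_suml.
set S := \sum_(i <- D) F i in hs hp' *; set T := \sum_(j <- E) G j in ht *.
have -> : s * t - S * T = (s - S) * t + S * (t - T) by ring.
apply: vgtD; first by rewrite (ce q'); apply: vgtM => //; apply: vgt_le hs; rewrite le_max lexx orbT.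
by rewrite (ce p') addrC; apply: vgtM => //; apply: vgt_le ht; rewrite le_max lexx orbT.
Qed.

Lemma nov_sum_regroup (I J : choiceType) (F : I -> K) (g : I -> J) (fib : J -> {fset I}) s :
  (forall i j, (i \in fib j) = (g i == j)) -> nov_sum N F s ->
  nov_sum N (fun j => \sum_(i <- fib j) F i) s.
Proof.
move=> hf /nov_sumP hF; apply/nov_sumP => c; have [D [hD hs]] := hF c.
pose E := [fset g i | i in D]%fset.
have DE j : j \notin E -> forall i, i \in fib j -> i \notin D.
  move=> jE i; rewrite hf => /eqP ij; apply: contra jE => iD.
  by apply/imfsetP; exists i.
exists E; split=> [j jE|].
  by apply: vgt_sum => i ij _; apply: hD; apply: DE ij.
pose r := flatten [seq (fib j : seq I) | j <- E].
have mr i : i \in r = (g i \in E).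
  apply/flatten_mapP/idP => [[j jE]|gE]; first by rewrite hf => /eqP ->.
  by exists (g i); rewrite // hf.
have ur : uniq r.
  rewrite /r; have : uniq (E : seq J) by exact: fset_uniq.
  elim: (E : seq J) => //= j l IH /andP[jl ul].
  rewrite cat_uniq fset_uniq IH // andbT; apply/hasPn => i /flatten_mapP[j' j'l].
  rewrite hf => /eqP ij; rewrite /= hf ij; apply: contraNneq jl => <-.
  by [].
have -> : \sum_(j <- E) \sum_(i <- fib j) F i = \sum_(i <- [fset x in r]%fset) F i.
  by rewrite sum_fset_seq // /r big_flatten /= big_map.
apply: (nov_sum_ge (D := D)) => //; apply/fsubsetP => i iD.
by rewrite !inE mr; apply/imfsetP; exists i.
Qed.

(** Only finitely many columns are non-zero, so truncating each of them to the same precision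
    truncates the whole family. *)
Lemma nov_sum_columns (I J : choiceType) (F : I * J -> K) (B : seq J) (s : J -> K) :
  uniq B -> (forall i j, j \notin B -> F (i, j) = 0) ->
  (forall j, j \in B -> nov_sum N (fun i => F (i, j)) (s j)) ->
  nov_sum N F (\sum_(j <- B) s j).
Proof.
move=> uB F0 hF; apply/nov_sumP => c.
have /choice [D hD] : forall j, exists D : {fset I}, j \in B ->
   (forall i, i \notin D -> vgt c (F (i, j))) /\ vgt c (s j - \sum_(i <- D) F (i, j)).
  move=> j; have [jB|_] := boolP (j \in B); last by exists fset0.
  by have [D hD] := (proj1 (nov_sumP _ _) (hF j jB)) c; exists D.
pose r := flatten [seq [seq (i, j) | i <- D j] | j <- B].
have mr i j : (i, j) \in r = (j \in B) && (i \in D j).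
  apply/flatten_mapP/andP => [[j' jB /mapP[i' iD [-> ->]]]|[jB iD]] //.
  by exists j => //; apply/mapP; exists i.
have ur : uniq r.
  rewrite /r; elim: B uB {F0 hF hD mr r} => //= j l IH /andP[jl ul].
  rewrite cat_uniq IH // andbT map_inj_uniq ?fset_uniq //=; last by move=> ? ? [].
  apply/hasPn => -[i j'] /flatten_mapP[j0 j0l /mapP[i0 _ [_ ->]]] /=.
  by apply: contra jl => /mapP[? _ [_ <-]].
exists [fset x in r]%fset; split=> [[i j]|].
  rewrite !inE /= mr negb_and => /orP[/F0 -> |iD]; first exact: vgt0.
  have [jB|/F0 ->] := boolP (j \in B); last exact: vgt0.
  by case: (hD j jB) => h _; apply: h.
rewrite sum_fset_seq // /r big_flatten /= big_map.
under [X in _ - X]eq_bigr => j _ do rewrite big_map.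
rewrite -sumrB; apply: vgt_sum => j jB _.
by case: (hD j jB).
Qed.

Lemma nov_sum_exists (I : choiceType) (F : I -> K) :
  (forall c, finite_set [set i | exists2 l, l <= c & nc (F i) l != 0]) ->
  exists s, nov_sum N F s.
Proof.
move=> hF; pose f l := \sum_(i \in [set: I]) nc (F i) l.
have hf c : finite_set [set l | l <= c /\ f l != 0].
  pose D := fset_set [set i | exists2 l, l <= c & nc (F i) l != 0].
  apply: (sub_finite_set (B := (\bigcup_(i in [set` D]) [set l | l <= c /\ nc (F i) l != 0])%classic)).
    move=> l /= [lc]; rewrite /f (fsbigTE D); last first.
      move=> i; rewrite in_fset_set // notin_setE /= => hi; apply/eqP.
      by apply: contra_notT hi => h; exists l.
    move=> h; apply: contrapT => h'; move/negP: h; apply; apply/eqP.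
    rewrite big_seq big1 // => i iD; apply/eqP; apply/negP => /negP ni.
    by apply: h'; exists i.
  apply: bigcup_finite; first exact: finite_fset.
  by move=> i _; apply: nov_coef_fin.
have [s hs] := nov_coef_surj N hf.
by exists s; split.
Qed.

End Novikov.

(** * Monomials and the exponential in the Novikov field *)

Section NovikovField.
Variables (R : realType) (K : fieldType) (N : novikov R K).
Notation nc := (nov_coef N).
Notation mono := (nov_mono N).

Lemma monoM a b e f : mono a e * mono b f = mono (a * b) (e + f).
Proof.
apply: (nov_ext (N := N)) => l; rewrite nov_coefM (fsbigTE [fset e]%fset) /=; last first.
  by move=> x; rewrite inE => /negbTE xe; rewrite nov_coef_mono xe mul0r.
rewrite big_seq_fset1 !nov_coef_mono eqxx subr_eq [f + e]addrC.
by case: ifP; rewrite ?mulr0.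
Qed.

Lemma monoD a b e : mono (a + b) e = mono a e + mono b e.
Proof.
apply: (nov_ext (N := N)) => l; rewrite ncD !nov_coef_mono.
by case: ifP; rewrite ?addr0.
Qed.

Lemma mono0 e : mono 0 e = 0.
Proof. by apply: (nov_ext (N := N)) => l; rewrite nc0 nov_coef_mono; case: ifP. Qed.

Lemma mono_eq0 a e : (mono a e == 0) = (a == 0).
Proof.
apply/eqP/eqP => [h|->]; last exact: mono0.
by have := congr1 (fun x => nc x e) h; rewrite nov_coef_mono eqxx nc0.
Qed.

Lemma novC1 : novC N 1 = 1.
Proof. by apply: (nov_ext (N := N)) => l; rewrite nov_coef_mono nov_coef1; case: eqP. Qed.

Lemma novC0 : novC N 0 = 0. Proof. exact: mono0. Qed.
Lemma novCD a b : novC N (a + b) = novC N a + novC N b. Proof. exact: monoD. Qed.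
Lemma novCM a b : novC N (a * b) = novC N a * novC N b.
Proof. by rewrite monoM addr0. Qed.

Fact novC_is_zmod_morphism : zmod_morphism (novC N).
Proof.
move=> a b; apply/eqP; rewrite eq_sym subr_eq -novCD subrK; exact: eqxx.
Qed.
Fact novC_is_monoid_morphism : monoid_morphism (novC N).
Proof. by split; [exact: novC1 | exact: novCM]. Qed.

HB.instance Definition _ := GRing.isZmodMorphism.Build R[i] K (novC N) novC_is_zmod_morphism.
HB.instance Definition _ := GRing.isMonoidMorphism.Build R[i] K (novC N) novC_is_monoid_morphism.

Lemma mono_novCT a e : mono a e = novC N a * novT N e.
Proof. by rewrite monoM mulr1 add0r. Qed.

Lemma novT_neq0 e : novT N e != 0.
Proof. by rewrite mono_eq0 oner_eq0. Qed.

Lemma nov_natr_eq0 n : ((n%:R : K) == 0) = (n == 0)%N.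
Proof. by rewrite -(rmorph_nat (novC N)) fmorph_eq0 pnatr_eq0. Qed.

Lemma nov_fact_neq0 n : (n`!%:R : K) != 0.
Proof. by rewrite nov_natr_eq0 -lt0n fact_gt0. Qed.

Definition is_exp (a E : K) : Prop := nov_sum N (fun s : nat => a ^+ s / s`!%:R) E.

Lemma is_exp_uniq a E E' : is_exp a E -> is_exp a E' -> E = E'.
Proof. exact: nov_sum_uniq. Qed.

Lemma is_exp0 : is_exp 0 1.
Proof.
have := @nov_sum_fset R K N nat (fun s : nat => 0 ^+ s / s`!%:R) [fset 0%N]%fset.
rewrite big_seq_fset1 expr0 fact0 divr1; apply=> i.
by rewrite inE => /negbTE i0; rewrite expr0n i0 mul0r.
Qed.

(** Regrouped along i + j = n, the Cauchy product of the two series is the binomial formula divided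
    by n!. *)
Lemma is_expD a b E E' : is_exp a E -> is_exp b E' -> is_exp (a + b) (E * E').
Proof.
move=> hE hE'; have := nov_sumM hE hE'.
pose g (p : nat * nat) := (p.1 + p.2)%N.
pose rs n := [seq ((i : nat), (n - i)%N) | i <- iota 0 n.+1].
have mrs n i j : ((i, j) \in rs n) = (i + j == n)%N.
  apply/mapP/eqP => [[k]|<-].
    by rewrite mem_iota add0n ltnS => /andP[_ kn] [-> ->]; rewrite subnKC.
  by exists i; rewrite ?addKn // mem_iota add0n ltnS leq_addr.
pose fib n := [fset p in rs n]%fset.
have hf p n : (p \in fib n) = (g p == n).
  by case: p => i j; rewrite in_fset -mrs.
move/(nov_sum_regroup hf); apply: nov_sum_ext => n.
rewrite sum_fset_seq; last by rewrite map_inj_uniq ?iota_uniq // => x y [].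
rewrite big_map -[iota 0 n.+1]/(index_iota 0 n.+1) big_mkord /= exprDn mulr_suml.
rewrite (reindex_inj rev_ord_inj) /=; apply: eq_bigr => i _.
rewrite subSS subKn; last by rewrite -ltnS.
rewrite -mulr_natr -(bin_fact (n := n) (m := i)); last by rewrite -ltnS.
rewrite !natrM; field.
by rewrite !nov_natr_eq0 -!lt0n !fact_gt0 bin_gt0 -ltnS ltn_ord.
Qed.

(** The terms for - a differ from those for a by signs, so their series converges; [is_expD] then
    identifies its sum as the inverse. *)
Lemma is_expN a E : is_exp a E -> is_exp (- a) E^-1.
Proof.
move=> hE; have [E' hE'] : exists E', is_exp (- a) E'.
  apply: nov_sum_exists => c; case: hE => /(_ c) hf _.
  apply: sub_finite_set hf => s /= [l lc h]; exists l => //; apply: contra h => /eqP h.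
  by rewrite exprNn -mulrA -signr_odd; case: (odd s); rewrite ?expr1 ?mulN1r ?ncN ?expr0 ?mul1r h ?oppr0.
have := is_expD hE hE'; rewrite subrr => /(is_exp_uniq is_exp0) h.
have E0 : E != 0 by apply: contra_eq_neq h => ->; rewrite mul0r oner_eq0.
by rewrite -[E^-1]mulr1 h mulKf.
Qed.

Lemma is_exp_neq0 a E : is_exp a E -> E != 0.
Proof.
move=> h; have := is_expD h (is_expN h); rewrite subrr => /(is_exp_uniq is_exp0) e.
by apply: contra_eq_neq e => ->; rewrite mul0r oner_eq0.
Qed.

Lemma is_exp_int a E (n : int) : is_exp a E -> is_exp (a *~ n) (E ^ n).
Proof.
move=> h; have nat_case (m : nat) : is_exp (a *+ m) (E ^+ m).
  elim: m => [|m IH]; first exact: is_exp0.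
  by rewrite mulrS exprS; apply: is_expD.
case: n => m; first exact: nat_case.
exact: (is_expN (nat_case m.+1)).
Qed.

End NovikovField.

(** * Disk potentials *)

Section Multilinear.
Variables (R : realType) (K : fieldType) (N : novikov R K).

Lemma mlext_nil d (f : seq 'I_d -> 'rV[R[i]]_d) :
  mlext N f [::] = map_mx (novC N) (f [::]).
Proof.
rewrite /mlext (big_pred1 [tuple]) => [|t]; last by rewrite [t]tuple0 /= eqxx.
by rewrite big_ord0 scale1r.
Qed.

Lemma mlext_cons d (f : seq 'I_d -> 'rV[R[i]]_d) (x : 'rV[K]_d) xs :
  mlext N f (x :: xs) = \sum_i x 0 i *: mlext N (fun t => f (i :: t)) xs.
Proof.
rewrite /mlext /=.
transitivity (\sum_i \sum_(t : (size xs).-tuple 'I_d)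
   (x 0 i * \prod_(k < size xs) (nth 0 xs k) 0 (tnth t k)) *: map_mx (novC N) (f (i :: t))).
  rewrite pair_big /=.
  rewrite (reindex (fun p : 'I_d * (size xs).-tuple 'I_d => cons_tuple p.1 p.2)) /=; last first.
    exists (fun t => (thead t, behead_tuple t)) => [[i t] _|t _] /=.
      by congr pair; apply: val_inj.
    by rewrite [RHS]tuple_eta; apply: val_inj.
  apply: eq_bigr => -[i t] _ /=; congr (_ *: _).
  rewrite big_ord_recl; congr (_ * _).
  apply: eq_bigr => k _; congr (_ 0 _).
  by rewrite !(tnth_nth i).
apply: eq_bigr => i _; rewrite scaler_sumr; apply: eq_bigr => t _.
by rewrite scalerA.
Qed.

(** Polarization: along b + t x a multilinear expression is a polynomial in t, and its linear
    coefficient collects the insertions of x in each position. *)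
Lemma mlext_poly d (b x : 'rV[K]_d) k s (f : seq 'I_d -> 'rV[R[i]]_d) :
  exists q : {poly K},
  [/\ forall t, q.[t] = mlext N f (nseq s (b + t *: x)) 0 k,
      q`_0 = mlext N f (nseq s b) 0 k &
      q`_1 = \sum_(i < s) mlext N f (nseq i b ++ x :: nseq (s.-1 - i) b) 0 k].
Proof.
elim: s f => [|s IH] f.
  exists (mlext N f [::] 0 k)%:P; split=> [t||]; first by rewrite hornerC.
    by rewrite coefC.
  by rewrite coefC big_ord0.
have /choice [q hq] := fun i => IH (fun t => f (i :: t)).
exists (\sum_i ((b 0 i)%:P + x 0 i *: 'X) * q i); split=> [t||].
- rewrite horner_sum mlext_cons summxE; apply: eq_bigr => i _.
  have [q1 _ _] := hq i.
  by rewrite hornerM hornerD hornerC hornerZ hornerX q1 !mxE [x 0 i * t]mulrC.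
- rewrite coef_sum mlext_cons summxE; apply: eq_bigr => i _.
  have [_ q2 _] := hq i.
  by rewrite coefM big_ord1 coefD coefC coefZ coefX mulr0 addr0 q2 mxE.
rewrite coef_sum big_ord_recl /= subn0 mlext_cons summxE.
transitivity (\sum_i (x 0 i * mlext N (fun t => f (i :: t)) (nseq s b) 0 k +
  b 0 i * \sum_(j < s) mlext N (fun t => f (i :: t)) (nseq j b ++ x :: nseq (s.-1 - j) b) 0 k)).
  apply: eq_bigr => i _; have [_ q2 q3] := hq i.
  rewrite coefM !big_ord_recl big_ord0 /= !coefD !coefC !coefZ !coefX /= q2 q3.
  by rewrite mulr0 mulr1 !addr0 add0r addrC.
rewrite big_split /=; congr (_ + _); first by apply: eq_bigr => i _; rewrite mxE.
under eq_bigr => i _ do rewrite mulr_sumr.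
rewrite exchange_big; apply: eq_bigr => j _ /=.
rewrite mlext_cons summxE; apply: eq_bigr => i _.
by rewrite mxE /bump /= add1n -[s.-1]subn1 -subnDA add1n.
Qed.

Lemma poly_eq_infinite (p q : {poly K}) (ts : nat -> K) : injective ts ->
  (forall n, p.[ts n] = q.[ts n]) -> p = q.
Proof.
move=> tsI h; apply/eqP; rewrite -subr_eq0; apply/negPn/negP => pq0.
have := @max_poly_roots _ _ [seq ts n | n <- iota 0 (size (p - q))] pq0.
rewrite size_map size_iota ltnn map_inj_uniq ?iota_uniq // => H.
suff : false by []; apply: H => //; apply/allP => _ /mapP[n _ ->].
by rewrite /root hornerD hornerN h subrr.
Qed.

Variable (L : lagrangian R).

(** An insertion of degree 1 changes the degree by 1 - 1 = 0. *)
Lemma mlext_deg s (f : seq 'I_(lg_dim L) -> 'rV[R[i]]_(lg_dim L)) (e : int)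
    (b : 'rV[K]_(lg_dim L)) k : cohdeg 1 b ->
  (forall t k, f t 0 k != 0 -> (lg_deg k)%:Z = \sum_(i <- t) (lg_deg i)%:Z + e - (size t)%:Z) ->
  mlext N f (nseq s b) 0 k != 0 -> (lg_deg k)%:Z = e.
Proof.
move=> hb; elim: s f => [|s IH] f hf.
  rewrite mlext_nil mxE => h.
  have /hf -> : f [::] 0 k != 0 by apply: contra h => /eqP ->; rewrite novC0.
  by rewrite big_nil add0r subr0.
rewrite mlext_cons summxE => h.
have [i hi] : exists i, (b 0 i *: mlext N (fun t => f (i :: t)) (nseq s b)) 0 k != 0.
  apply/existsP; apply: contraNT h; rewrite negb_exists => /forallP h.
  by rewrite big1 // => i _; have := h i; rewrite negbK => /eqP.
move: hi; rewrite mxE mulf_eq0 negb_or => /andP[bi hi].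
apply: IH hi => t k' /hf ->; rewrite big_cons (hb i bi) /=.
by rewrite -addn1 PoszD; ring.
Qed.

End Multilinear.

Section Disks.
Variables (R : realType) (K : fieldType) (N : novikov R K).
Variables (L : lagrangian R) (hL : lagrangian_axioms L).
Notation V := 'rV[K]_(lg_dim L).

Lemma kronK_lin g : linear (fun x : V => kronK N g x : K^o).
Proof.
move=> a x y; rewrite /kronK -[X in _ = X + _]/(a * _) mulr_sumr -big_split; apply: eq_bigr => k _ /=.
by rewrite !mxE mulrDl mulrA.
Qed.

Lemma kronK_additive (x : V) : zmod_morphism (fun g => kronK N g x).
Proof.
have hD g h : kronK N (g + h) x = kronK N g x + kronK N h x.
  rewrite /kronK -big_split; apply: eq_bigr => k _ /=.
  by rewrite lg_kronD // novCD mulrDr.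
by move=> g h; apply/eqP; rewrite eq_sym subr_eq -hD subrK.
Qed.

Lemma kronK_span (x : V) g1 g2 (a b : int) :
  kronK N (g1 *~ a + g2 *~ b) x = kronK N g1 x *~ a + kronK N g2 x *~ b.
Proof.
pose fM := GRing.isZmodMorphism.Build _ _ _ (kronK_additive x).
pose F : {additive lg_H1 L -> K} := HB.pack (fun g => kronK N g x) fM.
by have := raddfD F (g1 *~ a) (g2 *~ b); rewrite !raddfMz.
Qed.

Lemma hol_neq0 (rho : lg_H1 L -> R[i]) g : is_hol rho -> rho g != 0.
Proof.
move=> [h0 hD]; have := hD g (- g); rewrite subrr h0.
by move=> e; apply: contra_eq_neq e => ->; rewrite mul0r oner_eq0.
Qed.

Lemma hol_int (rho : lg_H1 L -> R[i]) g (n : int) : is_hol rho -> rho (g *~ n) = rho g ^ n.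
Proof.
move=> h; have [h0 hD] := h.
have nat_case (m : nat) : rho (g *+ m) = rho g ^+ m.
  by elim: m => [|m IH]; [rewrite mulr0n expr0 | rewrite mulrS hD IH exprS].
case: n => m; first exact: nat_case.
have e : rho (- (g *+ m.+1)) * rho (g *+ m.+1) = 1 by rewrite -hD addNr.
rewrite -[LHS]/(rho (- (g *+ m.+1))) -[RHS]/((rho g ^+ m.+1)^-1) -nat_case.
by rewrite -[LHS](mulfK (hol_neq0 (g *+ m.+1) h)) e mul1r.
Qed.

Lemma mc_coord_span (rho : lg_H1 L -> R[i]) (b : V) (W : K) (h : is_mc N rho b W) g1 g2 y1 y2 (i j : int) :
  mc_coord (MC h) g1 y1 -> mc_coord (MC h) g2 y2 ->
  exists2 E, is_exp N (kronK N (g1 *~ i + g2 *~ j) b) E &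
    novC N (rho (g1 *~ i + g2 *~ j)) * E = y1 ^ i * y2 ^ j.
Proof.
have [hh _ _ _] := h.
move=> [E1 e1 ->] [E2 e2 ->] /=.
exists (E1 ^ i * E2 ^ j).
  by rewrite kronK_span; apply: is_expD; apply: is_exp_int.
have [_ hD] := hh; rewrite hD !hol_int // novCM !exprzMl ?unitfE; last first.
- by rewrite (is_exp_neq0 e1).
- by rewrite mono_eq0 hol_neq0.
- by rewrite (is_exp_neq0 e2).
- by rewrite mono_eq0 hol_neq0.
rewrite !fmorphXz; ring.
Qed.

Lemma mc_coord_neq0 (b : mc N L) g y : mc_coord b g y -> y != 0.
Proof.
have [hh _ _ _] := mcP b.
by move=> [E /is_exp_neq0 e ->]; rewrite mulf_neq0 // mono_eq0 hol_neq0.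
Qed.

(** Supplies infinitely many scalars t for which t x has coordinates in Lambda_+, the range in which
    the divisor identity is assumed. *)
Lemma nov_plus_shift (x : V) : exists e : R, forall (n : nat) k, nov_plus N ((novT N (e + n%:R) *: x) 0 k).
Proof.
have [c hc] : exists c, forall k, vgt N c (x 0 k).
  have /choice [c hc] := fun k => vgt_exists N (x 0 k).
  exists (- \sum_k `|c k|) => k; apply: vgt_le (hc k).
  by rewrite lerNl (le_trans (ler_norm _)) // normrN (bigD1 k) //= lerDl sumr_ge0.
exists (1 - c) => n k; rewrite mxE => l l0.
have h : vgt N (- c + n%:R) (novT N (1 - c + n%:R)).
  move=> m hm; rewrite nov_coef_mono; case: eqP => // e.
  by move: hm; rewrite e -addrA gerDr ler10.
apply: (vgtM h (hc k)); rewrite addrAC addNr add0r.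
by rewrite (le_trans l0).
Qed.

Section Divisor.
Hypothesis hdiv : forall s b (x : V), cohdeg 1 x -> (forall k, nov_plus N (x 0 k)) ->
  mlext N (lg_m b) (nseq s x) =
  (kronK N (lg_bd L b) x ^+ s / s`!%:R) *: map_mx (novC N) (lg_m b [::]).

(** The divisor identity concerns equal insertions from Lambda_+. At b + t x both of its sides are
    polynomials in t that agree at infinitely many powers of T, hence coincide; the linear
    coefficients give the claim. *)
Lemma divisor_polar s beta (b x : V) k : cohdeg 1 b -> (forall k, nov_plus N (b 0 k)) ->
  cohdeg 1 x ->
  \sum_(i < s.+1) mlext N (lg_m beta) (nseq i b ++ x :: nseq (s - i) b) 0 k =
  kronK N (lg_bd L beta) x * (kronK N (lg_bd L beta) b ^+ s / s`!%:R) * novC N (lg_m beta [::] 0 k).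
Proof.
move=> hb pb hx; have [q [q1 _ q3]] := mlext_poly N b x k s.+1 (lg_m beta).
rewrite -q3; set kb := kronK _ _ b; set kx := kronK _ _ x; set m0 := novC _ _.
pose r : {poly K} := (kb%:P + kx *: 'X) ^+ s.+1 * (m0 / s.+1`!%:R)%:P.
have [e he] := nov_plus_shift x.
have -> : q = r.
  apply: (@poly_eq_infinite _ _ _ (fun n : nat => novT N (e + n%:R))).
    move=> m n h; have := congr1 (fun z => nov_coef N z (e + m%:R)) h.
    rewrite !nov_coef_mono eqxx; case: eqP => [/addrI/eqP|_ /eqP]; last by rewrite oner_eq0.
    by rewrite eqr_nat => /eqP.
  move=> n; rewrite q1 hdiv.
  - rewrite !mxE /r hornerM horner_exp hornerD hornerC hornerZ hornerX hornerC.
    have -> : kronK N (lg_bd L beta) (b + novT N (e + n%:R) *: x) = kb + novT N (e + n%:R) * kx.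
      by rewrite (linD (kronK_lin _)) (linZ (kronK_lin _)).
    rewrite -/m0.
    by rewrite [novT _ _ * _]mulrC mulrA mulrAC.
  - move=> l; rewrite !mxE => h; have [b0|/hb //] := eqVneq (b 0 l) 0.
    by apply: hx; apply: contra h => /eqP ->; rewrite b0 mulr0 addr0.
  move=> l; rewrite mxE; apply: vgtD; [exact: pb|exact: he].
have c1 (p : {poly K}) : p`_1 = p^`().[0] by rewrite horner_coef0 coef_deriv mulr1n.
rewrite c1 /r derivM derivC mulr0 addr0 deriv_exp derivD derivC derivZ derivX add0r.
rewrite hornerM hornerC hornerMn hornerM hornerZ hornerC horner_exp hornerD !hornerC hornerZ hornerX.
rewrite mulr0 addr0 mulr1 /= factS natrM -mulr_natr.
field; rewrite (nov_fact_neq0 N) /=.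
by rewrite addrC natr1 (nov_natr_eq0 N).
Qed.
End Divisor.

End Disks.

Lemma sum_if_eq (I : eqType) (V : nmodType) (s : seq I) (x : I) (F : I -> V) :
  uniq s -> x \in s -> \sum_(i <- s) (if x == i then F i else 0) = F x.
Proof.
move=> us xs; rewrite (bigD1_seq x) //= eqxx big1 ?addr0 // => i.
by rewrite eq_sym => /negbTE ->.
Qed.

(** * The potential of a monotone torus and its derivative *)

Section MonotoneTorus.
Variables (R : realType) (K : fieldType) (N : novikov R K).
Variables (L : lagrangian R) (hL : lagrangian_axioms L).
Hypotheses (hmon : is_monotone L) (hpot : potential_axioms N L).
Variables (g1 g2 : lg_H1 L) (hg : is_H1_basis g1 g2).
Variables (w : lpoly) (hW : has_potential N g1 g2 w).
Variables (b : mc N L) (hb : cohdeg 1 (mc_b b)).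
Variables (y1 y2 : K) (hy1 : mc_coord b g1 y1) (hy2 : mc_coord b g2 y2).
Notation V := 'rV[K]_(lg_dim L).

Lemma maslov_ge2 beta : beta != 0 -> lg_moduli 1 beta -> 2 <= lg_mu L beta.
Proof.
move=> b0 hm; have [c c0 hc] := hmon.
have := lg_moduli_area hL hm b0; rewrite hc pmulr_rgt0 // ltr0z => mu0.
have [d hd] := lg_mu_even hL beta; rewrite hd in mu0 *.
rewrite -[X in X <= _]mulr1 ler_pM2l //.
by rewrite pmulr_rgt0 // in mu0.
Qed.

Lemma H1_torsion_free (g : lg_H1 L) k : (0 < k)%N -> g *+ k = 0 -> g = 0.
Proof.
move=> k0 gk; have [[i j] [/= hij _]] := hg g.
have [z [_ uz]] := hg 0.
have e0 := uz (0, 0); have ek := uz (i * k%:Z, j * k%:Z).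
rewrite /= !mulr0z addr0 in e0; rewrite /= !mulrzA -mulrnDl -hij gk in ek.
have : (i * k%:Z, j * k%:Z) = (0, 0) by rewrite -e0 // ek.
have k0' : k%:Z != 0 by rewrite eqz_nat -lt0n.
case=> /eqP; rewrite mulf_eq0 (negbTE k0') orbF => /eqP i0.
move=> /eqP; rewrite mulf_eq0 (negbTE k0') orbF => /eqP j0.
by rewrite hij i0 j0 !mulr0z addr0.
Qed.

Let potA := hpot maslov_ge2 H1_torsion_free.
Notation rho := (mc_rho b).
Notation one := (oneL N L).

Lemma m0_count beta : lg_m beta [::] = ratr (lg_n beta) *: lg_one L.
Proof. by have [h _ _] := potA. Qed.

Lemma divisor s beta (x : V) : cohdeg 1 x -> (forall k, nov_plus N (x 0 k)) ->
  mlext N (lg_m beta) (nseq s x) =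
  (kronK N (lg_bd L beta) x ^+ s / s`!%:R) *: map_mx (novC N) (lg_m beta [::]).
Proof. by have [_ h _] := potA; apply: h. Qed.

Lemma one_coord : exists k, lg_one L 0 k != 0.
Proof.
apply/existsP; apply: contraT; rewrite negb_exists => /forallP h.
have /negP := lg_one_neq0 hL; case; apply/eqP/rowP => k; rewrite mxE.
by apply/eqP; have := h k; rewrite negbK.
Qed.

Lemma count_maslov beta : lg_n beta != 0 -> lg_mu L beta = 2.
Proof.
move=> n0; have [k hk] := one_coord.
have : lg_m beta [::] 0 k != 0.
  by rewrite m0_count mxE mulf_neq0 // fmorph_eq0.
move/(lg_m_deg hL); rewrite (lg_one_deg hL hk) big_nil /= => /eqP.
by rewrite subr0 add0r eq_sym subr_eq0 => /eqP.
Qed.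

Lemma disk_termE s beta k : disk_term N rho beta (nseq s (mc_b b)) 0 k =
  nov_mono N (ratr (lg_n beta)) (lg_area L beta) * novC N (rho (lg_bd L beta)) *
  (kronK N (lg_bd L beta) (mc_b b) ^+ s / s`!%:R) * one 0 k.
Proof.
have [_ _ pb _] := mcP b.
rewrite /disk_term mxE divisor // m0_count !mxE (mono_novCT N _ (lg_area L beta)).
by rewrite (mono_novCT N (ratr _)) novCM; ring.
Qed.

(** By monotonicity all classes with a non-zero count have the same area, so T-adic convergence of
    the Maurer-Cartan sum leaves only finitely many. *)
Lemma finite_counts : finite_set [set beta : lg_H2 L | lg_n beta != 0].
Proof.
have [k hk] := one_coord; have [c c0 hc] := hmon.
have [hol _ _ hF] := mcP b.
have [hf _] := hF k.
apply: (sub_finite_set (B := (fun beta => (0%N, beta)) @^-1`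
   [set i | exists2 l, l <= c * 2%:~R & nov_coef N
      ((fun sb : nat * lg_H2 L => (disk_term N rho sb.2 (nseq sb.1 (mc_b b))) 0 k) i) l != 0])).
  move=> beta /= n0; exists (lg_area L beta); first by rewrite hc count_maslov.
  rewrite (disk_termE 0) expr0 fact0 divr1 mulr1 mxE !monoM !addr0 nov_coef_mono eqxx.
  by apply: mulf_neq0 => //; apply: mulf_neq0; [rewrite fmorph_eq0 | apply: hol_neq0].
apply: finite_preimage; last exact: hf.
by move=> x y _ _ [].
Qed.

Let B : seq (lg_H2 L) := fset_set [set beta : lg_H2 L | lg_n beta != 0].

Lemma mem_counts beta : (beta \in B) = (lg_n beta != 0).
Proof. by rewrite /B in_fset_set; [apply/idP/idP; rewrite inE | exact: finite_counts]. Qed.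

Lemma uniq_counts : uniq B. Proof. exact: fset_uniq. Qed.

Lemma coord_exists : exists u : lg_H1 L -> int * int,
  forall g, g = g1 *~ (u g).1 + g2 *~ (u g).2 /\
    forall v, g = g1 *~ v.1 + g2 *~ v.2 -> u g = v.
Proof.
have /choice [u hu] := fun g => hg g.
by exists u.
Qed.

Lemma sum_potential (u : lg_H1 L -> int * int)
  (hu : forall g, g = g1 *~ (u g).1 + g2 *~ (u g).2 /\
    forall v, g = g1 *~ v.1 + g2 *~ v.2 -> u g = v) (phi : int * int -> K) :
  \sum_(beta <- B) nov_mono N (ratr (lg_n beta)) (lg_area L beta) * phi (u (lg_bd L beta)) =
  novT N 1 * \sum_(m <- w) m.2%:~R * phi m.1.
Proof.
(* The exponents that occur as boundary classes or in [w]; comparing coefficients over this finite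
   list turns the sum over disks into the sum over monomials. *)
pose U := undup ([seq u (lg_bd L beta) | beta <- B] ++ [seq m.1 | m <- w]).
have uU : uniq U by apply: undup_uniq.
have coefE v : \sum_(beta <- B | u (lg_bd L beta) == v)
    nov_mono N (ratr (lg_n beta)) (lg_area L beta) = (lp_coef w v)%:~R * novT N 1.
  apply: nov_sum_uniq (hW v); rewrite big_mkcond /=.
  apply: (nov_sum_ext _ (@nov_sum_fset _ _ N _ (fun beta => if u (lg_bd L beta) == v then
     nov_mono N (ratr (lg_n beta)) (lg_area L beta) else 0) (fset_set _) _)) => [beta|beta].
    have [n0|n0] := eqVneq (lg_n beta) 0.
      by rewrite n0 rmorph0 mono0; case: ifP => _; case: ifP.
    rewrite count_maslov // eqxx /=; congr (if _ then _ else _).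
    have [h1 h2] := hu (lg_bd L beta).
    by apply/eqP/eqP => [<-|/h2].
  by rewrite mem_counts negbK => /eqP ->; rewrite rmorph0 mono0; case: ifP.
transitivity (\sum_(v <- U) ((lp_coef w v)%:~R * novT N 1) * phi v).
  under [RHS]eq_bigr => v _ do rewrite -coefE mulr_suml big_mkcond /=.
  rewrite exchange_big /= big_seq [RHS]big_seq; apply: eq_bigr => beta bB.
  rewrite (sum_if_eq _ uU) //.
  by rewrite mem_undup mem_cat map_f.
under eq_bigr => v _ do rewrite mulrAC mulrC.
rewrite -mulr_sumr; congr (_ * _).
under eq_bigr => v _ do rewrite /lp_coef rmorph_sum mulr_suml /= big_mkcond /=.
rewrite exchange_big /= big_seq [RHS]big_seq; apply: eq_bigr => m mw.
rewrite (sum_if_eq _ uU) //.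
by rewrite mem_undup mem_cat (map_f (fun m : (int * int) * int => m.1)) ?orbT.
Qed.

Lemma sum_potential_coord (f : int * int -> K) (F : lg_H1 L -> K) :
  (forall g u, g = g1 *~ u.1 + g2 *~ u.2 -> F g = f u) ->
  \sum_(beta <- B) nov_mono N (ratr (lg_n beta)) (lg_area L beta) * F (lg_bd L beta) =
  novT N 1 * \sum_(m <- w) m.2%:~R * f m.1.
Proof.
move=> hF; have [u hu] := coord_exists; rewrite -(sum_potential hu).
by apply: eq_bigr => beta _; rewrite (hF _ _ (proj1 (hu _))).
Qed.

Lemma holonomy_exp : exists Y : lg_H1 L -> K, exists E : lg_H1 L -> K,
  [/\ forall g, is_exp N (kronK N g (mc_b b)) (E g),
      forall g, Y g = novC N (rho g) * E g &
      forall g u, g = g1 *~ u.1 + g2 *~ u.2 -> Y g = y1 ^ u.1 * y2 ^ u.2].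
Proof.
have [u hu] := coord_exists.
have /choice [E hE] : forall g, exists E, is_exp N (kronK N g (mc_b b)) E.
  move=> g; have [eg _] := hu g.
  case: b hy1 hy2 => r bb W h k1 k2.
  have [E hE _] := mc_coord_span hL (u g).1 (u g).2 k1 k2; exists E.
  by rewrite {1}eg.
exists (fun g => novC N (rho g) * E g), E; split=> // g v ->.
move: hE; case: b hy1 hy2 => r bb W h k1 k2 hE.
have [E' hE' <-] := mc_coord_span hL v.1 v.2 k1 k2.
by rewrite (is_exp_uniq (hE _) hE').
Qed.

(** A non-zero coordinate of the unit isolates W in the Maurer-Cartan equation. For each disk class
    the insertions of [b] sum up to an exponential, which with the holonomy forms a monomial in y_1
    and y_2. *)
Lemma potential_value : mc_W b = novT N 1 * lp_eval w y1 y2.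
Proof.
have [k hk] := one_coord.
have [Y [E [hE hY hYu]]] := holonomy_exp.
have ok : one 0 k != 0 by rewrite mxE mono_eq0.
apply: (mulIf ok).
have [_ _ _ /(_ k) hF] := mcP b.
have h2 : nov_sum N (fun sb : nat * lg_H2 L => (disk_term N rho sb.2 (nseq sb.1 (mc_b b))) 0 k)
    (\sum_(beta <- B) nov_mono N (ratr (lg_n beta)) (lg_area L beta) * Y (lg_bd L beta) * one 0 k).
  apply: nov_sum_columns => [|s beta|beta _ /=]; first exact: uniq_counts.
    by rewrite mem_counts negbK disk_termE => /eqP ->; rewrite rmorph0 mono0 !mul0r.
  have e : nov_mono N (ratr (lg_n beta)) (lg_area L beta) * Y (lg_bd L beta) * one 0 k =
    nov_mono N (ratr (lg_n beta)) (lg_area L beta) * novC N (rho (lg_bd L beta)) * one 0 k *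
    E (lg_bd L beta) by rewrite hY; ring.
  rewrite e; apply: nov_sum_ext (nov_sumZ _ (hE _)) => s.
  by rewrite disk_termE; ring.
rewrite (nov_sum_uniq hF h2) -mulr_suml; congr (_ * _).
rewrite (sum_potential_coord hYu); congr (_ * _).
by apply: eq_bigr => m _; rewrite mulrA.
Qed.

(* By the divisor axiom, the insertions of [b] around [x] sum up to the
   derivative of the potential in the direction [x]. *)
Lemma potential_derivative (x v : V) : cohdeg 1 x ->
  (forall k, nov_sum N (fun z : 2.-tuple nat * lg_H2 L =>
     (disk_term N rho z.2 (nseq (head 0%N z.1) (mc_b b) ++
        x :: nseq (head 0%N (behead z.1)) (mc_b b) ++ [::])) 0 k) (v 0 k)) ->
  v = (novT N 1 * (kronK N g1 x * (y1 * lp_eval (lp_d1 w) y1 y2) +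
                   kronK N g2 x * (y2 * lp_eval (lp_d2 w) y1 y2))) *: one.
Proof.
move=> hx hv; apply/rowP => k; rewrite mxE.
have [_ _ pb _] := mcP b.
have [Y [E [hE hY hYu]]] := holonomy_exp.
(* The insertions before and after [x] are grouped by their total number, which gives the sum over
   positions that [divisor_polar] evaluates. *)
pose g (z : 2.-tuple nat * lg_H2 L) := ((head 0%N z.1 + head 0%N (behead z.1))%N, z.2).
pose rs (sb : nat * lg_H2 L) : seq (2.-tuple nat * lg_H2 L) :=
  [seq ([tuple i; (sb.1 - i)%N], sb.2) | i <- iota 0 sb.1.+1].
have mrs z sb : (z \in rs sb) = (g z == sb).
  case: z sb => t beta [s beta']; case/tupleP: t => i t; case/tupleP: t => j t; rewrite [t]tuple0.
  apply/mapP/eqP => [[i0]|[<- <-]].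
    rewrite mem_iota add0n ltnS => /andP[_ h] /= [-> -> ->].
    by rewrite /g /= subnKC.
  exists i; first by rewrite mem_iota add0n ltnS /= leq_addr.
  by rewrite /= addKn; congr pair; apply: val_inj.
pose fib sb := [fset z in rs sb]%fset.
have hf z sb : (z \in fib sb) = (g z == sb) by rewrite in_fset -mrs.
have urs sb : uniq (rs sb).
  by rewrite map_inj_uniq ?iota_uniq // => i j [].
have h1 := nov_sum_regroup hf (hv k).
have h2 : nov_sum N (fun sb : nat * lg_H2 L =>
    nov_mono N (ratr (lg_n sb.2)) (lg_area L sb.2) * novC N (rho (lg_bd L sb.2)) *
    (kronK N (lg_bd L sb.2) (mc_b b) ^+ sb.1 / sb.1`!%:R) * kronK N (lg_bd L sb.2) x * one 0 k) (v 0 k).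
  apply: nov_sum_ext h1 => -[s beta].
  rewrite sum_fset_seq // big_map -[iota 0 _]/(index_iota 0 s.+1) big_mkord /=.
  transitivity (\sum_(i < s.+1) nov_mono N (rho (lg_bd L beta)) (lg_area L beta) *
      mlext N (lg_m beta) (nseq i (mc_b b) ++ x :: nseq (s - i) (mc_b b)) 0 k).
    by apply: eq_bigr => i _; rewrite /disk_term mxE cats0.
  rewrite -mulr_sumr (divisor_polar divisor) // m0_count !mxE.
  rewrite (mono_novCT N _ (lg_area L beta)) (mono_novCT N (ratr _)) novCM; ring.
have h3 : nov_sum N (fun sb : nat * lg_H2 L =>
    nov_mono N (ratr (lg_n sb.2)) (lg_area L sb.2) * novC N (rho (lg_bd L sb.2)) *
    (kronK N (lg_bd L sb.2) (mc_b b) ^+ sb.1 / sb.1`!%:R) * kronK N (lg_bd L sb.2) x * one 0 k)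
   (\sum_(beta <- B) nov_mono N (ratr (lg_n beta)) (lg_area L beta) *
      (Y (lg_bd L beta) * kronK N (lg_bd L beta) x) * one 0 k).
  apply: nov_sum_columns => [|s beta|beta _ /=]; first exact: uniq_counts.
    by rewrite mem_counts negbK => /eqP ->; rewrite rmorph0 mono0 !mul0r.
  have e : nov_mono N (ratr (lg_n beta)) (lg_area L beta) *
      (Y (lg_bd L beta) * kronK N (lg_bd L beta) x) * one 0 k =
    nov_mono N (ratr (lg_n beta)) (lg_area L beta) * novC N (rho (lg_bd L beta)) *
    kronK N (lg_bd L beta) x * one 0 k * E (lg_bd L beta) by rewrite hY; ring.
  rewrite e; apply: nov_sum_ext (nov_sumZ _ (hE _)) => s.
  by ring.
rewrite (nov_sum_uniq h2 h3) -mulr_suml; congr (_ * _).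
rewrite (sum_potential_coord (F := fun h => Y h * kronK N h x) (f := fun u => y1 ^ u.1 * y2 ^ u.2 *
  (kronK N g1 x *~ u.1 + kronK N g2 x *~ u.2))); last first.
  by move=> h u hu; rewrite (hYu _ _ hu) hu kronK_span.
congr (_ * _); rewrite /lp_eval !big_map !mulr_sumr -big_split; apply: eq_bigr => m _ /=.
have y10 := mc_coord_neq0 hy1; have y20 := mc_coord_neq0 hy2.
(* The boundary class pairs with [x] through its exponents, as y_1 d/dy_1 and y_2 d/dy_2 do on
   monomials; the factors y_1 and y_2 restore the exponents lowered by [lp_d1] and [lp_d2]. *)
have e1 : y1 * y1 ^ (m.1.1 - 1) = y1 ^ m.1.1.
  by rewrite -{1}[y1]expr1z -expfzDr // addrC subrK.
have e2 : y2 * y2 ^ (m.1.2 - 1) = y2 ^ m.1.2.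
  by rewrite -{1}[y2]expr1z -expfzDr // addrC subrK.
rewrite !intrM -[kronK N g1 x *~ _]mulrzr -[kronK N g2 x *~ _]mulrzr.
move: (y1 ^ (m.1.1 - 1)) (y2 ^ (m.1.2 - 1)) e1 e2 => z1 z2 <- <-.
move: (kronK N g1 x) (kronK N g2 x) (m.1.1%:~R) (m.1.2%:~R) (m.2%:~R) => k1 k2 i j c.
by ring.
Qed.

End MonotoneTorus.

(** * Quantum cohomology *)

Section Frobenius.
Variables (K : fieldType) (V : vectType K) (mul : V -> V -> V) (one : V) (B : V -> V -> K).
Hypotheses (mulDl : forall a x y z, mul (a *: x + y) z = a *: mul x z + mul y z)
  (mulC : commutative mul) (mulA : associative mul) (mul1 : left_id one mul)
  (BDl : forall a x y z, B (a *: x + y) z = a * B x z + B y z)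
  (BC : forall x y, B x y = B y x) (Bmul : forall x y z, B (mul x y) z = B x (mul y z))
  (Bnd : forall x, (forall y, B x y = 0) -> x = 0).

Let mul_lin z : linear (mul z).
Proof. by move=> a x y; rewrite mulC mulDl ![mul _ z]mulC. Qed.
Let B_lin z : linear (fun x => B x z : K^o).
Proof. by move=> a x y; apply: BDl. Qed.

Let mulx0 x : mul x 0 = 0. Proof. exact: (lin0 (@mul_lin x)). Qed.
Let B0l x : B 0 x = 0. Proof. exact: (lin0 (@B_lin x)). Qed.

(* The complement is the orthogonal of [I]: an element of both has square zero. *)
Lemma reduced_ideal_complement (I : {vspace V}) :
  (forall n, mul n n = 0 -> n = 0) ->
  (forall a x, x \in I -> mul a x \in I) ->
  exists J : {vspace V}, [/\ forall a x, x \in J -> mul a x \in J,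
    (I + J)%VS = fullv & (I :&: J)%VS = 0%VS].
Proof.
move=> red hI.
pose row (y : V) : 'rV[K]_(\dim I) := \row_i B y (tnth (vbasis I) i).
have rl : linear row by move=> a x y; apply/rowP => i; rewrite !mxE BDl.
pose J := lker (linfun row).
have JP y : reflect (forall x, x \in I -> B y x = 0) (y \in J).
  rewrite memv_ker linfunE //; apply: (iffP eqP) => [h x xI|h].
    rewrite (coord_vbasis xI) BC.
    rewrite (big_morph (fun z => B z y : K^o) (linD (@B_lin y)) (B0l y)).
    apply: big1 => i _; rewrite (linZ (@B_lin y)) BC -tnth_nth.
    by have /rowP/(_ i) := h; rewrite !mxE => ->; rewrite scaler0.
  by apply/rowP => i; rewrite !mxE h // vbasis_mem // mem_tnth.
have IJ : (I :&: J)%VS = 0%VS.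
  apply/eqP; rewrite -subv0; apply/subvP => x; rewrite memv_cap memv0 => /andP[xI /JP xJ].
  apply/eqP/red/Bnd => y; rewrite Bmul xJ // mulC; exact: hI.
exists J; split=> //.
  move=> a x /JP xJ; apply/JP => y yI; rewrite mulC Bmul; apply: xJ; exact: hI.
apply/eqP; rewrite eqEdim subvf /= dimv_disjoint_sum //.
have := limg_ker_dim (linfun row) fullv; rewrite capfv -/J => <-.
rewrite addnC leq_add2r (leq_trans (dimvS (subvf _))) //.
by rewrite dimvf /dim /= mul1n.
Qed.

Variables (c vp vm : V) (s : 'I_4 -> V) (W lp lm : K).
Hypotheses (dimV : \dim {: V} = 7) (five : (5 : K) != 0) (two : (2 : K) != 0).
Hypotheses (cs : forall i, mul c (s i) = W *: s i)
  (cvp : mul c vp = lp *: vp) (cvm : mul c vm = lm *: vm) (vp0 : vp != 0) (vm0 : vm != 0)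
  (Wp : W != lp) (Wm : W != lm) (pm : lp != lm).
(* The intersection form of the spheres is minus the Cartan matrix of A_4. *)
Hypotheses (Bss : forall i j : 'I_4, B (s i) (s j) =
    if i == j then -2 else if (i.+1 == j)%N || (j.+1 == i)%N then 1 else 0)
  (Bs1 : forall i, B (s i) one = 0).
Hypothesis nils : forall n i, mul n n = 0 -> B (mul n (s i)) (s i) = 0.

Let s2 := mul (s 0) (s 0).
(** The fifth vector completes the eigenspace of the spheres: its pairing with [one] is the
    self-pairing -2 of [s 0], whereas the spheres are orthogonal to [one]. *)
Definition frob_basis : 7.-tuple V := [tuple s 0; s 1; s 2; s 3; s2; vp; vm].

(** Vandermonde elimination: with coefficients l2 l3, -(l2 + l3) and 1, the three equations combine
    to (l1 - l2)(l1 - l3) a = 0. *)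
Lemma eigen_sep1 (l1 l2 l3 : K) (a b d : V) : l1 != l2 -> l1 != l3 -> a + b + d = 0 ->
  l1 *: a + l2 *: b + l3 *: d = 0 ->
  l1 *: (l1 *: a) + l2 *: (l2 *: b) + l3 *: (l3 *: d) = 0 -> a = 0.
Proof.
move=> n12 n13 f0 f1 f2.
rewrite (coord_vbasis (memvf a)); apply: big1 => i _.
suff -> : coord (vbasis fullv) i a = 0 by rewrite scale0r.
have := congr1 (coord (vbasis fullv) i) f0; have := congr1 (coord (vbasis fullv) i) f1.
have := congr1 (coord (vbasis fullv) i) f2; rewrite !linearD !linearZ linear0 /= /GRing.scale /=.
move: (coord _ i a) (coord _ i b) (coord _ i d) => x y z e2 e1 e0.
have : (l1 - l2) * (l1 - l3) * x = 0.
  transitivity ((l1 * (l1 * x) + l2 * (l2 * y) + l3 * (l3 * z))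
    - (l2 + l3) * (l1 * x + l2 * y + l3 * z) + (l2 * l3) * (x + y + z)); first by ring.
  by rewrite e0 e1 e2; ring.
by move/eqP; rewrite !mulf_eq0 !subr_eq0 (negPf n12) (negPf n13) => /eqP.
Qed.

Let mulxZ a x y : mul x (a *: y) = a *: mul x y. Proof. exact: (linZ (@mul_lin x)). Qed.
Let mulxD x y z : mul x (y + z) = mul x y + mul x z. Proof. exact: (linD (@mul_lin x)). Qed.
Let mulxN x y : mul x (- y) = - mul x y. Proof. exact: (linN (@mul_lin x)). Qed.
Let mulZx a x y : mul (a *: x) y = a *: mul x y. Proof. by rewrite mulC mulxZ mulC. Qed.
Let mul0x x : mul 0 x = 0. Proof. by rewrite mulC mulx0. Qed.

Lemma eigen_sep x y z : x + y + z = 0 ->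
  mul c x = W *: x -> mul c y = lp *: y -> mul c z = lm *: z -> [/\ x = 0, y = 0 & z = 0].
Proof.
move=> e0 hx hy hz.
have e1 : W *: x + lp *: y + lm *: z = 0 by rewrite -hx -hy -hz -!mulxD e0 mulx0.
have e2 : W *: (W *: x) + lp *: (lp *: y) + lm *: (lm *: z) = 0.
  by rewrite -hx -hy -hz -!mulxZ -!mulxD e1 mulx0.
split.
- exact: (eigen_sep1 Wp Wm e0 e1 e2).
- by apply: (@eigen_sep1 lp W lm y x z _ pm); rewrite 1?eq_sym ?[y + x]addrC //
    [lp *: _ + W *: _]addrC // [lp *: (lp *: _) + _]addrC.
- apply: (@eigen_sep1 lm W lp z x y); rewrite 1?eq_sym // -addrA addrC //.
Qed.

Let spart (k : 'I_7 -> K) := k (inord 0) *: s 0 + k (inord 1) *: s 1 + k (inord 2) *: s 2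
  + k (inord 3) *: s 3 + k (inord 4) *: s2.

Let cs2 : mul c s2 = W *: s2.
Proof. by rewrite /s2 mulA cs mulZx. Qed.

Let c_spart k : mul c (spart k) = W *: spart k.
Proof. by rewrite /spart !mulxD !mulxZ !cs cs2 !scalerDr !scalerA ![W * _]mulrC. Qed.

Let basis_sum k : \sum_(i < 7) k i *: frob_basis`_i =
  spart k + k (inord 5) *: vp + k (inord 6) *: vm.
Proof.
rewrite !big_ord_recl big_ord0 addr0 /spart /= !addrA.
by congr (_ *: _ + _ *: _ + _ *: _ + _ *: _ + _ *: _ + _ *: _ + _ *: _); congr k;
  apply: val_inj; rewrite /= inordK.
Qed.

Let BZ a x y : B (a *: x) y = a * B x y. Proof. exact: (linZ (@B_lin y)). Qed.
Let BD x y z : B (x + y) z = B x z + B y z. Proof. exact: (linD (@B_lin z)). Qed.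

Lemma frob_free : free frob_basis.
Proof.
apply/freeP => k; rewrite basis_sum => e.
have [|||x0 y0 z0] := eigen_sep e.
- exact: c_spart.
- by rewrite mulxZ cvp !scalerA mulrC.
- by rewrite mulxZ cvm !scalerA mulrC.
have k5 : k (inord 5) = 0 by move/eqP: y0; rewrite scaler_eq0 (negPf vp0) orbF => /eqP.
have k6 : k (inord 6) = 0 by move/eqP: z0; rewrite scaler_eq0 (negPf vm0) orbF => /eqP.
have k4 : k (inord 4) = 0.
  have := congr1 (B^~ one) x0; rewrite /spart !BD !BZ !Bs1 B0l /s2 Bmul [mul _ one]mulC mul1 Bss eqxx.
  rewrite !mulr0 !add0r => /eqP; rewrite mulf_eq0 oppr_eq0 (negPf two) orbF => /eqP ->//.
have e' i : k (inord 0) * B (s 0) (s i) + k (inord 1) * B (s 1) (s i)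
   + k (inord 2) * B (s 2) (s i) + k (inord 3) * B (s 3) (s i) = 0.
  by have := congr1 (B^~ (s i)) x0; rewrite /spart !BD !BZ k4 mul0r addr0 B0l.
have := e' 0; have := e' 1; have := e' 2; have := e' 3.
rewrite !Bss /= !mulr1 !mulr0 !addr0 ?add0r => e3 e2 e1 e0.
(* The weights 4, 3, 2, 1 are the first row of the adjugate of the Cartan matrix of A_4, whose
   determinant is 5. *)
have k0 : k (inord 0) = 0.
  have : 5 * k (inord 0) = 0.
    transitivity (- (4 * (k (inord 0) * -2 + k (inord 1)) + 3 * (k (inord 0) + k (inord 1) * -2 + k (inord 2)) + 2 * (k (inord 1) + k (inord 2) * -2 + k (inord 3)) + (k (inord 2) + k (inord 3) * -2))); first by ring.
    by rewrite e0 e1 e2 e3; ring.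
  by move/eqP; rewrite mulf_eq0 (negPf five) => /eqP.
move: e0; rewrite k0 mul0r add0r => k1.
move: e1; rewrite k0 k1 mul0r !add0r => k2.
move: e2; rewrite k1 k2 mul0r !add0r => k3 i.
by rewrite -(inord_val i); case: i => -[|[|[|[|[|[|[|m]]]]]]] hm.
Qed.

Let frob_full x : exists k : 'I_7 -> K,
  x = spart k + k (inord 5) *: vp + k (inord 6) *: vm.
Proof.
have hb : basis_of fullv frob_basis.
  by rewrite basisEfree frob_free subvf dimV size_tuple leqnn.
exists (fun i => coord frob_basis i x).
by rewrite -basis_sum; exact: (coord_basis hb (memvf x)).
Qed.

Lemma frob_span : exists k : 'I_7 -> K,
  one = k (inord 0) *: s 0 + k (inord 1) *: s 1 + k (inord 2) *: s 2
  + k (inord 3) *: s 3 + k (inord 4) *: mul (s 0) (s 0)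
  + k (inord 5) *: vp + k (inord 6) *: vm.
Proof. by have [k e] := frob_full one; exists k. Qed.

Let nil_eigen n v : mul n n = 0 -> v != 0 -> (exists a, mul n v = a *: v) -> mul n v = 0.
Proof.
move=> nn v0 [a e]; have : mul (mul n n) v = 0 by rewrite nn mul0x.
rewrite -mulA e mulxZ e scalerA => /eqP; rewrite scaler_eq0 (negPf v0) orbF mulf_eq0 orbb.
by move/eqP ->; rewrite scale0r.
Qed.

(* The eigenspaces of [c] through [vp] and [vm] are lines, on which a nilpotent acts by 0. *)
Let nil_kill n : mul n n = 0 -> (forall i, mul n (s i) = 0) -> n = 0.
Proof.
move=> nn ns.
have nvp : mul n vp = 0.
  apply: nil_eigen => //.
  have [k e] := frob_full (mul n vp); exists (k (inord 5)).
  have [||||_ /eqP] := @eigen_sep (spart k) (k (inord 5) *: vp - mul n vp) (k (inord 6) *: vm).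
  - by rewrite {1}e addrA -[_ - _ + _]addrA [- _ + _]addrC addrA subrr.
  - by rewrite c_spart.
  - by rewrite mulxD mulxN mulxZ cvp mulA [mul c n]mulC -mulA cvp mulxZ scalerBr !scalerA mulrC.
  - by rewrite mulxZ cvm !scalerA mulrC.
  by rewrite subr_eq0 => /eqP ->.
have nvm : mul n vm = 0.
  apply: nil_eigen => //.
  have [k e] := frob_full (mul n vm); exists (k (inord 6)).
  have [||||_ _ /eqP] := @eigen_sep (spart k) (k (inord 5) *: vp) (k (inord 6) *: vm - mul n vm).
  - by rewrite {1}e addrA subrr.
  - by rewrite c_spart.
  - by rewrite mulxZ cvp !scalerA mulrC.
  - by rewrite mulxD mulxN mulxZ cvm mulA [mul c n]mulC -mulA cvm mulxZ scalerBr !scalerA mulrC.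
  by rewrite subr_eq0 => /eqP ->.
rewrite -[n]mul1 mulC; have [k ->] := frob_full one.
by rewrite /spart !mulxD !mulxZ !ns nvp nvm /s2 mulA ns mul0x !scaler0 !addr0.
Qed.

(** Induction on the number of spheres not yet known to be annihilated. If [m] kills the earlier
    ones, then m s_j kills them and, by [nss], also s_j itself; so m s_j = 0, and [m] kills one
    more. *)
Lemma frob_reduced n : mul n n = 0 -> n = 0.
Proof.
have nx m x : mul m m = 0 -> mul (mul m x) (mul m x) = 0.
  by move=> mm; rewrite mulA -[mul (mul m x) m]mulA [mul x m]mulC mulA mm !mul0x.
(* [nils] yields only a number, but it applies to each m x, whose square is zero as well; hence m
   s_i s_i is orthogonal to every x. *)
have nss m i : mul m m = 0 -> mul (mul m (s i)) (s i) = 0.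
  move=> mm; apply: Bnd => x; rewrite Bmul [mul (s i) x]mulC -Bmul -[mul (mul m (s i)) x]mulA.
  by rewrite [mul (s i) x]mulC mulA nils // nx.
suff H k : forall m, mul m m = 0 -> (forall i : 'I_4, (i < 4 - k)%N -> mul m (s i) = 0) -> m = 0.
  by move=> nn; apply: (H 4%N) nn _ => i; rewrite subnn.
elim: k => [|k IH] m mm h; first by apply: nil_kill => // i; apply: h.
have [k4|k4] := ltnP k 4; last first.
  by apply: IH => // i; rewrite (eqP (_ : 4 - k == 0)%N) // subn_eq0.
have k0 : (4 - k.+1 < 4)%N by lia.
pose j := Ordinal k0.
have mj : mul m (s j) = 0.
  apply: IH; first exact: nx.
  move=> i hi; have [->|ij] := eqVneq i j; first exact: nss.
  rewrite -mulA [mul (s j) _]mulC mulA h ?mul0x //.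
  by move: ij hi; rewrite -val_eqE /=; lia.
apply: IH => // i hi; have [->//|ij] := eqVneq i j; apply: h.
by move: ij hi; rewrite -val_eqE /=; lia.
Qed.

End Frobenius.

(** * The intersection pairing of X *)

Section PairX.
Variable K : comNzRingType.
Implicit Types x y z : 'rV[K]_7.

Lemma pairXE x y : pairX x y =
  x 0 (inord 0) * y 0 (inord 6) + y 0 (inord 0) * x 0 (inord 6) +
  (x 0 (inord 1) * y 0 (inord 1) - (x 0 (inord 2) * y 0 (inord 2) +
   x 0 (inord 3) * y 0 (inord 3) + x 0 (inord 4) * y 0 (inord 4) +
   x 0 (inord 5) * y 0 (inord 5))).
Proof.
rewrite /pairX /intX /cupX /qformX !mxE -!val_eqE /= !inordK //=.
do 4 (rewrite big_ltn //); rewrite big_geq //=.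
by rewrite mulr0 oppr0 !addr0 mulr1 !addrA.
Qed.

Lemma pairX_linl z : linear (fun x => pairX x z : K^o).
Proof. by move=> a x y; rewrite !pairXE !mxE /GRing.scale /=; ring. Qed.

Lemma pairXC x y : pairX x y = pairX y x.
Proof. by rewrite !pairXE; ring. Qed.

Lemma pairX_linr z : linear (fun x => pairX z x : K^o).
Proof. by move=> a x y; rewrite ![pairX z _]pairXC; apply: pairX_linl. Qed.

Lemma pairX_nondeg x : (forall y, pairX x y = 0) -> x = 0.
Proof.
move=> h; apply/rowP => k; rewrite mxE.
have H i := h (delta_mx 0 (inord i)).
have := H 0%N; have := H 1%N; have := H 2; have := H 3; have := H 4; have := H 5; have := H 6.
rewrite !pairXE !mxE -!val_eqE /= !inordK //= !mulr0 !mulr1 !mul1r !mul0r !addr0 !add0r !oppr0 ?addr0 ?add0r ?sub0r.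
move=> h0 /eqP; rewrite oppr_eq0 => /eqP h5 /eqP; rewrite oppr_eq0 => /eqP h4.
move=> /eqP; rewrite oppr_eq0 => /eqP h3 /eqP; rewrite oppr_eq0 => /eqP h2 h1 h6.
by rewrite -(inord_val k); case: k => -[|[|[|[|[|[|[|m]]]]]]] hm.
Qed.

Lemma cupX1 y : cupX (oneX K) y = y.
Proof.
rewrite /cupX /qformX.
have -> : oneX K 0 (inord 0) = 1 by rewrite mxE !eqxx.
have h k : (0 < k < 7)%N -> oneX K 0 (inord k) = 0.
  by move=> /andP[k0 k7]; rewrite mxE -!val_eqE /= !inordK // (gtn_eqF k0).
rewrite h // mul0r big_nat_cond big1 => [|k /andP[/andP[k1 k2] _]].
  by rewrite subr0 scale0r addr0 mul1r scale1r addrK.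
by rewrite h ?mul0r //; lia.
Qed.
End PairX.

Lemma map_pairX (K K' : comNzRingType) (f : {rmorphism K -> K'}) (x y : 'rV[K]_7) :
  pairX (map_mx f x) (map_mx f y) = f (pairX x y).
Proof. by rewrite !pairXE !mxE !(rmorphD, rmorphN, rmorphM). Qed.

Lemma map_h2X (K K' : comNzRingType) (f : {rmorphism K -> K'}) al : map_mx f (h2X K al) = h2X K' al.
Proof. by apply/rowP => k; rewrite !mxE; case: ifP => _; rewrite ?rmorph_int ?rmorph0. Qed.

(** Once denominators are cleared, the exponent of 5 would be even on one side of the equation and
    odd on the other. *)
Lemma sqrt5_irrational (R : realType) (q : rat) : Num.sqrt 5 <> ratr q :> R.
Proof.
move=> e; have : (ratr (q ^+ 2) : R) = ratr 5 by rewrite rmorphXn /= -e sqr_sqrtr ?ler0n // ratr_nat.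
move/fmorph_inj => q2.
have : (numq q ^+ 2)%:~R = (5 * denq q ^+ 2)%:~R :> rat.
  by rewrite rmorphXn rmorphM rmorphXn /= numqE exprMn q2.
move/intr_inj/(congr1 absz); rewrite abszM !abszX => e2.
have n0 : (0 < `|denq q|)%N by rewrite absz_gt0 denq_neq0.
have m0 : (0 < `|numq q|)%N.
  have : (0 < `|numq q| ^ 2)%N by rewrite e2 muln_gt0 expn_gt0 n0.
  by rewrite expn_gt0 orbF.
have := congr1 (logn 5) e2; rewrite lognM ?expn_gt0 ?n0 // !lognX.
by move/(congr1 odd); rewrite oddD !oddM.
Qed.

(** * The quantum ring of X and its eigenvectors *)

Section QuantumRing.
Variables (R : realType) (K : fieldType) (N : novikov R K) (Q : quantum_data K).
Hypothesis hQ : quantum_axioms N Q.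
Notation qc := (qcoef Q).
Notation e_ i := (delta_mx 0 i : 'rV[K]_7).
Implicit Types x y z : 'rV[K]_7.

Let g i j k := pairX (qc i j) (e_ k).

Lemma qmul_linl z : linear (fun x => qmul Q x z).
Proof.
move=> a x y; rewrite /qmul /bilin scaler_sumr -big_split; apply: eq_bigr => i _ /=.
rewrite scaler_sumr -big_split; apply: eq_bigr => j _ /=.
by rewrite !mxE mulrDl scalerDl scalerA mulrA.
Qed.

Lemma pairX_qmul x y z : pairX (qmul Q x y) z = \sum_i \sum_j \sum_k x 0 i * y 0 j * z 0 k * g i j k.
Proof.
rewrite /qmul /bilin (big_morph (fun u => pairX u z : K^o) (linD (@pairX_linl _ z)) (lin0 (@pairX_linl _ z))).
apply: eq_bigr => i _.
rewrite (big_morph (fun u => pairX u z : K^o) (linD (@pairX_linl _ z)) (lin0 (@pairX_linl _ z))).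
apply: eq_bigr => j _; rewrite (linZ (@pairX_linl _ z)) {1}[z]row_sum_delta.
rewrite (big_morph _ (linD (@pairX_linr _ _)) (lin0 (@pairX_linr _ _))) scaler_sumr.
by apply: eq_bigr => k _; rewrite (linZ (@pairX_linr _ _)) scalerA.
Qed.

Lemma g12 i j k : g i j k = g j i k.
Proof.
apply: (nov_sum_uniq (qcoef_gw hQ i j k)); apply: nov_sum_ext (qcoef_gw hQ j i k) => al.
by rewrite (gw_swap12 hQ).
Qed.

Lemma g23 i j k : g i j k = g i k j.
Proof.
apply: (nov_sum_uniq (qcoef_gw hQ i j k)); apply: nov_sum_ext (qcoef_gw hQ i k j) => al.
by rewrite (gw_swap23 hQ).
Qed.

Lemma qmulC : commutative (qmul Q).
Proof.
move=> x y; apply/eqP; rewrite -subr_eq0; apply/eqP/pairX_nondeg => z.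
rewrite (linB (@pairX_linl _ z)) !pairX_qmul exchange_big /=.
apply/eqP; rewrite subr_eq0; apply/eqP; apply: eq_bigr => i _; apply: eq_bigr => j _; apply: eq_bigr => k _.
by rewrite g12; congr (_ * _ * _); rewrite mulrC.
Qed.

(** Both sides are the three-point function of x, y, z, which is symmetric. *)
Lemma qmul_assoc_pair x y z : pairX (qmul Q x y) z = pairX x (qmul Q y z).
Proof.
rewrite [RHS]pairXC !pairX_qmul [RHS]exchange_big /= exchange_big /=.
transitivity (\sum_j \sum_k \sum_i x 0 i * y 0 j * z 0 k * g i j k).
  by apply: eq_bigr => j _; rewrite exchange_big.
rewrite exchange_big /=; apply: eq_bigr => k _; apply: eq_bigr => j _; apply: eq_bigr => i _.
by rewrite (g12 i) (g23 j); congr (_ * _); ring.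
Qed.

(** An insertion of the unit leaves only the class 0, where the invariant is the classical triple
    intersection. *)
Lemma qmul1 : left_id (oneX K) (qmul Q).
Proof.
have q0j j : qc (inord 0) j = e_ j.
  apply/eqP; rewrite -subr_eq0; apply/eqP/pairX_nondeg => z.
  rewrite (linB (@pairX_linl _ z)) [z]row_sum_delta.
  rewrite !(big_morph _ (linD (@pairX_linr _ _)) (lin0 (@pairX_linr _ _))) -sumrB big1 // => k _.
  rewrite !(linZ (@pairX_linr _ _)) -scalerBr; apply/eqP; rewrite scaler_eq0 subr_eq0; apply/orP; right; apply/eqP.
  apply: (nov_sum_uniq (qcoef_gw hQ _ j k)).
  have := @nov_sum_fset R K N _ (fun al => nov_mono N (ratr (gw Q al (inord 0) j k)) (c1num al)%:~R) [fset 0]%fset.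
  rewrite big_seq_fset1 (gw_zero hQ) -[delta_mx 0 (inord 0)]/(oneX rat) cupX1.
  have -> : c1num 0 = 0.
    by rewrite /c1num (_ : h2X int 0 = 0) ?(lin0 (@pairX_linr _ _)) //; apply/rowP => i; rewrite !mxE; case: ifP.
  rewrite -/(novC N _) -[intX _]/(pairX _ _) -(map_pairX (ratr : {rmorphism rat -> R[i]})).
  rewrite -(map_pairX (novC N : {rmorphism R[i] -> K})) !map_delta_mx; apply=> al.
  by rewrite inE => al0; rewrite (gw_fundamental hQ) // rmorph0 mono0.
move=> x; rewrite /qmul /bilin (bigD1 (inord 0)) //= [X in _ + X]big1 ?addr0 => [|i i0].
  rewrite [RHS]row_sum_delta; apply: eq_bigr => j _.
  by rewrite mxE !eqxx mul1r q0j.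
by apply: big1 => j _; rewrite mxE eqxx /= (negPf i0) mul0r scale0r.
Qed.

Lemma h2X_neq0 al k : h2X K al 0 k != 0 -> degX k = 2%N.
Proof.
rewrite mxE; case: ifP => [|_]; last by rewrite eqxx.
by case: k => -[|[|[|[|[|[|[|m]]]]]]] hm.
Qed.

(* Degree 2 classes have three-point invariants only on curves with c_1 = 1. *)
Lemma qmul_divisors al be ga : exists r : rat,
  pairX (qmul Q (h2X K al) (h2X K be)) (h2X K ga) = novC N (ratr r) * novT N 1.
Proof.
have gT i j k : degX i = 2%N -> degX j = 2%N -> degX k = 2%N ->
    exists r : rat, g i j k = novC N (ratr r) * novT N 1.
  move=> di dj dk; pose D := fset_set [set al | c1num al <= 1 /\ exists i j k, gw Q al i j k != 0]%classic.
  exists (\sum_(al <- D) gw Q al i j k); rewrite -mono_novCT.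
  apply: (nov_sum_uniq (qcoef_gw hQ i j k)).
  have c1 al' : gw Q al' i j k != 0 -> c1num al' = 1.
    by move/(gw_degree hQ); rewrite di dj dk; lia.
  have -> : nov_mono N (ratr (\sum_(al' <- D) gw Q al' i j k)) 1 =
      \sum_(al' <- D) nov_mono N (ratr (gw Q al' i j k)) (c1num al')%:~R.
    rewrite rmorph_sum (big_morph (fun a => nov_mono N a 1) (fun a b => monoD N a b 1) (mono0 N 1)).
    apply: eq_bigr => al' _; have [->|/c1 -> //] := eqVneq (gw Q al' i j k) 0.
    by rewrite !rmorph0 !mono0.
  apply: (@nov_sum_fset _ _ N _ (fun al' => nov_mono N (ratr (gw Q al' i j k)) (c1num al')%:~R)) => al'.
  have [->|h] := eqVneq (gw Q al' i j k) 0; first by rewrite rmorph0 mono0.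
  rewrite in_fset_set ?notin_setE; last exact: gw_compact hQ 1.
  by case; split; [rewrite c1|exists i, j, k].
have sumT (I : finType) (F : I -> K) : (forall i, exists r : rat, F i = novC N (ratr r) * novT N 1) ->
    exists r : rat, \sum_i F i = novC N (ratr r) * novT N 1.
  move=> /choice[r hr]; exists (\sum_i r i); rewrite !rmorph_sum mulr_suml.
  by apply: eq_bigr => i _.
rewrite pairX_qmul; apply: (sumT) => i; apply: (sumT) => j; apply: (sumT) => k.
have z0 a : a = 0 -> exists r : rat, a = novC N (ratr r) * novT N 1.
  by move=> ->; exists 0; rewrite !rmorph0 mul0r.
have [e|/h2X_neq0 di] := eqVneq (h2X K al 0 i) 0; first by apply: (z0); rewrite e !mul0r.
have [e|/h2X_neq0 dj] := eqVneq (h2X K be 0 j) 0; first by apply: (z0); rewrite e mulr0 !mul0r.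
have [e|/h2X_neq0 dk] := eqVneq (h2X K ga 0 k) 0; first by apply: (z0); rewrite e mulr0 !mul0r.
have [r ->] := gT i j k di dj dk.
have hI a l : exists z : int, h2X K a 0 l = z%:~R.
  by rewrite mxE; case: ifP => _; [exists (a 0 (inord l.-1))|exists 0].
have [za ->] := hI al i; have [zb ->] := hI be j; have [zc ->] := hI ga k.
exists (za%:~R * zb%:~R * zc%:~R * r).
pose f : {rmorphism rat -> K} := novC N \o ratr.
transitivity (za%:~R * zb%:~R * zc%:~R * (f r * novT N 1)) => //.
rewrite -[novC N _]/(f (za%:~R * zb%:~R * zc%:~R * r)).
by rewrite !(rmorphM f) !(rmorph_int f) mulrA.
Qed.

Notation sph i := (h2X K (sphere_class i)).
Notation c := (h2X K c1X).

Lemma pairX_h2X1 al : pairX (h2X K al) (oneX K) = 0.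
Proof. by rewrite pairXE !mxE -!val_eqE /= !inordK //= !mulr0 !addr0 subr0 addr0. Qed.

Lemma pairX_sphere (i j : 'I_4) : pairX (sph i) (sph j) =
  if i == j then -2 else if (i.+1 == j)%N || (j.+1 == i)%N then 1 else 0.
Proof.
rewrite pairXE !mxE /= ![nat_of_ord (@inord 6 _)]inordK //= !inordK //=.
by case: i => -[|[|[|[|m]]]] hi //; case: j => -[|[|[|[|n]]]] hj //; rewrite -val_eqE /=; ring.
Qed.

(* Separates the eigenvalues of c_1 at the tori from the one at the spheres,
   which is a rational multiple of T. *)
Lemma quadratic_irrational (a b r : rat) : a != 0 ->
  (ratr b + ratr a * Num.sqrt 5)%:C <> ratr r :> R[i].
Proof.
rewrite -(fmorph_rat (real_complex R)) => a0 /(@complexI R) h.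
apply: (@sqrt5_irrational R ((r - b) / a)).
have a0' : ratr a != 0 :> R by rewrite fmorph_eq0.
by rewrite fmorph_div rmorphB /= -h [X in X - _]addrC addrK mulrC mulKf.
Qed.

Variables (w : 'I_4 -> K) (vp vm : 'rV[K]_7).
Notation valp := ((5 + 5 * Num.sqrt 5) / 2 : R).
Notation valm := ((5 - 5 * Num.sqrt 5) / 2 : R).
Notation lam v := (novT N 1 * novC N v%:C).
Hypotheses (c_sph : forall i, qmul Q c (sph i) = w i *: sph i)
  (c_vp : qmul Q c vp = lam valp *: vp) (c_vm : qmul Q c vm = lam valm *: vm)
  (vp0 : vp != 0) (vm0 : vm != 0).
Hypothesis nils : forall n i, qmul Q n n = 0 -> pairX (qmul Q n (sph i)) (sph i) = 0.

(** Multiplication by c_1 is self-adjoint, so eigenvectors that pair non-trivially share their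
    eigenvalue. *)
Let w_adj (i j : 'I_4) : pairX (sph i) (sph j) = 1 -> w i = w j.
Proof.
move=> h; transitivity (pairX (qmul Q c (sph i)) (sph j)).
  by rewrite c_sph (linZ (@pairX_linl _ _)) h /GRing.scale /= mulr1.
rewrite [qmul Q c _]qmulC qmul_assoc_pair c_sph (linZ (@pairX_linr _ _)) h.
by rewrite /GRing.scale /= mulr1.
Qed.

Let w0 i : w i = w 0.
Proof.
have h1 : w 0 = w 1 by apply: w_adj; rewrite pairX_sphere.
have h2 : w 1 = w 2 by apply: w_adj; rewrite pairX_sphere.
have h3 : w 2 = w 3 by apply: w_adj; rewrite pairX_sphere.
have -> : i = inord i by rewrite inord_val.
case: i => -[|[|[|[|m]]]] hm //=.
- by congr w; apply: val_inj; rewrite /= inordK.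
- by rewrite h1; congr w; apply: val_inj; rewrite /= inordK.
- by rewrite h1 h2; congr w; apply: val_inj; rewrite /= inordK.
- by rewrite h1 h2 h3; congr w; apply: val_inj; rewrite /= inordK.
Qed.

Let two : (2 : K) != 0. Proof. by rewrite (nov_natr_eq0 N). Qed.

Let w_rational : exists r : rat, w 0 = novT N 1 * novC N (ratr r).
Proof.
have [r hr] := qmul_divisors c1X (sphere_class 0) (sphere_class 0).
(* The self-pairing of a sphere is -2, so <c_1 s_1, s_1> is -2 times the eigenvalue. *)
exists (- r / 2).
have : w 0 * -2 = novC N (ratr r) * novT N 1.
  by rewrite -hr c_sph (linZ (@pairX_linl _ _)) pairX_sphere eqxx.
move=> e; apply: (mulIf two).
pose f : {rmorphism rat -> K} := novC N \o ratr.
rewrite -[novC N _]/(f (- r / 2)) fmorph_div rmorphN rmorph_nat.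
rewrite -[novC N _]/(f r) in e.
have -> : w 0 * 2 = - (f r * novT N 1) by rewrite -e; ring.
by field; rewrite two.
Qed.

Let lam_neq (u v : R[i]) : u <> v -> novT N 1 * novC N u != novT N 1 * novC N v.
Proof.
move=> uv; rewrite (inj_eq (mulfI (novT_neq0 N 1))) (inj_eq (fmorph_inj (novC N))).
by apply/eqP.
Qed.

Let valpE : valp = ratr (5 / 2) + ratr (5 / 2) * Num.sqrt 5.
Proof. by rewrite fmorph_div !rmorph_nat; field. Qed.
Let valmE : valm = ratr (5 / 2) + ratr (- 5 / 2) * Num.sqrt 5.
Proof. by rewrite !fmorph_div rmorphN !rmorph_nat; field. Qed.

Let val_neq : valp%:C <> valm%:C :> R[i].
Proof.
move=> /(@complexI R) h; have := sqrtr_gt0 (5 : R); rewrite ltr0n /=.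
by have -> : Num.sqrt (5 : R) = 0; [lra|rewrite ltxx].
Qed.

Let reduced_and_span : (forall n, qmul Q n n = 0 -> n = 0) /\
  exists k : 'I_7 -> K,
  oneX K = k (inord 0) *: sph 0 + k (inord 1) *: sph 1 + k (inord 2) *: sph 2
  + k (inord 3) *: sph 3 + k (inord 4) *: qmul Q (sph 0) (sph 0)
  + k (inord 5) *: vp + k (inord 6) *: vm.
Proof.
have [r hr] := w_rational.
have np : w 0 != lam valp.
  rewrite hr; apply: lam_neq => /esym; rewrite valpE; apply: quadratic_irrational.
  by [].
have nm : w 0 != lam valm.
  rewrite hr; apply: lam_neq => /esym; rewrite valmE; apply: quadratic_irrational.
  by [].
have c_sph' i : qmul Q c (sph i) = w 0 *: sph i by rewrite c_sph w0.
have dimV : \dim {: 'rV[K]_7} = 7 by rewrite dimvf.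
have five : (5 : K) != 0 by rewrite (nov_natr_eq0 N).
split.
  exact: (@frob_reduced _ _ (qmul Q) (oneX K) (@pairX K) (fun a x y z => qmul_linl z a x y) qmulC (qmulA hQ) qmul1
    (fun a x y z => pairX_linl z a x y) qmul_assoc_pair (@pairX_nondeg K) c vp vm (fun i => sph i)
    (w 0) (lam valp) (lam valm) dimV five two c_sph' c_vp c_vm vp0 vm0 np nm (lam_neq val_neq) pairX_sphere
    (fun i => pairX_h2X1 _) nils).
exact: (@frob_span _ _ (qmul Q) (oneX K) (@pairX K) (fun a x y z => qmul_linl z a x y) qmulC (qmulA hQ) qmul1
    (fun a x y z => pairX_linl z a x y) qmul_assoc_pair c vp vm (fun i => sph i)
    (w 0) (lam valp) (lam valm) dimV five two c_sph' c_vp c_vm vp0 vm0 np nm (lam_neq val_neq) pairX_sphere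
    (fun i => pairX_h2X1 _)).
Qed.

Lemma quantum_span : exists k : 'I_7 -> K,
  oneX K = k (inord 0) *: sph 0 + k (inord 1) *: sph 1 + k (inord 2) *: sph 2
  + k (inord 3) *: sph 3 + k (inord 4) *: qmul Q (sph 0) (sph 0)
  + k (inord 5) *: vp + k (inord 6) *: vm.
Proof. by case: reduced_and_span. Qed.

Lemma quantum_semisimple : semisimple_QH Q.
Proof.
move=> I hI; have [red _] := reduced_and_span.
exact: (@reduced_ideal_complement _ _ (qmul Q) (@pairX K) qmulC
    (fun a x y z => pairX_linl z a x y) (@pairXC K) qmul_assoc_pair (@pairX_nondeg K) I red hI).
Qed.

End QuantumRing.

(** In the rank factorization M = C R, the matrix C is left cancellable and R right cancellable, so
    M^2 = 0 forces R C = 0; the trace of C R is that of R C. *)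
Lemma trace_square_zero (K : fieldType) n (M : 'M[K]_n) : M *m M = 0 -> \tr M = 0.
Proof.
rewrite -{1 2}(mulmx_base M) => h.
have : row_base M *m col_base M = 0.
  apply: (row_free_inj (row_base_free M)); rewrite mul0mx.
  apply: (row_full_inj (col_base_full M)); rewrite mulmx0.
  by rewrite -h !mulmxA.
by move=> e; rewrite -(mulmx_base M) mxtrace_mulC e linear0.
Qed.

Lemma multilinear0 (K : fieldType) (Ob : Type) (H : Ob -> Ob -> vectType K)
    (f : forall A B, chain H A B -> H A B) (h : multilinear f) A B D (q : chain H B D) :
  f _ _ (hcons (0 : H A B) q) = 0.
Proof.
have := h _ _ _ _ (hnil A) q (-1) 0 0.
by rewrite /= scaler0 add0r scaleN1r addNr.
Qed.

(** * Open-closed maps *)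

Section OpenClosed.
Variables (R : realType) (K : fieldType) (N : novikov R K).
Variables (Q : quantum_data K) (hQ : quantum_axioms N Q).
Variables (F : lfamily R) (hF : lfamily_axioms N F).
Variables (A : fukaya N F) (hA : fukaya_axioms A).
Variables (O : open_closed A) (hO : open_closed_axioms Q O).
Notation C := (fk_cat A).
Notation H := (Defs.hom C).
Notation c := (h2X K c1X).
Let hC : ainf_axioms C := fk_ainf hA.
Let two : (2 : K) != 0. Proof. by rewrite (nov_natr_eq0 N). Qed.

Lemma q0_even x X : has_par false (q0 O x X).
Proof. exact: (oc_q_par hO x (hnil X)). Qed.

Lemma q0_closed x X : m1 (q0 O x X) = 0.
Proof.
have := oc_q_closed hO x (hnil X).
rewrite /hh_diff /= ?(big_cons, big_nil) /cfst /csnd /= ?(big_cons, big_nil) /=.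
by rewrite (mm_nil hC) (multilinear0 (oc_q_mul hO x)) scaler0 subr0 !addr0.
Qed.

(** In length 0 the Hochschild coboundary reduces to m_1 of the length 0 component, because m_0 =
    0. *)
Lemma hh_eq0 (phi phi' : cochain C) X : hh_eq phi phi' ->
  exists h, phi _ _ (hnil X) = phi' _ _ (hnil X) + m1 h.
Proof.
move=> [psi [hm _ /(_ _ _ (hnil X))]].
rewrite /hh_diff /= ?(big_cons, big_nil) /cfst /csnd /= ?(big_cons, big_nil) /=.
rewrite (mm_nil hC) (multilinear0 hm) scaler0 subr0 !addr0 => e.
by exists (psi _ _ (hnil X)); apply/eqP; rewrite addrC -subr_eq; apply/eqP.
Qed.

Lemma q0M x y X : exists h, q0 O (qmul Q x y) X = m2 (q0 O x X) (q0 O y X) + m1 h.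
Proof.
have [h e] := hh_eq0 X (oc_qM hO x y); exists h; apply: (etrans e); congr (_ + _).
rewrite /hh_cup /= ?(big_cons, big_nil) /cfst /csnd /= ?(big_cons, big_nil) /cfst /csnd /=.
by rewrite ?(big_cons, big_nil) /= ?(big_cons, big_nil) /= !addr0.
Qed.

Lemma q0_1 X : exists h, q0 O (oneX K) X = Defs.unit C X + m1 h.
Proof. exact: (hh_eq0 X (oc_q1 hO)). Qed.

Lemma p0_adj x X (w : H X X) : pairX x (p0 O w) = cyc (q0 O x X) w.
Proof.
rewrite /p0 (oc_p_adj hO) /= -(big_morph _ (fun a b => cycDr hC _ a b) (cyc0r hC _)).
by rewrite (hpartE two).
Qed.

Lemma pairX_p0_1 X (w : H X X) : m1 w = 0 -> pairX (oneX K) (p0 O w) = cyc (Defs.unit C X) w.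
Proof.
by move=> hw; have [h e] := q0_1 X; rewrite p0_adj e (cycDl hC) (cyc_exact hC two) ?addr0.
Qed.

(** Adjunction between [p0] and the ring map [q0]: tested on y, the left side is the pairing of q(y)
    q(x) with the unit, that is, of q(y) with q(x). *)
Lemma qmul_p0_unit x X : qmul Q x (p0 O (Defs.unit C X)) = p0 O (q0 O x X).
Proof.
apply/eqP; rewrite -subr_eq0; apply/eqP/pairX_nondeg => y.
rewrite pairXC (linB (@pairX_linr _ y)) -(qmul_assoc_pair hQ) !p0_adj.
have [h ->] := q0M y x X; rewrite (cycDl hC) (cyc_exact hC two) ?(unit_m1 hC) // addr0.
by rewrite (cyc_m2_unit hC) ?subrr.
Qed.

(** The same adjunction; the boundary term of q(x) stays a boundary after multiplication by the
    closed q(y), so it pairs to 0 with [w]. *)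
Lemma qmul_p0_eigen x X a (w : H X X) : (exists h, q0 O x X = a *: Defs.unit C X + m1 h) ->
  m1 w = 0 -> qmul Q x (p0 O w) = a *: p0 O w.
Proof.
move=> [h e] hw; apply/eqP; rewrite -subr_eq0; apply/eqP/pairX_nondeg => y.
rewrite pairXC (linB (@pairX_linr _ y)) (linZ (@pairX_linr _ y)) -(qmul_assoc_pair hQ) !p0_adj.
have [h' ->] := q0M y x X; rewrite (cycDl hC) (cyc_exact hC two) // addr0 e.
rewrite (m2Dr hC) (m2Zr hC) (unit_r hC) (cycDl hC) (cycZl hC).
have par : tau (q0 O y X) = q0 O y X by have := q0_even y X; rewrite /has_par scale1r.
have -> : m2 (q0 O y X) (m1 h) = m1 (m2 (q0 O y X) h).
  by rewrite (m1m2 hC) q0_closed (m20l hC) oppr0 sub0r /kos par (linN (@m2_linl _ _ _ hC _ _ _ _)) opprK.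
by rewrite (cyc_exact hC two) // addr0 par subrr.
Qed.

(** * Endomorphisms of an object supported on one Lagrangian *)

Section Lagrangian.
Variables (i : lf_idx F) (b : mc N (lf_lag i)).
Notation L := (lf_lag i).
Let hL : lagrangian_axioms L := lf_lagP hF i.

Let eta (beta : lg_H2 L) : R[i] := (lg_mu L beta)%:~R / 2.
Let eta_additive : zmod_morphism eta.
Proof. by move=> x y; rewrite /eta raddfB rmorphB mulrBl. Qed.

Hypothesis hb : cohdeg 1 (mc_b b).

(* Half the Maslov class lifts c_1 to H^2(X, L), and the degree of m_{s,beta}
   leaves only disks of Maslov index 2 in the component along the unit. *)
Lemma q0_c1 : exists h, q0 O c (fob b) = mc_W b *: Defs.unit C (fob b) + m1 h.
Proof.
pose eM := GRing.isZmodMorphism.Build _ _ eta eta_additive.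
pose etaA : {additive lg_H2 L -> R[i]} := HB.pack eta eM.
have hc al : pairX (h2X R[i] c1X) (h2X R[i] al) = etaA (lg_j L al).
  rewrite /= /eta (lg_muj hL) -!(map_h2X (intr : {rmorphism int -> R[i]})) map_pairX /=.
  by rewrite -/(c1num al) rmorphM /= mulrC mulKf // pnatr_eq0.
have [k /h2X_neq0 //|v hv /memv_imgP [h _]] := oc_q_rel hO b _ hc.
rewrite linfunE; last exact: m1_lin.
rewrite map_h2X => e; exists h; rewrite -e (fk_unit hA) -linearZ /=.
suff -> : v = mc_W b *: oneL N L by rewrite addrC subrK.
apply/rowP => k; rewrite mxE; have [hol _ _ hW] := mcP b.
have deg s beta : disk_term N (mc_rho b) beta (nseq s (mc_b b)) 0 k != 0 ->
    (lg_deg k)%:Z = 2 - lg_mu L beta.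
  rewrite mxE mulf_eq0 negb_or => /andP[_].
  apply: mlext_deg => // t l /(lg_m_deg hL) ->; move: (\sum_(_ <- t) _) => S; ring.
apply: (nov_sum_uniq (hv k)).
have [k0|k0] := eqVneq (lg_deg k) 0%N.
  apply: nov_sum_ext (hW k) => -[s beta] /=.
  have [->|/deg] := eqVneq (disk_term N (mc_rho b) beta (nseq s (mc_b b)) 0 k) 0; first by rewrite mulr0.
  rewrite k0 => e0; have {e0} : lg_mu L beta = 2 by lia.
  by rewrite /eta => ->; rewrite divff ?pnatr_eq0 // rmorph1 mul1r.
have -> : oneL N L 0 k = 0.
  rewrite mxE; apply/eqP; rewrite fmorph_eq0; apply: contraT => /(lg_one_deg hL) e0.
  by rewrite e0 in k0.
rewrite mulr0; apply: (nov_sum_ext (F := fun=> 0)).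
  move=> -[s beta] /=.
  have [->|/deg] := eqVneq (disk_term N (mc_rho b) beta (nseq s (mc_b b)) 0 k) 0; first by rewrite mulr0.
  (* In degree 2 the Maslov index is 0, where [eta] vanishes; degree 1 would mean index 1, which is
     odd. *)
  have [d hd] := lg_mu_even hL beta; have := lg_deg_le hL k.
  move=> le e0; have {e0} : lg_mu L beta = 0 by move: k0 hd le e0; lia.
  by rewrite /eta => ->; rewrite mul0r rmorph0 mul0r.
by have := @nov_sum_fset _ _ N (nat * lg_H2 L)%type (fun=> 0) fset0; rewrite big1 //; apply.
Qed.

Lemma qmul_c1_p0 (w : H (fob b) (fob b)) : m1 w = 0 ->
  qmul Q c (p0 O w) = mc_W b *: p0 O w.
Proof. exact: qmul_p0_eigen q0_c1. Qed.

Lemma same_refl : mc_same b b. Proof. by []. Qed.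

Lemma unit_neq0 : Defs.unit C (fob b) != 0.
Proof.
rewrite (fk_unit hA); apply/eqP => e.
have : oneL N L = 0.
  by apply: (bij_inj (fk_cls_bij hA same_refl)); rewrite e linear0.
move=> /rowP e0; have /negP := lg_one_neq0 hL; apply; apply/eqP/rowP => k.
by have /eqP := e0 k; rewrite !mxE fmorph_eq0 => /eqP.
Qed.

(** The odd cohomology of a surface is concentrated in degree 1. *)
Lemma odd_cls (x : H (fob b) (fob b)) : has_par true x ->
  exists2 x', cohdeg 1 x' & x = fk_cls A b b x'.
Proof.
have bij := fk_cls_bij hA same_refl; have [g _ gK] := bij.
move=> hx; exists (g x); rewrite ?gK // => k hk.
have : \row_k ((-1) ^+ lg_deg k * g x 0 k) = - g x.
  by apply: (bij_inj bij); rewrite -(fk_cls_par hA) ?linearN /= ?gK // hx expr1 scaleN1r.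
move=> /rowP/(_ k); rewrite !mxE -signr_odd; have := lg_deg_le hL k.
case: (lg_deg k) => [|[|[|]]] //= _; rewrite expr0 mul1r => /eqP; rewrite -addr_eq0 -mulr2n -mulr_natl.
all: by rewrite mulf_eq0 (negPf two) (negPf hk).
Qed.

Section CriticalPoint.
Variables (g1 g2 : lg_H1 L) (hmon : is_monotone L) (hg : is_H1_basis g1 g2).
Variables (w : lpoly) (hW : has_potential N g1 g2 w) (e : R[i]) (hcrit : is_crit g1 g2 w b e).

(** On a class of degree 1, m_1 is the derivative of the potential in that direction times the
    unit. *)
Lemma m1_crit (x : H (fob b) (fob b)) : has_par true x -> m1 x = 0.
Proof.
move=> /odd_cls [x' hx' ->]; have [_ [y1 [y2 [hy1 hy2 d1 d2 _]]]] := hcrit.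
have [//|[|//] _ //|v hv] := @fk_m _ _ _ _ _ hA i b [:: (b, x')].
rewrite /m1 => ->.
rewrite (@potential_derivative _ _ _ _ hL hmon (lf_potP hF (i:=i)) _ _ hg _ hW b hb _ _ hy1 hy2 x' v hx' hv).
by rewrite d1 d2 !mulr0 addr0 mulr0 scale0r linear0.
Qed.

(** Otherwise <1_X, p(y)> = <1_L, y> would vanish on all cocycles and 1_L would be a boundary. A
    primitive could be taken odd, but odd elements are closed here. *)
Lemma crit_eigenvector : exists2 w : H (fob b) (fob b), has_par false w /\ m1 w = 0 &
  p0 O w != 0.
Proof.
apply: contrapT => hn.
have [|x hx] := exactP hC two (x := Defs.unit C (fob b)).
  move=> y hy; rewrite -(hpartE two y) big_bool (cycDr hC).
  rewrite [X in X + _](cyc_has_par hC two (unit_par hC _) (hpart_par hC true y)) // add0r.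
  apply: contrapT => /eqP ne; apply: hn; exists (hpart false y).
    by split; [exact: hpart_par|exact: hpart_closed].
  apply: contraNneq ne => e0; rewrite -pairX_p0_1; last exact: hpart_closed.
  by rewrite e0 (lin0 (@pairX_linr _ _)).
have /negP := unit_neq0; apply.
rewrite -(hpart_id two (unit_par hC _)) hx (hpart_m1 hC) m1_crit //.
exact: hpart_par.
Qed.

Lemma crit_value : mc_W b = novT N 1 * novC N e.
Proof.
have [_ [y1 [y2 [hy1 hy2 _ _ <-]]]] := hcrit.
exact: (@potential_value _ _ _ _ hL hmon (lf_potP hF (i:=i)) _ _ hg _ hW b hb _ _ hy1 hy2).
Qed.

End CriticalPoint.

Section Sphere.
Hypothesis hS : is_sphere L.

Lemma sphere_deg (k : 'I_(lg_dim L)) : ~~ odd (lg_deg k).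
Proof.
have [_ _ b1 _] := hS; have := lg_deg_le hL k.
case e: (lg_deg k) => [|[|[|]]] // _.
by have /card0_eq/(_ k) := b1; rewrite inE e.
Qed.

Lemma sphere_even (x : H (fob b) (fob b)) : has_par false x.
Proof.
have [g _ gK] := fk_cls_bij hA same_refl; rewrite -[x]gK /has_par (fk_cls_par hA) // scale1r.
congr (fk_cls A b b _); apply/rowP => k.
by rewrite mxE -signr_odd (negPf (sphere_deg k)) mul1r.
Qed.

(** m_1 changes parity, while all of hom(S, S) is even because H^1 of a sphere vanishes. *)
Lemma sphere_m1 (x : H (fob b) (fob b)) : m1 x = 0.
Proof.
have := has_par_m1 hC (sphere_even x); rewrite /has_par (sphere_even (m1 x)) /= expr0 expr1 scale1r scaleN1r.
move/eqP; rewrite -addr_eq0 -mulr2n -scaler_nat scaler_eq0 (negPf two).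
by move/eqP.
Qed.

(* The pairing is the trace of the multiplication by q([n]) on hom(S, S), where
   m_1 vanishes; this operator has square zero. *)
Lemma sphere_nilpotent n : qmul Q n n = 0 ->
  pairX (qmul Q n (h2X K (lg_class L))) (h2X K (lg_class L)) = 0.
Proof.
move=> nn; rewrite -(oc_p_unit hO b) qmul_p0_unit.
rewrite (oc_mukai hO (q0_even n _) (unit_par hC _) (q0_closed _ _) (unit_m1 hC _)).
set x := q0 O n (fob b).
have xx : m2 x x = 0.
  have [h] := q0M n n (fob b); rewrite nn sphere_m1 addr0 -/x => <-.
  have := oc_q_lin hO 0 0 0 (hnil (fob b)); rewrite scaler0 add0r scale0r add0r.
  by have := oc_q_lin hO (-1) 0 0 (hnil (fob b)); rewrite scaler0 add0r scaleN1r addNr.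
suff -> : strH (fun z : H (fob b) (fob b) => \sum_(c : bool) (-1) ^+ (false * c + false * false) *:
    hprod (hprod x (hpart c z)) (Defs.unit C (fob b))) = 0 by rewrite mulr0.
rewrite /strH.
(* With m_1 = 0 the cohomology is hom(S, S) itself, and the supertrace becomes the trace of a
   matrix. *)
have I0 : limg (lm1 C (fob b) (fob b)) = 0%VS.
  apply/eqP; rewrite -subv0; apply/subvP => y /memv_imgP [z _ ->].
  by rewrite linfunE ?sphere_m1 ?mem0v //; apply: m1_lin.
have ZT : lker (lm1 C (fob b) (fob b)) = fullv.
  apply/eqP; rewrite eqEsubv subvf; apply/subvP => y _.
  by rewrite memv_ker linfunE ?sphere_m1 //; apply: m1_lin.
have D0 : (fullv :\: 0)%VS = fullv :> {vspace H (fob b) (fob b)}.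
  by have := addv_diff (fullv : {vspace H (fob b) (fob b)}) 0; rewrite !addv0.
rewrite I0 ZT D0; set e := vbasis _.
have pi1 (y : H (fob b) (fob b)) : addv_pi1 fullv 0 y = y.
  have /addv_pi1_pi2 {2}<- : y \in (fullv + 0)%VS by rewrite addv0 memvf.
  by have := memv_pi2 fullv 0 y; rewrite memv0 => /eqP ->; rewrite addr0.
pose f (y : H (fob b) (fob b)) : H (fob b) (fob b) := m2 x y; have fl : linear f := @m2_linr _ _ _ hC _ _ _ x.
have ff y : f (f y) = 0.
  have := m2A hC (q0_closed n _) (q0_closed n _) (sphere_m1 y) (sphere_m1 _).
  by rewrite -/x xx (m20l hC) /kos (sphere_even x) scale1r (linN (@m2_linl _ _ _ hC _ _ _ _)) opprK.
pose M := \matrix_(i, j) coord e j (f (tnth e i)).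
have row_f y : f y = \sum_j coord e j (f y) *: tnth e j.
  by rewrite [LHS](coord_vbasis (memvf _)); apply: eq_bigr => j _; rewrite -tnth_nth.
have MM : M *m M = 0.
  apply/matrixP => k l; rewrite !mxE; transitivity (coord e l (f (f (tnth e k)))); last by rewrite ff linear0.
  rewrite [f (tnth e k)]row_f (big_morph _ (linD fl) (lin0 fl)) linear_sum.
  by apply: eq_bigr => j _; rewrite (linZ fl) linearZ !mxE.
transitivity (\tr M); last exact: trace_square_zero. 
apply: eq_bigr => j _.
rewrite pi1 (mukai_integrand hC two _ (q0_even n _) (unit_par hC _)) (unit_r hC) mxE.
by have := sphere_even (m2 x (tnth e j)); rewrite /has_par scale1r => ->.
Qed.

End Sphere.

End Lagrangian.

(** The condition is linear in [v], so it may be checked on spanning vectors in the image of p; at v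
    = 1_X for every [B] it yields split generation. *)
Definition resolves (P : fobj N F -> Prop) B (v : 'rV[K]_7) : Prop :=
  exists2 q : H B B, factors P q & forall y : H B B, has_par false y -> m1 y = 0 ->
    pairX v (p0 O y) = cyc q y.

Lemma resolvesD P B u v : resolves P B u -> resolves P B v -> resolves P B (u + v).
Proof.
move=> [q fq hq] [r fr hr]; exists (q + r); first exact: factorsD.
by move=> y ey cy; rewrite (linD (@pairX_linl _ _)) (cycDl hC) hq ?hr.
Qed.

Lemma resolvesZ P B a v : resolves P B v -> resolves P B (a *: v).
Proof.
move=> [q fq hq]; exists (a *: q); first exact: factorsZ.
by move=> y ey cy; rewrite (linZ (@pairX_linl _ _)) (cycZl hC) hq.
Qed.

(* By the compatibility with the Mukai pairing, <p(x), p(y)> is a supertrace on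
   hom(X, B), which a dual pair of bases turns into a pairing of [y] with a sum
   of products through [X]. *)
Lemma resolves_p0 (P : fobj N F -> Prop) B X (x : H X X) : P X -> has_par false x -> m1 x = 0 ->
  resolves P B (p0 O x).
Proof.
move=> PX ex cx; have [q fq hq] := @strH_factors _ _ _ hC two P X B x PX ex cx.
exists (- (-1) ^+ oc_sigma O false *: q); first exact: factorsZ.
by move=> y ey cy; rewrite (oc_mukai hO ex ey cx cy) hq // (cycZl hC).
Qed.

Lemma resolves_split_generates (P : fobj N F -> Prop) :
  (forall B, resolves P B (oneX K)) -> split_generates C P.
Proof.
move=> h; apply: (split_generates_obj hC) => B; have [q fq hq] := h B.
by apply: (obj_genP hC two fq) => y ey cy; rewrite -hq // pairX_p0_1.
Qed.

End OpenClosed.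

Theorem theorem1p5 (R : realType) (Lam : closedFieldType) (N : novikov R Lam)
    (* quantum cohomology of X *)
    (Q : quantum_data Lam) (hQ : quantum_axioms N Q)
    (* the family of Lagrangians, its Fukaya category, the open-closed maps *)
    (F : lfamily R) (hF : lfamily_axioms N F)
    (A : fukaya N F) (hA : fukaya_axioms A)
    (O : open_closed A) (hO : open_closed_axioms Q O)
    (* the spheres S_1, ..., S_4 and the objects (S_i, 0) *)
    (S : 'I_4 -> lf_idx F)
    (hS : forall i, is_sphere (lf_lag (S i)))
    (hSclass : forall i, lg_class (lf_lag (S i)) = sphere_class i)
    (bS : forall i, mc N (lf_lag (S i)))
    (hbS : forall i, mc_b (bS i) = 0)
    (* the monotone torus L and the critical points b_1, b_2 of its potential *)
    (L : lf_idx F)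
    (hLtorus : is_torus (lf_lag L)) (hLmon : is_monotone (lf_lag L))
    (g1 g2 : lg_H1 (lf_lag L)) (hg : is_H1_basis g1 g2)
    (hW : has_potential N g1 g2 potX)
    (b1 b2 : mc N (lf_lag L))
    (hb1 : is_crit g1 g2 potX b1 ((5 + 5 * Num.sqrt 5) / 2)%:C)
    (hb2 : is_crit g1 g2 potX b2 ((5 - 5 * Num.sqrt 5) / 2)%:C) :
  split_generates (fk_cat A)
    (fun X => [\/ exists i, X = fob (bS i), X = fob b1 | X = fob b2]) /\
  semisimple_QH Q.
Proof.
pose P := fun X => [\/ exists i, X = fob (bS i), X = fob b1 | X = fob b2].
(* [cohdeg 1] is vacuous for the zero cochain, so the degree argument for c_1 covers the spheres as
   well. *)
have hb0 i : cohdeg 1 (mc_b (bS i)) by move=> k; rewrite hbS mxE eqxx.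
have sphE i : p0 O (Defs.unit (fk_cat A) (fob (bS i))) = h2X Lam (sphere_class i).
  by rewrite (oc_p_unit hO) hSclass.
have hC := fk_ainf hA.
have [[hc1 _] [hc2 _]] := (hb1, hb2).
have [w1 [ew1 cw1] v1] := crit_eigenvector hF hA hO hc1 hLmon hg hW hb1.
have [w2 [ew2 cw2] v2] := crit_eigenvector hF hA hO hc2 hLmon hg hW hb2.
have c_sph i : qmul Q (h2X Lam c1X) (h2X Lam (sphere_class i)) =
    mc_W (bS i) *: h2X Lam (sphere_class i).
  by rewrite -sphE (qmul_c1_p0 hQ hF hA hO) // unit_m1.
have c_1 := qmul_c1_p0 hQ hF hA hO hc1 cw1; rewrite (crit_value hF hc1 hLmon hg hW hb1) in c_1.
have c_2 := qmul_c1_p0 hQ hF hA hO hc2 cw2; rewrite (crit_value hF hc2 hLmon hg hW hb2) in c_2.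
have nils n i : qmul Q n n = 0 ->
    pairX (qmul Q n (h2X Lam (sphere_class i))) (h2X Lam (sphere_class i)) = 0.
  rewrite -hSclass; apply: (sphere_nilpotent hQ hF hA hO (bS i) (hS i)).
split; last exact: (quantum_semisimple hQ c_sph c_1 c_2 v1 v2 nils).
apply: (resolves_split_generates hA hO) => B; rewrite -/P.
have [k ->] := quantum_span hQ c_sph c_1 c_2 v1 v2 nils.
have rP X x : P X -> has_par false x -> m1 x = 0 -> resolves O P B (p0 O x) :=
  @resolves_p0 _ _ _ _ _ _ hA _ hO P B X x.
have PS i : P (fob (bS i)) by apply: Or31; exists i.
have rS i : resolves O P B (h2X Lam (sphere_class i)).
  by rewrite -sphE; apply: rP; [exact: PS|exact: unit_par|exact: unit_m1].
apply: (resolvesD hA); last by apply: (resolvesZ hA); apply: rP => //; apply: Or33.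
apply: (resolvesD hA); last by apply: (resolvesZ hA); apply: rP => //; apply: Or32.
apply: (resolvesD hA); last first.
  (* The square of s_1 is s_1 times p(1), that is p(q(s_1)): it also comes from the object S_1. *)
  apply: (resolvesZ hA); rewrite -{2}sphE (qmul_p0_unit hQ hA hO).
  by apply: rP; [exact: PS|exact: (q0_even hO)|exact: (q0_closed hA hO)].
by do 3 (apply: (resolvesD hA); last exact/(resolvesZ hA)/rS); exact/(resolvesZ hA)/rS.
Qed.
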